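(* Let $N=p_1\cdots p_r$ be a square-free positive integer with $r$ distinct prime factors. Define the constant $\ell_N$ by $$\ell_N=2^{1-r}\,\mathrm{lcm}\Big(4,\ 2^{r-1}\frac{24}{(24,\sigma(N))}\Big).$$ Then the function $$\Delta_N(z):=\left(\prod_{v\mid N}\eta(vz)\right)^{\ell_N}$$ is a weight $k_N=2^{r-1}\ell_N$ holomorphic form on $\Gamma_0(N)^+$ vanishing only at the cusp.
   Context: $\mathbb{H}$ is the upper half plane and $e(z)=e^{2\pi i z}$. For a square-free positive integer $N$, $$\Gamma_0(N)^+=\left\{ e^{-1/2}\begin{pmatrix} a & b\\ c& d\end{pmatrix}\in \mathrm{SL}(2,\mathbb{R}):\ ad-bc=e,\ a,b,c,d,e\in\mathbb{Z},\ e\mid N,\ e\mid a,\ e\mid d,\ N\mid c\right\}$$ (with $e>0$). It has exactly one cusp, at $i\infty$. A weight $k$ holomorphic form on $\Gamma_0(N)^+$ is a holomorphic function $f$ on $\mathbb{H}$ with $f(\gamma z)=(cz+d)^{k}f(z)$ for all $\gamma=\begin{pmatrix} *&*\\ c&d\end{pmatrix}\in\Gamma_0(N)^+$ (no character) and with a $q$-expansion ($q=e(z)$) having at most finitely many negative powers of $q$. $(\cdot,\cdot)$ is the greatest common divisor, $\mathrm{lcm}$ the least common multiple, $\sigma(N)$ the sum of positive divisors of $N$, $v$ runs over positive divisors of $N$, and $\eta(z)=e(z/24)\prod_{n=1}^\infty(1-e(nz))$ is the Dedekind eta function. *)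

(* Defs.v *)
From Stdlib Require Import Reals List ZArith Arith Znumtheory Lia Lra.
From Coquelicot Require Import Coquelicot.
Import ListNotations.

Open Scope R_scope.

Definition divisors (N : nat) : list nat :=
  filter (fun v => (N mod v =? 0)%nat) (seq 1 N).

Definition sigma (N : nat) : nat := list_sum (divisors N).

(* 2^(r-1) * 24 / (24, sigma N).  The exponent is -1 when r = 0, so the power
   of two is taken to be 2^r and the result is halved; no division below loses
   a remainder when r is the number of prime factors of a square-free N
   (see [ellN_spec]). *)
Definition twoN (r N : nat) : nat :=
  (2 ^ r * (24 / Nat.gcd 24 (sigma N)) / 2)%nat.

Definition ellN (r N : nat) : nat :=
  (2 * Nat.lcm 4 (twoN r N) / 2 ^ r)%nat.

Definition weightN (r N : nat) : nat := (2 ^ r * ellN r N / 2)%nat.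

Lemma ellN_spec (ps : list nat) :
  let r := length ps in
  let N := fold_right Nat.mul 1%nat ps in
  INR (twoN r N) =
    powerRZ 2 (Z.of_nat r - 1) * (24 / INR (Nat.gcd 24 (sigma N))) /\
  INR (ellN r N) =
    powerRZ 2 (1 - Z.of_nat r) * INR (Nat.lcm 4 (twoN r N)) /\
  INR (weightN r N) = powerRZ 2 (Z.of_nat r - 1) * INR (ellN r N).
Proof.
destruct ps as [|p ps].
- assert (E1 : twoN 0 1 = 12%nat) by reflexivity.
  assert (E2 : ellN 0 1 = 24%nat) by reflexivity.
  assert (E3 : weightN 0 1 = 12%nat) by reflexivity.
  assert (E4 : Nat.lcm 4 12 = 12%nat) by reflexivity.
  assert (E5 : Nat.gcd 24 (sigma 1) = 1%nat) by reflexivity.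
  cbv zeta. change (length (@nil nat)) with 0%nat.
  change (fold_right Nat.mul 1%nat nil) with 1%nat.
  rewrite E1, E2, E3, E4, E5. simpl. repeat split; lra.
- cbv zeta. change (length (p :: ps)) with (S (length ps)).
  generalize (fold_right Nat.mul 1%nat (p :: ps)); intro N.
  generalize (length ps); intro s.
  set (g := Nat.gcd 24 (sigma N)).
  assert (g0 : g <> 0%nat).
  { intro H. apply Nat.gcd_eq_0_l in H. discriminate. }
  destruct (Nat.gcd_divide_l 24 (sigma N)) as [m Hm]; fold g in Hm.
  assert (p0 : (2 ^ s)%nat <> 0%nat) by (apply Nat.pow_nonzero; lia).
  assert (Em : (24 / g)%nat = m) by (rewrite Hm; apply Nat.div_mul; exact g0).
  assert (T : twoN (S s) N = (2 ^ s * m)%nat).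
  { unfold twoN; fold g; rewrite Em, Nat.pow_succ_r'.
    replace (2 * 2 ^ s * m)%nat with (2 ^ s * m * 2)%nat by ring.
    apply Nat.div_mul; discriminate. }
  destruct (Nat.divide_lcm_r 4 (2 ^ s * m)) as [t Ht].
  assert (L : ellN (S s) N = (t * m)%nat).
  { unfold ellN; rewrite T, Ht, Nat.pow_succ_r'.
    replace (2 * (t * (2 ^ s * m)))%nat with (t * m * (2 * 2 ^ s))%nat by ring.
    apply Nat.div_mul; lia. }
  assert (K : weightN (S s) N = (2 ^ s * (t * m))%nat).
  { unfold weightN; rewrite L, Nat.pow_succ_r'.
    replace (2 * 2 ^ s * (t * m))%nat with (2 ^ s * (t * m) * 2)%nat by ring.
    apply Nat.div_mul; discriminate. }
  assert (P0 : 2 ^ s <> 0) by (apply pow_nonzero; lra).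
  assert (G : 24 / INR g = INR m).
  { assert (Hr : 24 = INR m * INR g).
    { rewrite <- mult_INR, <- Hm. simpl; lra. }
    rewrite Hr at 1. field. apply not_0_INR; exact g0. }
  rewrite G, K, L, T, Ht.
  replace (Z.of_nat (S s) - 1)%Z with (Z.of_nat s) by lia.
  replace (1 - Z.of_nat (S s))%Z with (- Z.of_nat s)%Z by lia.
  rewrite powerRZ_neg', <- pow_powerRZ, !mult_INR, !pow_INR.
  replace (INR 2) with 2 by (simpl; lra).
  repeat split; field; exact P0.
Qed.

Definition Cexp (z : C) : C :=
  (exp (Re z) * cos (Im z), exp (Re z) * sin (Im z)).

Definition e (z : C) : C := Cexp (2 * PI * Ci * z)%C.

Definition UHP (z : C) : Prop := 0 < Im z.

Fixpoint Cprod (u : nat -> C) (n : nat) : C :=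
  match n with
  | O => 1%C
  | S m => (Cprod u m * u (S m))%C
  end.

(* The value is the limit of the partial products whenever it exists (as it
   does for [u n = 1 - e (n z)], z in the upper half plane). *)
Definition Cprod_inf (u : nat -> C) : C :=
  iota (T := C_CompleteNormedModule)
    (fun l : C => filterlim (Cprod u) eventually (locally l)).

Definition eta (z : C) : C :=
  (e (z / 24) * Cprod_inf (fun n => 1 - e (INR n * z)))%C.

Definition DeltaN (r N : nat) (z : C) : C :=
  (fold_right (fun v w : C => v * w)%C 1%C
     (map (fun v : nat => eta (INR v * z)%C) (divisors N)) ^ ellN r N)%C.

Record mat2 := Mat2 { m11 : R; m12 : R; m21 : R; m22 : R }.

Definition SL2R (g : mat2) : Prop := m11 g * m22 g - m12 g * m21 g = 1.

Definition Gamma0_plus (N : nat) (g : mat2) : Prop :=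
  SL2R g /\
  exists a b c d f : Z,
    (a * d - b * c = f)%Z /\ (0 < f)%Z /\
    (f | Z.of_nat N)%Z /\ (f | a)%Z /\ (f | d)%Z /\ (Z.of_nat N | c)%Z /\
    g = Mat2 (IZR a / sqrt (IZR f)) (IZR b / sqrt (IZR f))
             (IZR c / sqrt (IZR f)) (IZR d / sqrt (IZR f)).

Definition autfactor (g : mat2) (z : C) : C := (m21 g * z + m22 g)%C.

Definition moebius (g : mat2) (z : C) : C :=
  ((m11 g * z + m12 g) / autfactor g z)%C.

(* f(z) = sum_{n >= -m} c(n) q^n on the upper half plane, for some m. *)
Definition has_qexp (f : C -> C) (c : Z -> C) : Prop :=
  exists m : nat,
    (forall n : Z, (n < - Z.of_nat m)%Z -> c n = 0%C) /\
    (forall z : C, UHP z ->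
       is_series
         (fun j : nat =>
            let n := (Z.of_nat j - Z.of_nat m)%Z in (c n * e (IZR n * z))%C)
         (f z)).

Definition holomorphic_form (N k : nat) (f : C -> C) : Prop :=
  (forall z : C, UHP z -> ex_derive f z) /\
  (forall (g : mat2) (z : C), Gamma0_plus N g -> UHP z ->
     f (moebius g z) = (autfactor g z ^ k * f z)%C) /\
  (exists c : Z -> C, has_qexp f c).

(* The q-expansion has only positive powers of q, i.e. positive order at the
   cusp i*infinity, while f has no zero in the upper half plane. *)
Definition vanishes_only_at_cusp (f : C -> C) : Prop :=
  (exists c : Z -> C, has_qexp f c /\ forall n : Z, (n <= 0)%Z -> c n = 0%C) /\
  (forall z : C, UHP z -> f z <> 0%C).

(* Main.v *)
Require Import Defs.
From Stdlib Require Import Reals List ZArith Arith Znumtheory Permutation Bool Lia Lra Psatz.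
From Coquelicot Require Import Coquelicot.
Import ListNotations.

(** The idea of the proof.

    Holomorphy, absence of zeros and the q-expansion come from the product of
    eta: the factor q^(ell sigma(N) / 24) is a positive power of q, because 24
    divides ell sigma(N), and the remaining product of the 1 - q^(v j) is an
    absolutely convergent power series in q without zeros in the upper half
    plane.  The substance is the transformation law, and there the point is that
    no root of unity is left over.

    The inversion of eta ([eta_S]).  The logarithmic derivative of eta is, up to
    constants, the Eisenstein series of weight two, a sum over m of the terms
    1 / sin^2(pi m z).  Expanded in partial fractions, it becomes a double sum of
    the 1 / (m z + n)^2 that converges only conditionally.  After a telescoping
    term 1 / (w - 1/2) - 1 / (w + 1/2) has been subtracted, the rest can be
    summed by rows or by columns, and the telescoping terms leave a cotangent
    whose limit is the anomalous term pi i / z ([eisenstein2_S]).  Hence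
    eta (- 1 / z) / (sqrt z eta z) has derivative 0, and its value is read off at
    z = i.  The partial fractions themselves follow from the duplication formulas
    of 1 / sin^2 and cot by a dominated passage to the limit
    ([partial_fractions]).

    The multiplier ([eta_multiplier]).  For a matrix (a, b; c, d) of SL(2, Z) with
    odd d > 0 it is the quadratic symbol (c/d) times an explicit 24th root of
    unity.  This is proved by a Euclidean descent on d: the element (1 0; 1 1)
    changes c by d, and the inversion exchanges c and d at the cost of quadratic
    reciprocity.  The symbol is defined by the formula of Gauss's lemma, for which
    multiplicativity in the top and Eisenstein's proof of reciprocity work
    directly for composite moduli.

    The product ([Delta_modular]).  Let (a, b; c, d) / sqrt f belong to
    Gamma0(N)+, and let g = N / f.  For x | f and y | g, it moves the factor eta at
    ((f / x) y z) to the factor at (x y z) through an element of SL(2, Z), so that it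
    permutes the factors; the scalars sqrt (x / f) from the automorphy factors
    multiply up to the power of sqrt f that the normalisation requires.  The sum of
    the exponents of the multipliers vanishes modulo 24 after multiplication by ell
    ([total_exponent_24]).  The quadratic symbols are harmless when ell is even;
    when ell is odd there are at least three primes, so f or g has two of them,
    and the symbols cancel in fours ([jac_cancels]).  This settles odd f; for even
    f the cofactor g is odd, and the Fricke involution exchanges the two. *)

Open Scope Z_scope.

(** * The quadratic symbol *)

Definition half_range (d : Z) : list Z :=
  map Z.of_nat (seq 1 (Z.to_nat ((d - 1) / 2))).

Definition sumZ (l : list Z) (f : Z -> Z) : Z :=
  fold_right (fun x s => f x + s) 0 l.

Definition sgn_mods (d y : Z) : bool := Z.odd (2 * y / d).

(** Gauss's lemma taken as a definition: the parity of the number of x between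
    1 and (d - 1) / 2 for which the residue of c x modulo d exceeds d / 2.  For
    odd positive d coprime to c this is the Jacobi symbol, with [true] in the
    place of -1.  Periodicity and multiplicativity in c, and reciprocity, can be read
    off from this formula, for composite d as well as for prime d. *)
Definition jac (c d : Z) : bool :=
  Z.odd (sumZ (half_range d) (fun x => 2 * (c * x) / d)).

Lemma in_half_range d x : d mod 2 = 1 -> 0 < d ->
  In x (half_range d) <-> 1 <= x /\ 2 * x < d.
Proof.
  intros Hd Hp. unfold half_range. rewrite in_map_iff. split.
  - intros [n [<- Hn]]. apply in_seq in Hn.
    assert (0 <= (d-1)/2) by (apply Z.div_pos; lia).
    assert (d = 2 * ((d-1)/2) + 1) by (Z.to_euclidean_division_equations; lia). lia.
  - intros [H1 H2]. exists (Z.to_nat x). split; [lia|]. apply in_seq.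
    assert (0 <= (d-1)/2) by (apply Z.div_pos; lia).
    assert (d = 2 * ((d-1)/2) + 1) by (Z.to_euclidean_division_equations; lia). lia.
Qed.

Lemma NoDup_half_range d : NoDup (half_range d).
Proof.
  unfold half_range. apply FinFun.Injective_map_NoDup; [|apply seq_NoDup].
  intros x y H; lia.
Qed.

Lemma sumZ_ext l f g : (forall x, In x l -> f x = g x) -> sumZ l f = sumZ l g.
Proof.
  induction l as [|x l IH]; simpl; intros H; [reflexivity|].
  rewrite (H x), IH; auto.
Qed.

Lemma sumZ_plus l f g : sumZ l (fun x => f x + g x) = sumZ l f + sumZ l g.
Proof. induction l as [|x l IH]; simpl; lia. Qed.

Lemma sumZ_const l a : sumZ l (fun _ => a) = a * Z.of_nat (length l).
Proof. induction l as [|x l IH]; simpl length; simpl sumZ; lia. Qed.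

Lemma sumZ_swap l l' (f : Z -> Z -> Z) :
  sumZ l (fun x => sumZ l' (f x)) = sumZ l' (fun y => sumZ l (fun x => f x y)).
Proof.
  induction l as [|x l IH]; simpl.
  - rewrite sumZ_const; lia.
  - rewrite sumZ_plus, IH; reflexivity.
Qed.

Lemma sumZ_map l f (p : Z -> Z) : sumZ (map p l) f = sumZ l (fun x => f (p x)).
Proof. induction l as [|x l IH]; simpl; congruence. Qed.

Lemma sumZ_Permutation l l' f : Permutation l l' -> sumZ l f = sumZ l' f.
Proof. induction 1; simpl; lia. Qed.

Lemma odd_sumZ_ext l f g : (forall x, In x l -> Z.odd (f x) = Z.odd (g x)) ->
  Z.odd (sumZ l f) = Z.odd (sumZ l g).
Proof.
  induction l as [|x l IH]; simpl; intros H; [reflexivity|].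
  rewrite !Z.odd_add, (H x), IH; auto.
Qed.

Lemma length_half_range d : d mod 2 = 1 -> 0 < d ->
  Z.of_nat (length (half_range d)) = (d - 1) / 2.
Proof.
  intros Hd Hp. unfold half_range. rewrite length_map, length_seq.
  rewrite Z2Nat.id; [reflexivity|]. apply Z.div_pos; lia.
Qed.

Lemma sgn_mods_shift d y k : 0 < d -> sgn_mods d (y + k * d) = sgn_mods d y.
Proof.
  intros Hd. unfold sgn_mods.
  replace (2 * (y + k * d)) with (2 * y + (2 * k) * d) by ring.
  rewrite Z.div_add by lia. rewrite Z.odd_add, Z.odd_mul; simpl.
  apply xorb_false_r.
Qed.

Lemma sgn_mods_opp d y : d mod 2 = 1 -> 0 < d -> y mod d <> 0 ->
  sgn_mods d (- y) = negb (sgn_mods d y).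
Proof.
  intros Hd Hp Hy. unfold sgn_mods.
  assert (E : (2 * y) mod d <> 0).
  { intro H. apply Z.mod_divide in H; [|lia].
    apply Gauss in H.
    - apply Hy, Z.mod_divide; [lia|exact H].
    - apply Zgcd_1_rel_prime. rewrite Z.gcd_comm.
      assert (G : rel_prime 2 d).
      { apply prime_rel_prime; [apply prime_2|].
        intros G. apply Z.mod_divide in G; lia. }
      apply Zgcd_1_rel_prime; exact G. }
  replace (2 * - y) with (- (2 * y)) by ring.
  rewrite Z.div_opp_l_nz by (lia || exact E).
  rewrite Z.odd_sub, Z.odd_opp. simpl. now destruct (Z.odd _).
Qed.

Definition abs_mods (d y : Z) : Z :=
  if sgn_mods d y then d - y mod d else y mod d.

Lemma sgn_mods_spec d y : 0 < d ->
  sgn_mods d y = (d <=? 2 * (y mod d)).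
Proof.
  intros Hp. unfold sgn_mods.
  rewrite (Z.div_mod y d) at 1 by lia.
  replace (2 * (d * (y / d) + y mod d)) with (2 * (y mod d) + (2 * (y / d)) * d) by ring.
  rewrite Z.div_add by lia. rewrite Z.odd_add, Z.odd_mul, andb_false_l, xorb_false_r.
  pose proof (Z.mod_pos_bound y d Hp) as B.
  destruct (Z.leb_spec d (2 * (y mod d))) as [H|H].
  - replace (2 * (y mod d) / d) with 1; [reflexivity|].
    apply (Z.div_unique_pos _ _ _ (2 * (y mod d) - d)); lia.
  - rewrite Z.div_small by lia. reflexivity.
Qed.

Lemma abs_mods_spec d y : 0 < d ->
  exists k, y = (if sgn_mods d y then - abs_mods d y else abs_mods d y) + k * d.
Proof.
  intros Hp. pose proof (Z.div_mod y d ltac:(lia)) as E. unfold abs_mods.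
  destruct (sgn_mods d y).
  - exists (y / d + 1). lia.
  - exists (y / d). lia.
Qed.

Lemma coprime_mul_mod c d x : Z.gcd c d = 1 -> d mod 2 = 1 -> 0 < d ->
  - d < x < d -> (c * x) mod d = 0 -> x = 0.
Proof.
  intros Hg Hd Hp Hx H. apply Z.mod_divide in H; [|lia].
  apply Gauss in H; [|apply Zgcd_1_rel_prime; rewrite Z.gcd_comm; exact Hg].
  destruct H as [k Hk].
  assert (k < 1 /\ - 1 < k) by (split; apply Zmult_lt_reg_r with d; lia).
  assert (k = 0) by lia. subst; lia.
Qed.

Lemma abs_mods_range c d x : Z.gcd c d = 1 -> d mod 2 = 1 -> 0 < d ->
  In x (half_range d) -> In (abs_mods d (c * x)) (half_range d).
Proof.
  intros Hg Hd Hp Hx. apply in_half_range in Hx; auto. apply in_half_range; auto.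
  unfold abs_mods. rewrite sgn_mods_spec by lia.
  pose proof (Z.mod_pos_bound (c * x) d Hp) as B.
  assert ((c * x) mod d <> 0) by (intro H; apply (coprime_mul_mod c d x) in H; auto; lia).
  destruct (Z.leb_spec d (2 * ((c * x) mod d))); [|lia].
  split; [lia|].
  assert (2 * ((c * x) mod d) <> d) by (Z.to_euclidean_division_equations; lia). lia.
Qed.

Lemma abs_mods_inj c d x y : Z.gcd c d = 1 -> d mod 2 = 1 -> 0 < d ->
  In x (half_range d) -> In y (half_range d) ->
  abs_mods d (c * x) = abs_mods d (c * y) -> x = y.
Proof.
  intros Hg Hd Hp Hx Hy E.
  apply in_half_range in Hx; auto. apply in_half_range in Hy; auto.
  destruct (abs_mods_spec d (c * x) Hp) as [k Hk].
  destruct (abs_mods_spec d (c * y) Hp) as [l Hl].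
  rewrite <- E in Hl.
  assert (x - y = 0 \/ x + y = 0) as [H|H]; [|lia|lia].
  destruct (sgn_mods d (c * x)), (sgn_mods d (c * y)).
  1, 4: left; apply (coprime_mul_mod c d); auto; [lia|];
    replace (c * (x - y)) with ((k - l) * d) by lia; apply Z.mod_mul; lia.
  all: right; apply (coprime_mul_mod c d); auto; [lia|];
    replace (c * (x + y)) with ((k + l) * d) by lia; apply Z.mod_mul; lia.
Qed.

(** If c x and c y have the same residue up to sign then d divides x - y or
    x + y, which are too small unless x = y. *)
Lemma abs_mods_Permutation c d : Z.gcd c d = 1 -> d mod 2 = 1 -> 0 < d ->
  Permutation (map (fun x => abs_mods d (c * x)) (half_range d)) (half_range d).
Proof.
  intros Hg Hd Hp. apply NoDup_Permutation_bis.
  - assert (G : forall l, NoDup l -> incl l (half_range d) ->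
      NoDup (map (fun x => abs_mods d (c * x)) l)).
    { induction l as [|x l IH]; intros Hn Hi; simpl; constructor.
      - intro H. apply in_map_iff in H. destruct H as [y [E Hy]].
        apply abs_mods_inj in E; auto; try (apply Hi; simpl; auto).
        subst. inversion Hn; auto.
      - apply IH; [inversion Hn; auto|]. intros y Hy. apply Hi; simpl; auto. }
    apply G; [apply NoDup_half_range|apply incl_refl].
  - rewrite length_map; lia.
  - intros y Hy. apply in_map_iff in Hy. destruct Hy as [x [<- Hx]].
    now apply abs_mods_range.
Qed.

Lemma jac_shift c d k : 0 < d -> jac (c + k * d) d = jac c d.
Proof.
  intros Hd. unfold jac. apply odd_sumZ_ext. intros x _.
  pose proof (sgn_mods_shift d (c * x) (k * x) Hd) as E. unfold sgn_mods in E.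
  rewrite <- E. do 2 f_equal. ring.
Qed.

(** The element c2 x is, up to sign, another element of the half system; the
    signs met on the way from x to c1 c2 x add up. *)
Lemma jac_mul_top c1 c2 d : Z.gcd c1 d = 1 -> Z.gcd c2 d = 1 -> d mod 2 = 1 -> 0 < d ->
  jac (c1 * c2) d = xorb (jac c1 d) (jac c2 d).
Proof.
  intros H1 H2 Hd Hp. unfold jac.
  rewrite <- (sumZ_Permutation _ _ (fun x => 2 * (c1 * x) / d)
    (abs_mods_Permutation c2 d H2 Hd Hp)), sumZ_map, <- Z.odd_add, <- sumZ_plus.
  apply odd_sumZ_ext. intros x Hx.
  rewrite Z.odd_add.
  pose proof (abs_mods_range c2 d x H2 Hd Hp Hx) as Ha.
  set (y := abs_mods d (c2 * x)) in *.
  change (sgn_mods d (c1 * c2 * x) = xorb (sgn_mods d (c1 * y)) (sgn_mods d (c2 * x))).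
  destruct (abs_mods_spec d (c2 * x) Hp) as [k Hk]. fold y in Hk.
  apply in_half_range in Ha; auto.
  assert (N : (c1 * y) mod d <> 0).
  { intro H. apply (coprime_mul_mod c1 d) in H; auto; lia. }
  destruct (sgn_mods d (c2 * x)).
  - replace (c1 * c2 * x) with (- (c1 * y) + (c1 * k) * d).
    + rewrite sgn_mods_shift, sgn_mods_opp by assumption. now destruct (sgn_mods d (c1 * y)).
    + transitivity (c1 * (c2 * x)); [rewrite Hk|]; ring.
  - replace (c1 * c2 * x) with ((c1 * y) + (c1 * k) * d).
    + rewrite sgn_mods_shift by assumption. now destruct (sgn_mods d (c1 * y)).
    + transitivity (c1 * (c2 * x)); [rewrite Hk|]; ring.
Qed.

Lemma jac_opp c d : Z.gcd c d = 1 -> d mod 2 = 1 -> 0 < d ->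
  jac (- c) d = xorb (Z.odd ((d - 1) / 2)) (jac c d).
Proof.
  intros Hg Hd Hp. unfold jac.
  rewrite <- length_half_range by assumption.
  replace (Z.of_nat (length (half_range d))) with
    (sumZ (half_range d) (fun _ => 1)) by (rewrite sumZ_const; lia).
  rewrite <- Z.odd_add, <- sumZ_plus. apply odd_sumZ_ext. intros x Hx.
  apply in_half_range in Hx; auto.
  change (sgn_mods d (- c * x) = Z.odd (1 + 2 * (c * x) / d)).
  replace (- c * x) with (- (c * x)) by ring. rewrite sgn_mods_opp; auto.
  - rewrite Z.odd_add. unfold sgn_mods. now destruct (Z.odd _).
  - intro H. apply (coprime_mul_mod c d) in H; auto; lia.
Qed.

(** Summing c x = d floor(c x / d) + residue modulo 2: the least absolute
    residues are a permutation of the x, so that for odd c and d only the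
    quotients and the number of negative residues remain. *)
Lemma jac_floor c d : Z.gcd c d = 1 -> d mod 2 = 1 -> 0 < d -> c mod 2 = 1 ->
  jac c d = Z.odd (sumZ (half_range d) (fun x => c * x / d)).
Proof.
  intros Hg Hd Hp Hc.
  pose proof (sumZ_Permutation _ _ (fun x => x) (abs_mods_Permutation c d Hg Hd Hp)) as P.
  rewrite sumZ_map in P.
  assert (E : Z.odd (sumZ (half_range d) (fun x => x)) =
     Z.odd (sumZ (half_range d) (fun x => c * x / d + (2 * (c * x) / d + abs_mods d (c * x))))).
  { apply odd_sumZ_ext. intros x Hx.
    replace (Z.odd x) with (Z.odd (c * x)) by
      (rewrite Z.odd_mul; rewrite Zmod_odd in Hc; destruct (Z.odd c); [reflexivity|discriminate]).
    rewrite (Z.div_mod (c * x) d) at 1 by lia.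
    assert (Od : Z.odd d = true) by (rewrite Zmod_odd in Hd; destruct (Z.odd d); [reflexivity|discriminate]).
    unfold abs_mods. fold (sgn_mods d (c * x)).
    rewrite !Z.odd_add, Z.odd_mul. rewrite Od.
    change (Z.odd (2 * (c * x) / d)) with (sgn_mods d (c * x)).
    destruct (sgn_mods d (c * x)).
    - rewrite Z.odd_sub, Od. destruct (Z.odd ((c * x) / d)), (Z.odd ((c * x) mod d)); reflexivity.
    - destruct (Z.odd ((c * x) / d)), (Z.odd ((c * x) mod d)); reflexivity. }
  rewrite !sumZ_plus, !Z.odd_add in E. rewrite P in E.
  unfold jac.
  destruct (Z.odd (sumZ (half_range d) (fun x => x))),
   (Z.odd (sumZ (half_range d) (fun x => c * x / d))),
   (Z.odd (sumZ (half_range d) (fun x => 2 * (c * x) / d))); simpl in E; congruence.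
Qed.

Lemma sumZ_seq_lt (n : nat) (P : Z -> bool) (k : Z) :
  0 <= k <= Z.of_nat n ->
  (forall y, 1 <= y <= Z.of_nat n -> P y = true <-> y <= k) ->
  sumZ (map Z.of_nat (seq 1 n)) (fun y => if P y then 1 else 0) = k.
Proof.
  revert k. induction n as [|n IH]; intros k Hk HP.
  - simpl. lia.
  - rewrite seq_S, map_app.
    assert (A : forall l l' f, sumZ (l ++ l') f = sumZ l f + sumZ l' f).
    { induction l as [|x l IHl]; intros; simpl; [reflexivity|]. rewrite IHl; lia. }
    rewrite A. cbn [map]. unfold sumZ at 2. cbn [fold_right].
    assert (D : k = Z.of_nat (S n) \/ k <= Z.of_nat n) by lia.
    replace (Z.of_nat (1 + n)) with (Z.of_nat (S n)) by lia.
    destruct D as [D|D].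
    + replace (P (Z.of_nat (S n))) with true by (symmetry; apply HP; lia).
      rewrite (IH (k - 1)); [lia|lia|].
      intros y Hy. rewrite HP by lia. lia.
    + replace (P (Z.of_nat (S n))) with false.
      * rewrite (IH k); [lia|lia|]. intros y Hy. rewrite HP by lia. lia.
      * symmetry. apply not_true_is_false. intros H. apply HP in H; lia.
Qed.

Lemma floor_count c d x : Z.gcd c d = 1 -> d mod 2 = 1 -> 0 < d -> c mod 2 = 1 -> 0 < c ->
  In x (half_range d) ->
  c * x / d = sumZ (half_range c) (fun y => if d * y <? c * x then 1 else 0).
Proof.
  intros Hg Hd Hp Hc Hcp Hx. apply in_half_range in Hx; auto.
  unfold half_range. symmetry.
  assert (Hh : 0 <= (c-1)/2) by (apply Z.div_pos; lia).
  assert (Ec : c = 2 * ((c-1)/2) + 1) by (Z.to_euclidean_division_equations; lia).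
  apply sumZ_seq_lt.
  - split; [apply Z.div_pos; nia|].
    rewrite Z2Nat.id by lia. apply Z.lt_succ_r.
    apply Z.div_lt_upper_bound; nia.
  - intros y Hy. rewrite Z2Nat.id in Hy by lia. rewrite Z.ltb_lt.
    assert (d * y <> c * x).
    { intros H. assert (x = 0); [|lia]. apply (coprime_mul_mod c d); auto; [lia|].
      rewrite <- H, Z.mul_comm. apply Z.mod_mul; lia. }
    split; intros H'.
    + apply Z.div_le_lower_bound; lia.
    + pose proof (Z.mul_div_le (c * x) d Hp). nia.
Qed.

(** Eisenstein's argument: the two sums of quotients count the lattice points on
    either side of the diagonal of a rectangle. *)
Lemma jac_reciprocity c d : Z.gcd c d = 1 -> c mod 2 = 1 -> d mod 2 = 1 -> 0 < c -> 0 < d ->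
  xorb (jac c d) (jac d c) = Z.odd ((c - 1) / 2 * ((d - 1) / 2)).
Proof.
  intros Hg Hc Hd Hcp Hdp.
  assert (Hg' : Z.gcd d c = 1) by (rewrite Z.gcd_comm; exact Hg).
  rewrite jac_floor, (jac_floor d c) by assumption.
  rewrite <- Z.odd_add. f_equal.
  rewrite (sumZ_ext _ _ _ (fun x Hx => floor_count c d x Hg Hd Hdp Hc Hcp Hx)).
  rewrite (sumZ_ext _ _ _ (fun x Hx => floor_count d c x Hg' Hc Hcp Hd Hdp Hx)).
  rewrite sumZ_swap, <- sumZ_plus.
  rewrite (sumZ_ext _ _ (fun _ => (d - 1) / 2)).
  - rewrite sumZ_const, length_half_range by assumption. ring.
  - intros y Hy. rewrite <- sumZ_plus. rewrite (sumZ_ext _ _ (fun _ => 1)).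
    + rewrite sumZ_const, length_half_range by assumption. ring.
    + intros x Hx. apply in_half_range in Hx; auto. apply in_half_range in Hy; auto.
      assert (d * y <> c * x).
      { intros H. assert (x = 0); [|lia]. apply (coprime_mul_mod c d); auto; [lia|].
        rewrite <- H, Z.mul_comm. apply Z.mod_mul; lia. }
      destruct (Z.ltb_spec (d * y) (c * x)), (Z.ltb_spec (c * x) (d * y)); lia.
Qed.

Lemma gcd_add_mul c d k : Z.gcd (c + k * d) d = Z.gcd c d.
Proof.
  rewrite (Z.gcd_comm _ d), (Z.gcd_comm c d).
  apply Z.gcd_add_mult_diag_r.
Qed.

Lemma coprime_factor_l c a b : Z.gcd c (a * b) = 1 -> Z.gcd c a = 1.
Proof.
  intros H. apply Zgcd_1_rel_prime. apply Zgcd_1_rel_prime in H.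
  apply rel_prime_sym. apply rel_prime_div with (a * b); [now apply rel_prime_sym|].
  apply Z.divide_factor_l.
Qed.

Lemma coprime_factor_r c a b : Z.gcd c (a * b) = 1 -> Z.gcd c b = 1.
Proof. rewrite Z.mul_comm. apply coprime_factor_l. Qed.

(** Twice applied, reciprocity carries the multiplicativity from the top to the
    bottom. *)
Lemma jac_mul_bottom c d1 d2 : Z.gcd c (d1 * d2) = 1 ->
  d1 mod 2 = 1 -> d2 mod 2 = 1 -> 0 < d1 -> 0 < d2 ->
  jac c (d1 * d2) = xorb (jac c d1) (jac c d2).
Proof.
  intros Hg H1 H2 P1 P2.
  assert (Od : (d1 * d2) mod 2 = 1) by (rewrite Z.mul_mod, H1, H2; [reflexivity|lia]).
  assert (Pd : 0 < d1 * d2) by nia.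
  (* reciprocity needs a positive odd top: add a multiple of the bottom *)
  assert (X : exists k, 0 < c + k * (d1 * d2) /\ (c + k * (d1 * d2)) mod 2 = 1).
  { destruct (Z.eq_dec (c mod 2) 1) as [E|E].
    - exists (2 * Z.abs c). split.
      { assert (c <> 0) by (intro; subst; discriminate).
        assert (2 * Z.abs c * 1 <= 2 * Z.abs c * (d1 * d2)) by (apply Z.mul_le_mono_nonneg_l; lia). lia. }
      replace (c + 2 * Z.abs c * (d1 * d2)) with (c + (Z.abs c * (d1 * d2)) * 2) by ring.
      rewrite Z.mod_add by lia. exact E.
    - exists (2 * Z.abs c + 1). split.
      { assert ((2 * Z.abs c + 1) * 1 <= (2 * Z.abs c + 1) * (d1 * d2)) by (apply Z.mul_le_mono_nonneg_l; lia). lia. }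
      replace (c + (2 * Z.abs c + 1) * (d1 * d2)) with ((c + d1 * d2) + (Z.abs c * (d1 * d2)) * 2) by ring.
      rewrite Z.mod_add by lia. rewrite Z.add_mod, Od by lia.
      pose proof (Z.mod_pos_bound c 2 ltac:(lia)).
      assert (c mod 2 = 0) as -> by lia. reflexivity. }
  destruct X as [k [Xp Xo]].
  rewrite <- (jac_shift c (d1 * d2) k Pd), <- (jac_shift c d1 (k * d2) P1),
    <- (jac_shift c d2 (k * d1) P2).
  replace (c + k * d2 * d1) with (c + k * (d1 * d2)) by ring.
  replace (c + k * d1 * d2) with (c + k * (d1 * d2)) by ring.
  assert (G : Z.gcd (c + k * (d1 * d2)) (d1 * d2) = 1) by (rewrite gcd_add_mul; exact Hg).
  set (x := c + k * (d1 * d2)) in *.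
  pose proof (coprime_factor_l _ _ _ G) as G1.
  pose proof (coprime_factor_r _ _ _ G) as G2.
  pose proof (jac_reciprocity x (d1 * d2) G Xo Od Xp Pd) as R.
  pose proof (jac_reciprocity x d1 G1 Xo H1 Xp P1) as R1.
  pose proof (jac_reciprocity x d2 G2 Xo H2 Xp P2) as R2.
  rewrite (jac_mul_top d1 d2 x) in R by (try assumption; rewrite Z.gcd_comm; assumption).
  assert (E : Z.odd ((d1 * d2 - 1) / 2) = xorb (Z.odd ((d1 - 1) / 2)) (Z.odd ((d2 - 1) / 2))).
  { rewrite <- Z.odd_add.
    assert (d1 = 2 * ((d1-1)/2) + 1) by (clear -H1; Z.to_euclidean_division_equations; lia).
    assert (d2 = 2 * ((d2-1)/2) + 1) by (clear -H2; Z.to_euclidean_division_equations; lia).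
    set (u := (d1-1)/2) in *. set (v := (d2-1)/2) in *.
    replace ((d1 * d2 - 1) / 2) with (u + v + 2 * (u * v)).
    - rewrite !Z.odd_add, Z.odd_mul. simpl. apply xorb_false_r.
    - apply Z.div_unique_exact; [lia|]. rewrite H, H0. ring. }
  rewrite Z.odd_mul in R, R1, R2. rewrite E in R.
  destruct (jac x (d1 * d2)), (jac x d1), (jac x d2), (jac d1 x), (jac d2 x),
    (Z.odd ((x - 1) / 2)), (Z.odd ((d1 - 1) / 2)), (Z.odd ((d2 - 1) / 2));
    simpl in *; congruence.
Qed.

Open Scope nat_scope.

(** * Divisors of a square-free number *)

Definition prod_list (ps : list nat) : nat := fold_right Nat.mul 1 ps.

Definition distinct_primes (ps : list nat) : Prop :=
  (forall p, In p ps -> prime (Z.of_nat p)) /\ NoDup ps.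

(** The divisors generated from the prime factors, for inductions that remove
    one prime at a time. *)
Fixpoint divs (ps : list nat) : list nat :=
  match ps with
  | [] => [1]
  | p :: qs => divs qs ++ map (Nat.mul p) (divs qs)
  end.

Lemma divide_Z_nat a b : Nat.divide a b <-> (Z.of_nat a | Z.of_nat b)%Z.
Proof.
  split.
  - intros [k ->]. exists (Z.of_nat k). lia.
  - intros H. destruct (Nat.eq_dec a 0) as [->|Na].
    + destruct H as [k H]. exists 0. lia.
    + destruct H as [k H]. exists (Z.to_nat k). nia.
Qed.

Lemma prime_nat_gt_1 p : prime (Z.of_nat p) -> 1 < p.
Proof. intros H. apply prime_ge_2 in H. lia. Qed.

Lemma prime_nat_mult p a b : prime (Z.of_nat p) -> Nat.divide p (a * b) ->
  Nat.divide p a \/ Nat.divide p b.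
Proof.
  intros Hp H. apply divide_Z_nat in H. rewrite Nat2Z.inj_mul in H.
  apply prime_mult in H; auto. now rewrite !divide_Z_nat.
Qed.

Lemma prime_nat_not_divide_prod p ps : prime (Z.of_nat p) -> distinct_primes ps ->
  ~ In p ps -> ~ Nat.divide p (prod_list ps).
Proof.
  intros Hp. induction ps as [|q ps IH]; intros [H1 H2] Hn; simpl.
  - intros [k Hk]. pose proof (prime_nat_gt_1 p Hp). symmetry in Hk. apply Nat.eq_mul_1 in Hk. lia.
  - intros D. apply prime_nat_mult in D; auto. destruct D as [D|D].
    + apply divide_Z_nat in D. apply prime_div_prime in D; auto; [|apply H1; simpl; auto].
      apply Nat2Z.inj in D. apply Hn. simpl; auto.
    + revert D. apply IH.
      * split; [intros; apply H1; simpl; auto|now inversion H2].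
      * intros G. apply Hn. simpl; auto.
Qed.

Lemma distinct_primes_tail p ps : distinct_primes (p :: ps) -> distinct_primes ps.
Proof. intros [H1 H2]. split; [intros; apply H1; simpl; auto|now inversion H2]. Qed.

Lemma distinct_primes_head p ps : distinct_primes (p :: ps) ->
  prime (Z.of_nat p) /\ ~ Nat.divide p (prod_list ps).
Proof.
  intros H. assert (P : prime (Z.of_nat p)) by (apply H; simpl; auto).
  split; auto. apply prime_nat_not_divide_prod; auto; [now apply distinct_primes_tail in H|].
  destruct H as [_ H]. now inversion H.
Qed.

Lemma prod_list_pos ps : distinct_primes ps -> 0 < prod_list ps.
Proof.
  induction ps as [|p ps IH]; intros H; simpl; [lia|].
  destruct (distinct_primes_head p ps H) as [P _]. apply prime_nat_gt_1 in P.
  apply distinct_primes_tail in H. specialize (IH H). nia.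
Qed.

Lemma prime_nat_coprime p v : prime (Z.of_nat p) -> ~ Nat.divide p v -> Nat.gcd v p = 1.
Proof.
  intros P H. assert (rel_prime (Z.of_nat p) (Z.of_nat v)).
  { apply prime_rel_prime; auto. now rewrite <- divide_Z_nat. }
  destruct H0 as [_ _ G].
  specialize (G (Z.of_nat (Nat.gcd v p))). rewrite <- !divide_Z_nat in G.
  specialize (G (Nat.gcd_divide_r v p) (Nat.gcd_divide_l v p)).
  change 1%Z with (Z.of_nat 1) in G. apply divide_Z_nat in G.
  destruct G as [k G]. symmetry in G. apply Nat.eq_mul_1 in G. lia.
Qed.

Lemma in_divs ps v : distinct_primes ps -> In v (divs ps) <-> Nat.divide v (prod_list ps).
Proof.
  revert v. induction ps as [|p ps IH]; intros v H.
  - simpl. split; [intros [<-|[]]; exists 1; reflexivity|].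
    intros [k Hk]. symmetry in Hk. apply Nat.eq_mul_1 in Hk. lia.
  - destruct (distinct_primes_head p ps H) as [P Np]. apply distinct_primes_tail in H.
    pose proof (prime_nat_gt_1 p P) as P1.
    simpl. rewrite in_app_iff, in_map_iff. split.
    + intros [G|[u [<- G]]]; apply IH in G; auto.
      * now apply Nat.divide_mul_r.
      * apply Nat.mul_divide_mono_l. exact G.
    + intros D. destruct (Nat.eq_dec (v mod p) 0) as [E|E].
      * right. apply Nat.Lcm0.mod_divide in E. destruct E as [u ->].
        exists u. split; [apply Nat.mul_comm|]. apply IH; auto.
        rewrite Nat.mul_comm in D. apply Nat.mul_divide_cancel_l in D; [auto|lia].
      * left. apply IH; auto. apply Nat.gauss with p; auto.
        apply prime_nat_coprime; auto. intros G. apply E. now apply Nat.Lcm0.mod_divide.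
Qed.

Lemma NoDup_divs ps : distinct_primes ps -> NoDup (divs ps).
Proof.
  induction ps as [|p ps IH]; intros H; simpl.
  - constructor; [simpl; tauto|constructor].
  - destruct (distinct_primes_head p ps H) as [P Np]. apply distinct_primes_tail in H.
    pose proof (prime_nat_gt_1 p P) as P1.
    apply NoDup_app; [now apply IH| |].
    + apply FinFun.Injective_map_NoDup; [|now apply IH]. intros x y E. nia.
    + intros v Hv Hm. apply in_map_iff in Hm. destruct Hm as [u [<- Hu]].
      apply in_divs in Hv; auto. apply Np.
      apply Nat.divide_trans with (p * u); auto. apply Nat.divide_factor_l.
Qed.

Lemma divisors_Permutation ps : distinct_primes ps ->
  Permutation (divisors (prod_list ps)) (divs ps).
Proof.
  intros H. pose proof (prod_list_pos ps H) as P. apply NoDup_Permutation.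
  - apply NoDup_filter, seq_NoDup.
  - now apply NoDup_divs.
  - intros v. unfold divisors. rewrite filter_In, in_seq, Nat.eqb_eq, in_divs by auto. split.
    + intros [_ E]. now apply Nat.Lcm0.mod_divide.
    + intros D. split; [|now apply Nat.Lcm0.mod_divide].
      pose proof (Nat.divide_pos_le _ _ P D). destruct D as [k D].
      destruct v; [lia|lia].
Qed.

Lemma divs_split ps f : distinct_primes ps -> Nat.divide f (prod_list ps) ->
  exists fs gs, Permutation ps (fs ++ gs) /\ prod_list fs = f.
Proof.
  intros H D. apply in_divs in D; auto. revert f D.
  induction ps as [|p ps IH]; intros f D; simpl in D.
  - destruct D as [<-|[]]. exists [], []. split; [constructor|reflexivity].
  - apply distinct_primes_tail in H. apply in_app_iff in D. destruct D as [D|D].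
    + destruct (IH H f D) as [fs [gs [E F]]]. exists fs, (p :: gs). split; auto.
      now apply Permutation_cons_app.
    + apply in_map_iff in D. destruct D as [u [<- D]].
      destruct (IH H u D) as [fs [gs [E F]]]. exists (p :: fs), gs. split; [now constructor|].
      simpl. congruence.
Qed.

Lemma prod_list_app l l' : prod_list (l ++ l') = prod_list l * prod_list l'.
Proof. induction l as [|x l IH]; simpl; [lia|]. rewrite IH. lia. Qed.

Lemma prod_list_Permutation l l' : Permutation l l' -> prod_list l = prod_list l'.
Proof. induction 1; simpl; lia. Qed.

Lemma distinct_primes_Permutation l l' : Permutation l l' -> distinct_primes l -> distinct_primes l'.
Proof.
  intros E [H1 H2]. split.
  - intros p Hp. apply H1. revert Hp. apply Permutation_in. now apply Permutation_sym.
  - now apply (Permutation_NoDup E).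
Qed.

Lemma distinct_primes_app l l' : distinct_primes (l ++ l') -> distinct_primes l /\ distinct_primes l'.
Proof.
  intros [H1 H2]. apply NoDup_app_remove_l in H2 as H3. apply NoDup_app_remove_r in H2.
  split; split; auto; intros; apply H1, in_app_iff; auto.
Qed.

Lemma length_divs ps : length (divs ps) = 2 ^ length ps.
Proof.
  induction ps as [|p ps IH]; simpl; [reflexivity|]. rewrite length_app, length_map, IH. lia.
Qed.

(** ** Iterated operations over lists of divisors *)

Definition comm_monoid {T : Type} (op : T -> T -> T) (one : T) : Prop :=
  (forall x y z, op x (op y z) = op (op x y) z) /\ (forall x y, op x y = op y x) /\
  (forall x, op one x = x).

Definition iter_op {T : Type} (op : T -> T -> T) (one : T) (l : list nat) (F : nat -> T) : T :=
  fold_right (fun v w => op (F v) w) one l.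

Lemma iter_op_app {T} (op : T -> T -> T) one l l' F : comm_monoid op one ->
  iter_op op one (l ++ l') F = op (iter_op op one l F) (iter_op op one l' F).
Proof.
  intros [A [Co U]]. induction l as [|x l IH]; simpl; [now rewrite U|].
  unfold iter_op in *. now rewrite IH, A.
Qed.

Lemma iter_op_map {T} (op : T -> T -> T) one l h F :
  iter_op op one (map h l) F = iter_op op one l (fun v => F (h v)).
Proof. induction l as [|x l IH]; simpl; [reflexivity|]. unfold iter_op in *. now rewrite IH. Qed.

Lemma iter_op_ext {T} (op : T -> T -> T) one l F G : (forall v, In v l -> F v = G v) ->
  iter_op op one l F = iter_op op one l G.
Proof.
  induction l as [|x l IH]; simpl; intros H; [reflexivity|].
  unfold iter_op in *. rewrite IH, H; auto.
Qed.

Lemma iter_op_Permutation {T} (op : T -> T -> T) one l l' F : comm_monoid op one ->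
  Permutation l l' -> iter_op op one l F = iter_op op one l' F.
Proof.
  intros [A [Co U]]. unfold iter_op. induction 1; simpl; try congruence; now rewrite !A, (Co (F y)).
Qed.

Lemma iter_op_op {T} (op : T -> T -> T) one l F G : comm_monoid op one ->
  iter_op op one l (fun v => op (F v) (G v)) = op (iter_op op one l F) (iter_op op one l G).
Proof.
  intros [A [Co U]]. unfold iter_op. induction l as [|x l IH]; simpl; [now rewrite U|].
  rewrite IH, !A. f_equal. rewrite <- !A. f_equal. apply Co.
Qed.

Lemma iter_op_divs_app {T} (op : T -> T -> T) one fs gs F : comm_monoid op one ->
  iter_op op one (divs (fs ++ gs)) F =
  iter_op op one (divs fs) (fun x => iter_op op one (divs gs) (fun y => F (x * y))).
Proof.
  intros M. pose proof M as [A [Co U]]. revert F. induction fs as [|p fs IH]; intros F.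
  - simpl. unfold iter_op at 2. simpl. rewrite Co, U. apply iter_op_ext. intros; f_equal; lia.
  - simpl. rewrite !iter_op_app, !iter_op_map, !IH by auto. f_equal.
    apply iter_op_ext. intros x _. apply iter_op_ext. intros y _. f_equal. lia.
Qed.

Lemma divs_pos ps v : distinct_primes ps -> In v (divs ps) -> 0 < v.
Proof.
  intros H D. apply in_divs in D; auto. pose proof (prod_list_pos ps H).
  destruct D as [k D]. destruct v; lia.
Qed.

(** The involution v -> N / v exchanges the divisors prime to p with the
    multiples of p. *)
Lemma iter_op_divs_compl {T} (op : T -> T -> T) one ps F : comm_monoid op one -> distinct_primes ps ->
  iter_op op one (divs ps) (fun v => F (prod_list ps / v)) = iter_op op one (divs ps) F.
Proof.
  intros M. pose proof M as [A [Co U]]. revert F. induction ps as [|p ps IH]; intros F H.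
  - reflexivity.
  - destruct (distinct_primes_head p ps H) as [P _]. apply prime_nat_gt_1 in P.
    apply distinct_primes_tail in H.
    cbn [divs]. rewrite !iter_op_app, !iter_op_map, Co by auto.
    rewrite <- (IH F H), <- (IH (fun v => F (p * v)) H). f_equal.
    + apply iter_op_ext. intros v Hv. f_equal. cbn [prod_list fold_right]. fold (prod_list ps).
      apply Nat.Div0.div_mul_cancel_l. lia.
    + apply iter_op_ext. intros v Hv. f_equal. cbn [prod_list fold_right]. fold (prod_list ps).
      pose proof (divs_pos ps v H Hv). apply in_divs in Hv; auto. destruct Hv as [k ->].
      rewrite Nat.div_mul, Nat.mul_assoc, Nat.div_mul by lia. reflexivity.
Qed.

Lemma comm_monoid_Zadd : comm_monoid Z.add 0%Z.
Proof. repeat split; intros; lia. Qed.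

Definition divsumZ (ps : list nat) (F : nat -> Z) : Z := iter_op Z.add 0%Z (divs ps) F.

Lemma iter_Zadd_scal l k F : iter_op Z.add 0%Z l (fun v => (k * F v)%Z) = (k * iter_op Z.add 0%Z l F)%Z.
Proof. unfold iter_op. induction l as [|x l IH]; simpl; [lia|]. rewrite IH. lia. Qed.

Lemma iter_Zadd_const l (k : Z) : iter_op Z.add 0%Z l (fun v => k) = (k * Z.of_nat (length l))%Z.
Proof. unfold iter_op. induction l as [|x l IH]; [simpl; lia|]. cbn [fold_right length]. rewrite IH. lia. Qed.

Lemma sigma_divs ps : distinct_primes ps -> Z.of_nat (Defs.sigma (prod_list ps)) = divsumZ ps Z.of_nat.
Proof.
  intros H. unfold divsumZ. rewrite <- (iter_op_Permutation _ _ _ _ _ comm_monoid_Zadd (divisors_Permutation ps H)).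
  unfold Defs.sigma. generalize (divisors (prod_list ps)). unfold iter_op.
  induction l as [|x l IH]; [reflexivity|]. cbn [fold_right]. rewrite <- IH.
  apply Nat2Z.inj_add.
Qed.

Lemma divsumZ_app fs gs :
  divsumZ (fs ++ gs) Z.of_nat = (divsumZ fs Z.of_nat * divsumZ gs Z.of_nat)%Z.
Proof.
  unfold divsumZ. rewrite iter_op_divs_app by apply comm_monoid_Zadd.
  rewrite (iter_op_ext _ _ _ _ (fun x => (iter_op Z.add 0%Z (divs gs) Z.of_nat * Z.of_nat x)%Z)).
  - rewrite iter_Zadd_scal. ring.
  - intros x _. rewrite <- (Z.mul_comm (Z.of_nat x)), <- iter_Zadd_scal.
    apply iter_op_ext. intros; lia.
Qed.

Lemma Z_mul_divide_compat a b c d : (a | b)%Z -> (c | d)%Z -> (a * c | b * d)%Z.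
Proof. intros [k ->] [l ->]. exists (k * l)%Z. ring. Qed.

(** Each odd prime p contributes the even factor 1 + p. *)
Lemma pow2_divide_sigma ps : (forall p, In p ps -> p mod 2 = 1) ->
  (2 ^ Z.of_nat (length ps) | divsumZ ps Z.of_nat)%Z.
Proof.
  induction ps as [|p ps IH]; intros H.
  - exists 1%Z. reflexivity.
  - assert (E : divsumZ (p :: ps) Z.of_nat = ((1 + Z.of_nat p) * divsumZ ps Z.of_nat)%Z).
    { unfold divsumZ. cbn [divs]. rewrite iter_op_app, iter_op_map by apply comm_monoid_Zadd.
      rewrite (iter_op_ext _ _ _ (fun v => Z.of_nat (p * v)) (fun v => (Z.of_nat p * Z.of_nat v)%Z)) by (intros; lia).
      rewrite iter_Zadd_scal. ring. }
    rewrite E. cbn [length]. rewrite Nat2Z.inj_succ, Z.pow_succ_r by lia.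
    apply Z_mul_divide_compat; [|apply IH; intros; apply H; simpl; auto].
    exists (Z.of_nat ((p + 1) / 2)). specialize (H p (or_introl eq_refl)).
    pose proof (Nat.div_mod_eq (p + 1) 2).
    assert ((p + 1) mod 2 = 0) by (rewrite Nat.Div0.add_mod, H; reflexivity). lia.
Qed.

(** The four divisors v, p v, q v and p q v together contribute h v four times,
    and kp and kq twice each. *)
Lemma sign_cancels p q ps (h : nat -> bool) (kp kq : bool) :
  (forall v, In v (divs (q :: ps)) -> h (p * v) = xorb kp (h v)) ->
  (forall v, In v (divs ps) -> h (q * v) = xorb kq (h v)) ->
  exists m, iter_op Z.add 0%Z (divs (p :: q :: ps)) (fun v => Z.b2z (h v)) = (2 * m)%Z.
Proof.
  intros Hp Hq. cbn [divs] in Hp |- *.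
  rewrite !iter_op_app, !iter_op_map, !iter_op_app, !iter_op_map by apply comm_monoid_Zadd.
  rewrite <- !(iter_op_op _ _ _ _ _ comm_monoid_Zadd).
  assert (G : forall l, (forall v, In v l -> In v (divs ps)) -> exists m,
    iter_op Z.add 0%Z l (fun v => (Z.b2z (h v) + Z.b2z (h (q * v)%nat) + (Z.b2z (h (p * v)%nat) + Z.b2z (h (p * (q * v))%nat)))%Z) = (2 * m)%Z).
  { induction l as [|v l IH]; intros Hl; [exists 0%Z; reflexivity|].
    destruct IH as [m Hm]; [intros; apply Hl; simpl; auto|].
    assert (Hv : In v (divs ps)) by (apply Hl; simpl; auto).
    unfold iter_op in *. cbn [fold_right]. rewrite Hm.
    rewrite (Hp (q * v)), (Hp v), (Hq v).
    2: exact Hv.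
    2: apply in_app_iff; auto.
    2: apply in_app_iff; right; apply in_map; exact Hv.
    destruct (h v), kp, kq; simpl Z.b2z;
      [exists (m + 1)%Z|exists (m + 1)%Z|exists (m + 1)%Z|exists (m + 2)%Z
      |exists (m + 1)%Z|exists (m + 1)%Z|exists (m + 1)%Z|exists m]; lia. }
  apply G. auto.
Qed.

(** ** The exponent [ellN] and the weight *)

(** What the least common multiple in the definition of ell provides.  The
    weight 2^(r-1) ell is divisible by 4; hence an odd ell is possible only with
    at least three primes. *)
Lemma weight_facts ps : distinct_primes ps ->
  let r := length ps in let N := prod_list ps in
  exists h, weightN r N = 2 * h /\ Nat.Even h /\ 2 ^ r * ellN r N = 4 * h /\
    Nat.divide 24 (ellN r N * Defs.sigma N) /\ (Nat.Even (ellN r N) \/ 3 <= r) /\ 0 < ellN r N.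
Proof.
  intros H r N. destruct ps as [|p ps].
  - exists 6. repeat split; try reflexivity.
    + exists 3. reflexivity.
    + left. exists 12. reflexivity.
    + change (0 < 24). lia.
  - set (s := length ps). assert (Er : r = S s) by reflexivity. rewrite Er.
    set (g := Nat.gcd 24 (Defs.sigma N)).
    assert (g0 : g <> 0) by (intro G; apply Nat.gcd_eq_0_l in G; discriminate).
    destruct (Nat.gcd_divide_l 24 (Defs.sigma N)) as [m Hm]; fold g in Hm.
    destruct (Nat.gcd_divide_r 24 (Defs.sigma N)) as [n Hn]; fold g in Hn.
    assert (p0 : 2 ^ s <> 0) by (apply Nat.pow_nonzero; lia).
    assert (Em : 24 / g = m) by (rewrite Hm; apply Nat.div_mul; exact g0).
    assert (T : twoN (S s) N = 2 ^ s * m).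
    { unfold twoN; fold g; rewrite Em, Nat.pow_succ_r'.
      replace (2 * 2 ^ s * m) with (2 ^ s * m * 2) by ring. apply Nat.div_mul; discriminate. }
    destruct (Nat.divide_lcm_r 4 (2 ^ s * m)) as [t Ht].
    destruct (Nat.divide_lcm_l 4 (2 ^ s * m)) as [u Hu].
    assert (L : ellN (S s) N = t * m).
    { unfold ellN; rewrite T, Ht, Nat.pow_succ_r'.
      replace (2 * (t * (2 ^ s * m))) with (t * m * (2 * 2 ^ s)) by ring.
      apply Nat.div_mul; lia. }
    assert (K : weightN (S s) N = 2 ^ s * (t * m)).
    { unfold weightN; rewrite L, Nat.pow_succ_r'.
      replace (2 * 2 ^ s * (t * m)) with (2 ^ s * (t * m) * 2) by ring.
      apply Nat.div_mul; discriminate. }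
    assert (Q : 2 ^ s * (t * m) = 4 * u) by lia.
    assert (m0 : m <> 0) by (intros ->; lia).
    assert (t0 : t <> 0).
    { intros ->. rewrite Nat.mul_0_l in Ht. apply Nat.lcm_eq_0 in Ht. nia. }
    exists (2 * u). rewrite K, L. repeat split.
    + lia.
    + exists u. reflexivity.
    + rewrite Nat.pow_succ_r'. lia.
    + exists (t * n). rewrite Hn, Hm. ring.
    + destruct (Nat.Even_or_Odd (t * m)) as [E|[v O]]; [now left|]. right.
      destruct s as [|[|s]]; [..|lia]; exfalso; simpl in Q; lia.
    + nia.
Qed.

Open Scope R_scope.

(** * Limits of complex sequences *)

Definition clim (u : nat -> C) (l : C) : Prop :=
  forall eps, 0 < eps -> exists N, forall n, (N <= n)%nat -> Cmod (u n - l) < eps.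

Lemma Cmod_sub_sym a b : Cmod (a - b) = Cmod (b - a).
Proof. rewrite <- (Cmod_opp (b - a)). f_equal; ring. Qed.

Lemma Cmod_sub_tri a b c : Cmod (a - c) <= Cmod (a - b) + Cmod (b - c).
Proof. replace (a - c)%C with ((a - b) + (b - c))%C by ring. apply Cmod_triangle. Qed.

Lemma Cmod_small_eq a b : (forall eps, 0 < eps -> Cmod (a - b) < eps) -> a = b.
Proof.
  intros H. apply Ceq_minus, Cmod_eq_0.
  destruct (Rle_lt_or_eq_dec _ _ (Cmod_ge_0 (a - b))) as [G|G]; [|auto].
  specialize (H _ G). lra.
Qed.

Lemma clim_unique u l m : clim u l -> clim u m -> l = m.
Proof.
  intros H1 H2. apply Cmod_small_eq. intros eps He.
  destruct (H1 (eps / 2)) as [N1 G1]; [lra|]. destruct (H2 (eps / 2)) as [N2 G2]; [lra|].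
  specialize (G1 (max N1 N2) ltac:(lia)). specialize (G2 (max N1 N2) ltac:(lia)).
  pose proof (Cmod_sub_tri l (u (max N1 N2)) m). rewrite (Cmod_sub_sym l (u _)) in H. lra.
Qed.

Lemma clim_ext_from u v l N : (forall n, (N <= n)%nat -> u n = v n) -> clim u l -> clim v l.
Proof.
  intros E H eps He. destruct (H eps He) as [M G]. exists (max N M). intros n Hn.
  rewrite <- E by lia. apply G; lia.
Qed.

Lemma clim_ext u v l : (forall n, u n = v n) -> clim u l -> clim v l.
Proof. intros E. apply (clim_ext_from u v l 0). auto. Qed.

Lemma clim_const c : clim (fun _ => c) c.
Proof.
  intros eps He. exists O. intros. replace (c - c)%C with (RtoC 0) by ring. rewrite Cmod_0; lra.
Qed.

Lemma clim_plus u v l m : clim u l -> clim v m -> clim (fun n => u n + v n)%C (l + m).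
Proof.
  intros H1 H2 eps He.
  destruct (H1 (eps / 2)) as [N1 G1]; [lra|]. destruct (H2 (eps / 2)) as [N2 G2]; [lra|].
  exists (max N1 N2). intros n Hn. specialize (G1 n ltac:(lia)). specialize (G2 n ltac:(lia)).
  replace (u n + v n - (l + m))%C with ((u n - l) + (v n - m))%C by ring.
  pose proof (Cmod_triangle (u n - l) (v n - m)). lra.
Qed.

Lemma clim_scal u l c : clim u l -> clim (fun n => c * u n)%C (c * l).
Proof.
  intros H eps He. pose proof (Cmod_ge_0 c).
  destruct (H (eps / (Cmod c + 1))) as [N G]; [apply Rdiv_lt_0_compat; lra|].
  exists N. intros n Hn. specialize (G n Hn).
  replace (c * u n - c * l)%C with (c * (u n - l))%C by ring. rewrite Cmod_mult.
  apply Rmult_lt_compat_r with (r := Cmod c + 1) in G; [|lra].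
  unfold Rdiv in G. rewrite Rmult_assoc, Rinv_l in G by lra.
  pose proof (Cmod_ge_0 (u n - l)). nra.
Qed.

Lemma clim_opp u l : clim u l -> clim (fun n => - u n)%C (- l).
Proof.
  intros H. replace (- l)%C with (-1 * l)%C by ring.
  apply (clim_ext (fun n => -1 * u n)%C); [intros; ring|]. now apply clim_scal.
Qed.

Lemma clim_minus u v l m : clim u l -> clim v m -> clim (fun n => u n - v n)%C (l - m).
Proof. intros H1 H2. apply clim_plus; [|apply clim_opp]; assumption. Qed.

Lemma clim_0_le u (b : nat -> R) : (forall n, Cmod (u n) <= b n) -> is_lim_seq b 0 -> clim u 0.
Proof.
  intros Hb Hl eps He. apply is_lim_seq_spec in Hl. destruct (Hl (mkposreal eps He)) as [N G].
  exists N. intros n Hn. specialize (G n Hn). simpl in G. rewrite Rminus_0_r in G.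
  replace (u n - 0)%C with (u n) by ring. specialize (Hb n).
  pose proof (Rle_abs (b n)). lra.
Qed.

Lemma clim_le u l B : clim u l -> (forall n, Cmod (u n) <= B) -> Cmod l <= B.
Proof.
  intros H G. apply le_epsilon. intros eps He. destruct (H eps He) as [N HN].
  specialize (HN N (le_n _)). specialize (G N).
  replace l with ((l - u N) + u N)%C by ring.
  pose proof (Cmod_triangle (l - u N) (u N)). rewrite (Cmod_sub_sym l (u N)) in H0. lra.
Qed.

Lemma clim_bounded u l : clim u l -> exists B, forall n, Cmod (u n) <= B.
Proof.
  intros H. destruct (H 1 ltac:(lra)) as [N HN].
  assert (F : forall N, exists B, forall n, (n < N)%nat -> Cmod (u n) <= B).
  { clear. induction N as [|N [B HB]]; [exists 0; lia|].
    exists (Rmax B (Cmod (u N))). intros n Hn.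
    destruct (Nat.eq_dec n N) as [->|]; [apply Rmax_r|].
    eapply Rle_trans; [apply HB; lia|apply Rmax_l]. }
  destruct (F N) as [B HB]. exists (Rmax B (Cmod l + 1)). intros n.
  destruct (le_lt_dec N n) as [G|G].
  - specialize (HN n G). eapply Rle_trans; [|apply Rmax_r].
    replace (u n) with ((u n - l) + l)%C by ring.
    pose proof (Cmod_triangle (u n - l) l). lra.
  - eapply Rle_trans; [apply HB; lia|apply Rmax_l].
Qed.

Lemma clim_mult u v l m : clim u l -> clim v m -> clim (fun n => u n * v n)%C (l * m).
Proof.
  intros H1 H2. destruct (clim_bounded _ _ H1) as [B HB].
  assert (B0 : 0 <= B) by (eapply Rle_trans; [apply Cmod_ge_0|apply (HB O)]).
  apply (clim_ext (fun n => u n * (v n - m) + m * u n)%C); [intros; ring|].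
  replace (l * m)%C with (0 + m * l)%C by ring.
  apply clim_plus; [|now apply clim_scal].
  intros eps He. destruct (H2 (eps / (B + 1))) as [N G]; [apply Rdiv_lt_0_compat; lra|].
  exists N. intros n Hn. specialize (G n Hn).
  replace (u n * (v n - m) - 0)%C with (u n * (v n - m))%C by ring. rewrite Cmod_mult.
  apply Rmult_lt_compat_r with (r := B + 1) in G; [|lra].
  unfold Rdiv in G. rewrite Rmult_assoc, Rinv_l in G by lra.
  pose proof (Cmod_ge_0 (v n - m)). specialize (HB n). nra.
Qed.

Lemma clim_comp u l (phi : nat -> nat) : (forall n, (n <= phi n)%nat) ->
  clim u l -> clim (fun n => u (phi n)) l.
Proof.
  intros Hp H eps He. destruct (H eps He) as [N G]. exists N. intros n Hn.
  apply G. specialize (Hp n). lia.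
Qed.

Lemma abs_Im_le_Cmod z : Rabs (Im z) <= Cmod z.
Proof. eapply Rle_trans; [|apply Rmax_Cmod]. apply Rmax_r. Qed.

Lemma Cmod_le_sum z : Cmod z <= Rabs (Re z) + Rabs (Im z).
Proof.
  assert (E : z = (Re z + Ci * Im z)%C).
  { destruct z as [x y]. apply injective_projections; simpl; ring. }
  rewrite E at 1. eapply Rle_trans; [apply Cmod_triangle|].
  rewrite Cmod_mult, Cmod_Ci, !Cmod_R. lra.
Qed.

Lemma Im_minus a b : Im (a - b) = Im a - Im b.
Proof. unfold Cminus. rewrite im_plus, im_opp. ring. Qed.

Lemma Re_minus a b : Re (a - b) = Re a - Re b.
Proof. unfold Cminus. rewrite re_plus, re_opp. ring. Qed.

Lemma clim_Cauchy u :
  (forall eps, 0 < eps -> exists N, forall n m, (N <= n)%nat -> (N <= m)%nat ->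
     Cmod (u n - u m) < eps) ->
  exists l, clim u l.
Proof.
  intros H.
  destruct (Rcomplete.R_complete (fun n => Re (u n))) as [x Hx].
  { intros eps He. destruct (H eps He) as [N G]. exists N. intros n m Hn Hm.
    unfold Rdist. rewrite <- Re_minus. eapply Rle_lt_trans; [apply re_le_Cmod|]. now apply G. }
  destruct (Rcomplete.R_complete (fun n => Im (u n))) as [y Hy].
  { intros eps He. destruct (H eps He) as [N G]. exists N. intros n m Hn Hm.
    unfold Rdist. rewrite <- Im_minus. eapply Rle_lt_trans; [apply abs_Im_le_Cmod|]. now apply G. }
  exists (x, y). intros eps He.
  destruct (Hx (eps / 2)) as [N1 G1]; [lra|]. destruct (Hy (eps / 2)) as [N2 G2]; [lra|].
  exists (max N1 N2). intros n Hn. specialize (G1 n ltac:(lia)). specialize (G2 n ltac:(lia)).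
  unfold Rdist in *. eapply Rle_lt_trans; [apply Cmod_le_sum|].
  rewrite Re_minus, Im_minus. simpl. lra.
Qed.

(** * Series dominated by a summable real sequence *)

Fixpoint csum (f : nat -> C) (n : nat) : C :=
  match n with O => 0%C | S m => (csum f m + f m)%C end.

Fixpoint rsum (f : nat -> R) (n : nat) : R :=
  match n with O => 0 | S m => rsum f m + f m end.

Definition summable (b : nat -> R) : Prop :=
  (forall n, 0 <= b n) /\ exists B, forall n, rsum b n <= B.

Lemma csum_ext_lt f g n : (forall i, (i < n)%nat -> f i = g i) -> csum f n = csum g n.
Proof.
  induction n as [|n IH]; simpl; intros H; [reflexivity|].
  rewrite IH, H; auto.
Qed.

Lemma csum_ext f g n : (forall i, f i = g i) -> csum f n = csum g n.
Proof. intros; apply csum_ext_lt; auto. Qed.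

Lemma csum_plus f g n : csum (fun i => f i + g i)%C n = (csum f n + csum g n)%C.
Proof. induction n as [|n IH]; simpl; [ring|]. rewrite IH; ring. Qed.

Lemma csum_scal c f n : csum (fun i => c * f i)%C n = (c * csum f n)%C.
Proof. induction n as [|n IH]; simpl; [ring|]. rewrite IH; ring. Qed.

Lemma csum_minus f g n : csum (fun i => f i - g i)%C n = (csum f n - csum g n)%C.
Proof. induction n as [|n IH]; simpl; [ring|]. rewrite IH; ring. Qed.

Lemma csum_0 n : csum (fun _ => 0%C) n = 0%C.
Proof. induction n as [|n IH]; simpl; [reflexivity|]. rewrite IH; ring. Qed.

Lemma csum_add f n m : csum f (n + m) = (csum f n + csum (fun i => f (n + i)%nat) m)%C.
Proof.
  induction m as [|m IH]; simpl; [rewrite Nat.add_0_r; ring|].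
  rewrite Nat.add_succ_r; simpl. rewrite IH; ring.
Qed.

Lemma csum_first f n : csum f (S n) = (f O + csum (fun i => f (S i)) n)%C.
Proof. change (S n) with (1 + n)%nat. rewrite csum_add. simpl. ring. Qed.

Lemma csum_rev f n : csum f n = csum (fun i => f (n - 1 - i)%nat) n.
Proof.
  induction n as [|n IH]; [reflexivity|].
  symmetry. rewrite csum_first. cbn [csum]. rewrite IH.
  rewrite (csum_ext_lt (fun i => f (S n - 1 - S i)%nat) (fun i => f (n - 1 - i)%nat)).
  - replace (S n - 1 - 0)%nat with n by lia. ring.
  - intros; f_equal; lia.
Qed.

Lemma csum_swap (f : nat -> nat -> C) n m :
  csum (fun i => csum (f i) m) n = csum (fun j => csum (fun i => f i j) n) m.
Proof.
  induction n as [|n IH]; simpl; [symmetry; apply csum_0|].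
  rewrite IH, <- csum_plus. reflexivity.
Qed.

Lemma rsum_ext_lt f g n : (forall i, (i < n)%nat -> f i = g i) -> rsum f n = rsum g n.
Proof.
  induction n as [|n IH]; simpl; intros H; [reflexivity|].
  rewrite IH, H; auto.
Qed.

Lemma rsum_le f g n : (forall i, f i <= g i) -> rsum f n <= rsum g n.
Proof. intros H. induction n as [|n IH]; simpl; [lra|]. specialize (H n); lra. Qed.

Lemma rsum_scal c f n : rsum (fun i => c * f i) n = c * rsum f n.
Proof. induction n as [|n IH]; simpl; [ring|]. rewrite IH; ring. Qed.

Lemma rsum_plus f g n : rsum (fun i => f i + g i) n = rsum f n + rsum g n.
Proof. induction n as [|n IH]; simpl; [ring|]. rewrite IH; ring. Qed.

Lemma summable_scal b c : 0 <= c -> summable b -> summable (fun n => c * b n).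
Proof.
  intros Hc [Hb [B HB]]. split.
  - intros n. now apply Rmult_le_pos.
  - exists (c * B). intros n. rewrite rsum_scal. now apply Rmult_le_compat_l.
Qed.

Lemma summable_le b c : (forall n, 0 <= c n <= b n) -> summable b -> summable c.
Proof.
  intros H [Hb [B HB]]. split; [intros; apply H|].
  exists B. intros n. eapply Rle_trans; [|apply HB]. apply rsum_le. intros; apply H.
Qed.

Lemma summable_plus b c : summable b -> summable c -> summable (fun n => b n + c n).
Proof.
  intros [Hb [B HB]] [Hc [D HD]]. split; [intros n; specialize (Hb n); specialize (Hc n); lra|].
  exists (B + D). intros n. rewrite rsum_plus. specialize (HB n); specialize (HD n). lra.
Qed.

Lemma summable_tail b : summable b -> forall eps, 0 < eps ->
  exists N, forall n m, (N <= n)%nat -> (n <= m)%nat -> rsum b m - rsum b n < eps.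
Proof.
  intros [Hb [B HB]] eps He.
  destruct (ex_finite_lim_seq_incr (rsum b) B) as [l Hl].
  - intros n. simpl. specialize (Hb n). lra.
  - exact HB.
  - apply is_lim_seq_spec in Hl. assert (He2 : 0 < eps / 2) by lra.
    destruct (Hl (mkposreal _ He2)) as [N G]. simpl in G.
    exists N. intros n m Hn Hm. pose proof (G n Hn) as G1. pose proof (G m ltac:(lia)) as G2.
    apply Rabs_def2 in G1. apply Rabs_def2 in G2. lra.
Qed.

Lemma csum_diff_le f b n m : (forall i, (n <= i)%nat -> Cmod (f i) <= b i) -> (n <= m)%nat ->
  Cmod (csum f m - csum f n) <= rsum b m - rsum b n.
Proof.
  intros H Hnm. induction Hnm.
  - replace (csum f n - csum f n)%C with (RtoC 0) by ring. rewrite Cmod_0; lra.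
  - simpl. replace (csum f m + f m - csum f n)%C with ((csum f m - csum f n) + f m)%C by ring.
    eapply Rle_trans; [apply Cmod_triangle|]. specialize (H m Hnm). lra.
Qed.

Lemma Cmod_csum_le f b n : (forall i, Cmod (f i) <= b i) -> Cmod (csum f n) <= rsum b n.
Proof.
  intros H. pose proof (csum_diff_le f b 0 n (fun i _ => H i) ltac:(lia)) as G.
  simpl in G. replace (csum f n - 0)%C with (csum f n) in G by ring. lra.
Qed.

Lemma csum_converges f b : summable b -> (forall i, Cmod (f i) <= b i) ->
  exists l, clim (csum f) l.
Proof.
  intros Hs H. apply clim_Cauchy. intros eps He.
  destruct (summable_tail b Hs eps He) as [N G]. exists N. intros n m Hn Hm.
  destruct (le_ge_dec n m) as [L|L].
  - rewrite Cmod_sub_sym. eapply Rle_lt_trans; [apply csum_diff_le; auto|]. now apply G.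
  - eapply Rle_lt_trans; [apply csum_diff_le; auto|]. now apply G.
Qed.

Lemma csum_tail_le f l b n T : clim (csum f) l -> (forall i, (n <= i)%nat -> Cmod (f i) <= b i) ->
  (forall m, (n <= m)%nat -> rsum b m - rsum b n <= T) -> Cmod (l - csum f n) <= T.
Proof.
  intros Hl H HT.
  apply (clim_le (fun m => csum f (n + m) - csum f n)%C).
  - apply clim_minus; [|apply clim_const].
    intros eps He. destruct (Hl eps He) as [N G]. exists N. intros m Hm. apply G; lia.
  - intros m. eapply Rle_trans; [apply csum_diff_le; [exact H|lia]|]. apply HT; lia.
Qed.

Lemma clim_csum (F : nat -> nat -> C) f n :
  (forall i, clim (fun k => F k i) (f i)) -> clim (fun k => csum (F k) n) (csum f n).
Proof.
  intros Hf. induction n as [|n IH]; simpl; [apply clim_const|]. now apply clim_plus.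
Qed.

(** Tannery's theorem: cut all the sums at an index beyond which the dominating
    series has a small tail. *)
Lemma tannery (F : nat -> nat -> C) (f : nat -> C) (b : nat -> R) (S : nat -> C) (s : C) :
  summable b ->
  (forall k i, Cmod (F k i) <= b i) ->
  (forall i, clim (fun k => F k i) (f i)) ->
  (forall k, clim (csum (F k)) (S k)) ->
  clim (csum f) s ->
  clim S s.
Proof.
  intros Hb HF Hf HS Hs eps He.
  destruct (summable_tail b Hb (eps / 3)) as [N1 G1]; [lra|].
  destruct (Hs (eps / 3)) as [N2 G2]; [lra|].
  set (n := max N1 N2).
  destruct (clim_csum F f n Hf (eps / 3)) as [N3 G3]; [lra|].
  exists N3. intros k Hk.
  specialize (G2 n ltac:(lia)). specialize (G3 k ltac:(lia)).
  assert (T : Cmod (S k - csum (F k) n) <= eps / 3).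
  { apply (csum_tail_le _ _ b); [apply HS| |].
    - intros; apply HF.
    - intros m Hm. left. apply G1; lia. }
  pose proof (Cmod_sub_tri (S k) (csum (F k) n) s).
  pose proof (Cmod_sub_tri (csum (F k) n) (csum f n) s). lra.
Qed.

(** When the sums do not depend on the parameter, the convergence of the limit
    series comes out as well.  Finitely many terms and parameters may escape the
    domination; this leaves out the terms near a pole. *)
Lemma tannery_constant (F : nat -> nat -> C) (f : nat -> C) (b : nat -> R) (s : C) (K I : nat) :
  summable b ->
  (forall k i, (K <= k)%nat -> (I <= i)%nat -> Cmod (F k i) <= b i) ->
  (forall i, clim (fun k => F k i) (f i)) ->
  (forall k, (K <= k)%nat -> clim (csum (F k)) s) ->
  clim (csum f) s.
Proof.
  intros Hb HF Hf HS eps He.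
  destruct (summable_tail b Hb (eps / 2)) as [N1 G1]; [lra|].
  exists (max N1 I). intros n Hn. rewrite Cmod_sub_sym.
  apply Rle_lt_trans with (eps / 2); [|lra].
  apply (clim_le (fun k => s - csum (F (K + k)%nat) n)%C).
  - apply clim_minus; [apply clim_const|].
    apply (clim_comp (fun k => csum (F k) n) _ (fun k => K + k)%nat); [intros; lia|].
    now apply clim_csum.
  - intros k. apply (csum_tail_le _ _ b); [apply HS; lia| |].
    + intros; apply HF; lia.
    + intros m Hm. left. apply G1; lia.
Qed.

Lemma summable_geom r : 0 <= r < 1 -> summable (fun n => r ^ n).
Proof.
  intros Hr. split; [intros; apply pow_le; lra|].
  exists (/ (1 - r)). intros n.
  assert (E : (1 - r) * rsum (fun i => r ^ i) n = 1 - r ^ n).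
  { induction n as [|n IH]; simpl; [ring|]. rewrite Rmult_plus_distr_l, IH; ring. }
  apply Rmult_le_reg_l with (1 - r); [lra|]. rewrite E, Rinv_r by lra.
  pose proof (pow_le r n ltac:(lra)). lra.
Qed.

Lemma summable_inv_sq : summable (fun n => / (INR n + 1) ^ 2).
Proof.
  split.
  - intros n. left. apply Rinv_0_lt_compat, pow_lt. pose proof (pos_INR n); lra.
  - assert (H : forall n, rsum (fun n => / (INR n + 1) ^ 2) (S n) <= 2 - / (INR n + 1)).
    { induction n as [|n IH]; [simpl; lra|].
      change (rsum (fun n => / (INR n + 1) ^ 2) (S n) + / (INR (S n) + 1) ^ 2 <= 2 - / (INR (S n) + 1)).
      rewrite S_INR. assert (P := pos_INR n).
      assert (/ (INR n + 1 + 1) ^ 2 <= / (INR n + 1) - / (INR n + 1 + 1)); [|lra].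
      replace (/ (INR n + 1) - / (INR n + 1 + 1)) with (/ ((INR n + 1) * (INR n + 1 + 1))) by (field; lra).
      apply Rinv_le_contravar; nra. }
    exists 2. intros [|n]; [simpl; lra|]. eapply Rle_trans; [apply H|].
    assert (0 < / (INR n + 1)) by (apply Rinv_0_lt_compat; pose proof (pos_INR n); lra). lra.
Qed.

(** * Complex differentiation *)

Definition near (z : C) (P : C -> Prop) : Prop :=
  exists delta, 0 < delta /\ forall w : C, Cmod (w - z) < delta -> P w.

Definition ccont (f : C -> C) (z : C) : Prop :=
  forall eps, 0 < eps -> near z (fun w => Cmod (f w - f z) < eps).

(** Caratheodory's form of differentiability: rules of calculus reduce to
    algebra and to continuity at one point. *)
Definition cder (f : C -> C) (z l : C) : Prop :=
  exists phi : C -> C, phi z = l /\ ccont phi z /\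
    near z (fun w => f w - f z = phi w * (w - z))%C.

Lemma near_and z P Q : near z P -> near z Q -> near z (fun w => P w /\ Q w).
Proof.
  intros [d1 [D1 H1]] [d2 [D2 H2]]. exists (Rmin d1 d2). split; [now apply Rmin_glb_lt|].
  intros w Hw. split; [apply H1|apply H2]; eapply Rlt_le_trans; try exact Hw.
  apply Rmin_l. apply Rmin_r.
Qed.

Lemma near_imp z (P Q : C -> Prop) : (forall w, P w -> Q w) -> near z P -> near z Q.
Proof. intros H [d [D G]]. exists d. split; auto. Qed.

Lemma near_refl z P : near z P -> P z.
Proof.
  intros [d [D G]]. apply G. replace (z - z)%C with (RtoC 0) by ring. now rewrite Cmod_0.
Qed.

Lemma ccont_near f z P : ccont f z -> near (f z) P -> near z (fun w => P (f w)).
Proof. intros Hf [d [D G]]. apply (near_imp _ _ _ (fun w H => G (f w) H)). now apply Hf. Qed.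

Lemma near_ImP (z : C) y : y < Im z -> near z (fun w => y < Im w).
Proof.
  intros H. exists (Im z - y). split; [lra|]. intros w Hw.
  pose proof (abs_Im_le_Cmod (w - z)). rewrite Im_minus in H0.
  pose proof (Rle_abs (- (Im w - Im z))). rewrite Rabs_Ropp in H1. lra.
Qed.

Lemma ccont_clim f z u : ccont f z -> clim u z -> clim (fun n => f (u n)) (f z).
Proof.
  intros Hf Hu eps He. destruct (Hf eps He) as [d [D G]]. destruct (Hu d D) as [N HN].
  exists N. intros n Hn. apply G. now apply HN.
Qed.

Lemma ccont_ext f g z : near z (fun w => f w = g w) -> ccont f z -> ccont g z.
Proof.
  intros H Hf eps He. generalize (near_and _ _ _ H (Hf eps He)). apply near_imp.
  intros w [E G]. rewrite <- E, <- (near_refl _ _ H). exact G.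
Qed.

Lemma ccont_const c z : ccont (fun _ => c) z.
Proof.
  intros eps He. exists 1. split; [lra|]. intros w _.
  replace (c - c)%C with (RtoC 0) by ring. now rewrite Cmod_0.
Qed.

Lemma ccont_id z : ccont (fun w => w) z.
Proof. intros eps He. exists eps. split; auto. Qed.

Lemma ccont_plus f g z : ccont f z -> ccont g z -> ccont (fun w => f w + g w)%C z.
Proof.
  intros Hf Hg eps He.
  generalize (near_and _ _ _ (Hf (eps / 2) ltac:(lra)) (Hg (eps / 2) ltac:(lra))).
  apply near_imp. intros w [H1 H2].
  replace (f w + g w - (f z + g z))%C with ((f w - f z) + (g w - g z))%C by ring.
  pose proof (Cmod_triangle (f w - f z) (g w - g z)). lra.
Qed.

Lemma ccont_mult f g z : ccont f z -> ccont g z -> ccont (fun w => f w * g w)%C z.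
Proof.
  intros Hf Hg eps He.
  pose proof (Cmod_ge_0 (f z)) as Pf. pose proof (Cmod_ge_0 (g z)) as Pg.
  set (K := Cmod (f z) + Cmod (g z) + 1).
  assert (K0 : 0 < K) by (unfold K; lra).
  set (d := Rmin 1 (eps / K)).
  assert (Hd : 0 < d) by (apply Rmin_glb_lt; [lra|]; now apply Rdiv_lt_0_compat).
  generalize (near_and _ _ _ (Hf d Hd) (Hg d Hd)).
  apply near_imp. intros w [H1 H2].
  replace (f w * g w - f z * g z)%C with
    ((f w - f z) * (g w - g z) + (f z * (g w - g z) + g z * (f w - f z)))%C by ring.
  eapply Rle_lt_trans; [apply Cmod_triangle|].
  eapply Rle_lt_trans; [apply Rplus_le_compat_l, Cmod_triangle|].
  rewrite !Cmod_mult.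
  pose proof (Cmod_ge_0 (f w - f z)). pose proof (Cmod_ge_0 (g w - g z)).
  assert (D1 : d <= 1) by apply Rmin_l.
  assert (D2 : d * K <= eps).
  { pose proof (Rmin_r 1 (eps / K)) as M. fold d in M.
    apply Rmult_le_compat_r with (r := K) in M; [|lra].
    unfold Rdiv in M. rewrite Rmult_assoc, Rinv_l in M; lra. }
  unfold K in D2. nra.
Qed.

Lemma ccont_inv (f : C -> C) z : f z <> 0%C -> ccont f z -> ccont (fun w => / f w)%C z.
Proof.
  intros Hz Hf eps He. pose proof (proj1 (Cmod_gt_0 _) Hz) as L.
  set (l := f z) in *.
  assert (D : 0 < Rmin (Cmod l / 2) (eps * (Cmod l * Cmod l) / 2)).
  { apply Rmin_glb_lt; [lra|]. assert (0 < Cmod l * Cmod l) by nra. nra. }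
  generalize (Hf _ D). apply near_imp. intros w G. fold l in G.
  pose proof (Rlt_le_trans _ _ _ G (Rmin_l _ _)) as G1.
  pose proof (Rlt_le_trans _ _ _ G (Rmin_r _ _)) as G2.
  assert (U : Cmod l / 2 < Cmod (f w)).
  { pose proof (Cmod_triangle (l - f w) (f w)) as T.
    replace (l - f w + f w)%C with l in T by ring. rewrite (Cmod_sub_sym l (f w)) in T. lra. }
  assert (U0 : f w <> 0%C) by (apply (proj2 (Cmod_gt_0 _)); lra).
  replace (/ f w - / l)%C with ((l - f w) / (f w * l))%C by (field; auto).
  rewrite Cmod_div by (now apply Cmult_neq_0). rewrite Cmod_mult, (Cmod_sub_sym l).
  apply Rmult_lt_reg_r with (Cmod (f w) * Cmod l); [nra|].
  unfold Rdiv. rewrite Rmult_assoc, Rinv_l by nra.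
  assert (eps * (Cmod l / 2) < eps * Cmod (f w)) by nra. nra.
Qed.

Lemma clim_inv u (l : C) : l <> 0%C -> clim u l -> clim (fun n => / u n)%C (/ l).
Proof.
  intros Hl H. apply (ccont_clim (fun w => / w)%C l u); auto.
  apply (ccont_inv (fun w => w)); [exact Hl|apply ccont_id].
Qed.

Lemma ccont_comp f g z : ccont g z -> ccont f (g z) -> ccont (fun w => f (g w)) z.
Proof. intros Hg Hf eps He.
  apply (ccont_near g z (fun x => Cmod (f x - f (g z)) < eps) Hg). now apply Hf. Qed.

Lemma cder_cont f z l : cder f z l -> ccont f z.
Proof.
  intros [phi [E [Hp Hn]]].
  apply (ccont_ext (fun w => f z + phi w * (w - z))%C).
  - generalize Hn. apply near_imp. intros w H. rewrite <- H. ring.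
  - apply ccont_plus; [apply ccont_const|]. apply ccont_mult; [exact Hp|].
    apply (ccont_plus (fun w => w) (fun _ => (- z)%C)); [apply ccont_id|apply ccont_const].
Qed.

Lemma cder_ext_near f g z l : near z (fun w => f w = g w) -> cder f z l -> cder g z l.
Proof.
  intros H [phi [E [Hp Hn]]]. exists phi. repeat split; auto.
  generalize (near_and _ _ _ H Hn). apply near_imp. intros w [H1 H2].
  rewrite <- H1, <- (near_refl _ _ H). exact H2.
Qed.

Lemma cder_ext f g z l : (forall w, f w = g w) -> cder f z l -> cder g z l.
Proof. intros H. apply cder_ext_near. exists 1. split; [lra|auto]. Qed.

Lemma cder_const c z : cder (fun _ => c) z 0.
Proof.
  exists (fun _ => 0%C). split; [reflexivity|]. split; [apply ccont_const|].
  exists 1. split; [lra|]. intros; ring.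
Qed.

Lemma cder_id z : cder (fun w => w) z 1.
Proof.
  exists (fun _ => 1%C). split; [reflexivity|]. split; [apply ccont_const|].
  exists 1. split; [lra|]. intros; ring.
Qed.

Lemma cder_plus f g z l m : cder f z l -> cder g z m -> cder (fun w => f w + g w)%C z (l + m).
Proof.
  intros [p [E [Hp Hn]]] [q [F [Hq Hm]]]. exists (fun w => p w + q w)%C.
  split; [now rewrite E, F|]. split; [now apply ccont_plus|].
  generalize (near_and _ _ _ Hn Hm). apply near_imp. intros w [H1 H2].
  replace (f w + g w - (f z + g z))%C with ((f w - f z) + (g w - g z))%C by ring.
  rewrite H1, H2. ring.
Qed.

Lemma cder_mult f g z l m : cder f z l -> cder g z m ->
  cder (fun w => f w * g w)%C z (l * g z + f z * m).
Proof.
  intros Hf Hg. pose proof (cder_cont _ _ _ Hg) as Cg.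
  destruct Hf as [p [E [Hp Hn]]]. destruct Hg as [q [F [Hq Hm]]].
  exists (fun w => p w * g w + f z * q w)%C.
  split; [now rewrite E, F|]. split.
  { apply ccont_plus; apply ccont_mult; auto. apply ccont_const. }
  generalize (near_and _ _ _ Hn Hm). apply near_imp. intros w [H1 H2].
  replace (f w * g w - f z * g z)%C with ((f w - f z) * g w + f z * (g w - g z))%C by ring.
  rewrite H1, H2. ring.
Qed.

Lemma cder_scal c f z l : cder f z l -> cder (fun w => c * f w)%C z (c * l).
Proof.
  intros H. replace (c * l)%C with (0 * f z + c * l)%C by ring.
  apply (cder_mult (fun _ => c)); [apply cder_const|exact H].
Qed.

Lemma cder_minus f g z l m : cder f z l -> cder g z m -> cder (fun w => f w - g w)%C z (l - m).
Proof.
  intros Hf Hg. replace (l - m)%C with (l + -1 * m)%C by ring.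
  apply (cder_ext (fun w => f w + -1 * g w)%C); [intros; ring|].
  apply cder_plus; [|apply cder_scal]; assumption.
Qed.

Lemma cder_comp f g z l m : cder g z m -> cder f (g z) l -> cder (fun w => f (g w)) z (l * m).
Proof.
  intros Hg [p [E [Hp Hn]]]. pose proof (cder_cont _ _ _ Hg) as Cg.
  destruct Hg as [q [F [Hq Hm]]].
  exists (fun w => p (g w) * q w)%C.
  split; [now rewrite E, F|]. split.
  { apply ccont_mult; auto. now apply ccont_comp. }
  generalize (near_and _ _ _ (ccont_near _ _ _ Cg Hn) Hm). apply near_imp. intros w [H1 H2].
  rewrite H1, H2. ring.
Qed.

Lemma cder_inv (f : C -> C) z l : f z <> 0%C -> cder f z l -> cder (fun w => / f w)%C z (- l / (f z * f z)).
Proof.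
  intros Hz Hf. pose proof (cder_cont _ _ _ Hf) as Cf.
  destruct Hf as [p [E [Hp Hn]]].
  exists (fun w => - p w * (/ f w * / f z))%C.
  split; [rewrite E; field; auto|]. split.
  { apply ccont_mult.
    - apply (ccont_ext (fun w => (-1) * p w)%C);
        [exists 1; split; [lra|intros; ring]|apply ccont_mult; [apply ccont_const|exact Hp]].
    - apply ccont_mult; [now apply ccont_inv|apply ccont_const]. }
  assert (N : near z (fun w => f w <> 0%C)).
  { apply (ccont_near f z (fun x => x <> 0%C) Cf).
    exists (Cmod (f z)). split; [exact (proj1 (Cmod_gt_0 _) Hz)|].
    intros w Hw ->. rewrite Cmod_sub_sym in Hw. replace (f z - 0)%C with (f z) in Hw by ring. lra. }
  generalize (near_and _ _ _ N Hn). apply near_imp. intros w [H1 H2].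
  replace (/ f w - / f z)%C with (- (f w - f z) * (/ f w * / f z))%C by (field; auto).
  rewrite H2. ring.
Qed.

(** The difference quotient, with the value l at z, serves as [phi]. *)
Lemma cder_eps f z l : cder f z l <-> forall eps, 0 < eps ->
  near z (fun w => Cmod (f w - f z - l * (w - z)) <= eps * Cmod (w - z)).
Proof.
  split.
  - intros [p [E [Hp Hn]]] eps He. generalize (near_and _ _ _ (Hp eps He) Hn).
    apply near_imp. intros w [H1 H2]. rewrite H2.
    replace (p w * (w - z) - l * (w - z))%C with ((p w - p z) * (w - z))%C by (rewrite E; ring).
    rewrite Cmod_mult. apply Rmult_le_compat_r; [apply Cmod_ge_0|lra].
  - intros H. exists (fun w => if Ceq_dec w z then l else (f w - f z) / (w - z))%C.
    split; [destruct (Ceq_dec z z); congruence|]. split.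
    + intros eps He. generalize (H (eps / 2) ltac:(lra)). apply near_imp.
      intros w G. destruct (Ceq_dec z z) as [_|]; [|congruence].
      destruct (Ceq_dec w z) as [->|N].
      * replace (l - l)%C with (RtoC 0) by ring. rewrite Cmod_0. lra.
      * assert (N' : (w - z)%C <> 0%C) by (now apply Cminus_eq_contra).
        pose proof (proj1 (Cmod_gt_0 _) N') as L.
        replace ((f w - f z) / (w - z) - l)%C with ((f w - f z - l * (w - z)) / (w - z))%C
          by (field; auto).
        rewrite Cmod_div by auto. apply Rmult_lt_reg_r with (Cmod (w - z)); [auto|].
        unfold Rdiv. rewrite Rmult_assoc, Rinv_l by lra. nra.
    + exists 1. split; [lra|]. intros w _. destruct (Ceq_dec w z) as [->|N]; [ring|].
      field. now apply Cminus_eq_contra.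
Qed.

Lemma cder_is_derive f z l : cder f z l -> is_derive (K := C_AbsRing) (V := C_NormedModule) f z l.
Proof.
  intros H. pose proof (proj1 (cder_eps f z l) H) as H'. clear H. split.
  - apply is_linear_scal_l.
  - intros x Hx.
    assert (Ex : x = z).
    { symmetry. apply Cmod_small_eq. intros eps He.
      destruct (Hx (fun w => Cmod (w - x) < eps)) as [d G].
      - exists (mkposreal eps He). intros w Hw. exact Hw.
      - apply G. apply (ball_center (M := AbsRing_UniformSpace C_AbsRing)). }
    subst x. intros eps.
    destruct (H' eps (cond_pos eps)) as [d [D G]]. exists (mkposreal d D). intros w Hw.
    specialize (G w Hw).
    change (Cmod (f w - f z - (w - z) * l) <= eps * Cmod (w - z)).
    now rewrite (Cmult_comm (w - z)).
Qed.

Lemma cder_ex_derive f z l : cder f z l -> ex_derive (K := C_AbsRing) (V := C_NormedModule) f z.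
Proof. intros H. exists l. now apply cder_is_derive. Qed.

(** * The mean value inequality and limits of derivatives *)

Lemma cder_segment f k z h t l : cder f (z + RtoC t * h)%C l ->
  derivable_pt_lim (fun s => Re (k * f (z + RtoC s * h)%C)) t (Re (k * l * h)).
Proof.
  intros H eps He.
  set (K := Cmod k * Cmod h + 1).
  pose proof (Cmod_ge_0 k) as Pk. pose proof (Cmod_ge_0 h) as Ph.
  assert (K0 : 0 < K) by (unfold K; nra).
  destruct (proj1 (cder_eps f _ l) H (eps / (2 * K))) as [d [D G]]; [apply Rdiv_lt_0_compat; lra|].
  assert (D' : 0 < d / (Cmod h + 1)) by (apply Rdiv_lt_0_compat; lra).
  exists (mkposreal _ D'). intros s Hs0 Hs. simpl in Hs.
  assert (Hs' : Cmod (z + RtoC (t + s) * h - (z + RtoC t * h)) = Rabs s * Cmod h).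
  { rewrite <- Cmod_R, <- Cmod_mult. f_equal. rewrite RtoC_plus. ring. }
  assert (B : Rabs s * Cmod h < d).
  { apply Rmult_lt_compat_r with (r := Cmod h + 1) in Hs; [|lra].
    unfold Rdiv in Hs. rewrite Rmult_assoc, Rinv_l in Hs by lra.
    pose proof (Rabs_pos s). nra. }
  specialize (G (z + RtoC (t + s) * h)%C). rewrite Hs' in G. specialize (G B).
  set (p := (z + RtoC t * h)%C) in *. set (p' := (z + RtoC (t + s) * h)%C) in *.
  assert (E : (p' - p = s * h)%C) by (unfold p, p'; rewrite RtoC_plus; ring).
  rewrite E in G.
  assert (F : (Re (k * f p') - Re (k * f p)) / s - Re (k * l * h) =
     Re (k * (f p' - f p - l * (s * h))) / s).
  { replace (k * (f p' - f p - l * (s * h)))%C with (k * f p' - k * f p - s * (k * l * h))%C by ring.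
    rewrite !Re_minus, re_scal_l. field. exact Hs0. }
  rewrite F. unfold Rdiv at 1. rewrite Rabs_mult, Rabs_inv.
  assert (0 < Rabs s) by (now apply Rabs_pos_lt).
  apply Rmult_lt_reg_r with (Rabs s); [auto|]. rewrite Rmult_assoc, Rinv_l, Rmult_1_r by lra.
  eapply Rle_lt_trans; [apply re_le_Cmod|]. rewrite Cmod_mult.
  eapply Rle_lt_trans; [apply Rmult_le_compat_l; [exact Pk|exact G]|].
  assert (M : eps / (2 * K) * (2 * K) = eps) by (field; lra).
  assert (M0 : 0 < eps / (2 * K)) by (apply Rdiv_lt_0_compat; lra).
  set (m := eps / (2 * K)) in *. unfold K in M.
  assert (Cmod k * (m * (Rabs s * Cmod h)) = (m * Rabs s) * (Cmod k * Cmod h)) by ring.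
  assert (0 < m * Rabs s) by nra. nra.
Qed.

(** The real mean value theorem on the segment from z to w, for the component of
    f in the direction of the increment f w - f z; so no constant is lost. *)
Lemma mean_value_le (f f' : C -> C) (z w : C) B :
  (forall t : R, 0 <= t <= 1 ->
     cder f (z + RtoC t * (w - z))%C (f' (z + RtoC t * (w - z))%C) /\
     Cmod (f' (z + RtoC t * (w - z))%C) <= B) ->
  Cmod (f w - f z) <= B * Cmod (w - z).
Proof.
  intros H.
  destruct (Req_dec (Cmod (f w - f z)) 0) as [E0|N0].
  { rewrite E0. specialize (H 0 ltac:(lra)). destruct H as [_ H].
    apply Rmult_le_pos; [|apply Cmod_ge_0]. eapply Rle_trans; [apply Cmod_ge_0|exact H]. }
  set (D := (f w - f z)%C) in *.
  set (k := (Cconj D / Cmod D)%C).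
  assert (D0 : RtoC (Cmod D) <> 0%C) by (intro E; apply RtoC_inj in E; auto).
  assert (Ek : Cmod k = 1).
  { unfold k. rewrite Cmod_div, Cmod_conj, Cmod_R, Rabs_pos_eq by (auto using Cmod_ge_0).
    now apply Rinv_r. }
  set (h := (w - z)%C) in *.
  set (psi := fun s : R => Re (k * f (z + RtoC s * h)%C)).
  destruct (MVT_gen psi 0 1 (fun t => Re (k * f' (z + RtoC t * h)%C * h))) as [c [Hc E]].
  - intros t Ht. rewrite Rmin_left, Rmax_right in Ht by lra.
    apply is_derive_Reals. apply cder_segment. apply H; lra.
  - intros t Ht. rewrite Rmin_left, Rmax_right in Ht by lra.
    apply derivable_continuous_pt. exists (Re (k * f' (z + RtoC t * h)%C * h)).
    apply cder_segment. apply H; lra.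
  - rewrite Rmin_left, Rmax_right in Hc by lra.
    assert (P : psi 1 - psi 0 = Cmod D).
    { unfold psi. rewrite <- Re_minus.
      replace (k * f (z + RtoC 1 * h) - k * f (z + RtoC 0 * h))%C with (RtoC (Cmod D)).
      - apply re_RtoC.
      - replace (z + RtoC 1 * h)%C with w by (unfold h; ring).
        replace (z + RtoC 0 * h)%C with z by (unfold h; ring).
        replace (k * f w - k * f z)%C with (D * Cconj D / Cmod D)%C by (unfold k, D; field; exact D0).
        rewrite <- Cmod2_conj, RtoC_pow. field. exact D0. }
    rewrite P in E. rewrite E. destruct (H c Hc) as [_ Hb]. fold h in Hb.
    eapply Rle_trans; [apply Rle_abs|]. rewrite Rminus_0_r, Rmult_1_r.
    eapply Rle_trans; [apply re_le_Cmod|]. rewrite !Cmod_mult, Ek, Rmult_1_l.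
    apply Rmult_le_compat_r; [apply Cmod_ge_0|exact Hb].
Qed.

Lemma Im_segment (z w : C) y t : y < Im z -> y < Im w -> 0 <= t <= 1 ->
  y < Im (z + RtoC t * (w - z))%C.
Proof.
  intros Hz Hw Ht. rewrite im_plus, im_scal_l, Im_minus.
  destruct (Req_dec t 1) as [->|]; [lra|]. nra.
Qed.

Lemma cder_0_constant (f : C -> C) : (forall z, UHP z -> cder f z 0) ->
  forall z w, UHP z -> UHP w -> f w = f z.
Proof.
  intros H z w Hz Hw. apply Ceq_minus, Cmod_eq_0. apply Rle_antisym; [|apply Cmod_ge_0].
  replace 0 with (0 * Cmod (w - z)) by ring.
  apply (mean_value_le f (fun _ => 0%C)). intros t Ht. split.
  - apply H. now apply Im_segment.
  - rewrite Cmod_0; lra.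
Qed.

(** The mean value inequality for f m - f N bounds the difference quotients of
    F - f N by the tail of the series M, independently of the second point. *)
Lemma cder_lim (y : R) (f g : nat -> C -> C) (F G : C -> C) (M : nat -> R) :
  summable M ->
  (forall n w, y < Im w -> cder (f n) w (g n w)) ->
  (forall n w, y < Im w -> Cmod (g (S n) w - g n w) <= M n) ->
  (forall w, y < Im w -> clim (fun n => f n w) (F w)) ->
  (forall w, y < Im w -> clim (fun n => g n w) (G w)) ->
  forall z, y < Im z -> cder F z (G z).
Proof.
  intros HM Hd Hg HF HG z Hz. apply cder_eps. intros eps He.
  destruct (summable_tail M HM (eps / 4)) as [N HN]; [lra|].
  assert (B : forall w m, y < Im w -> Cmod (g (N + m)%nat w - g N w) <= eps / 4).
  { intros w m Hw. eapply Rle_trans with (rsum M (N + m) - rsum M N).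
    - induction m as [|m IH].
      + rewrite Nat.add_0_r. replace (g N w - g N w)%C with (RtoC 0) by ring. rewrite Cmod_0; lra.
      + rewrite Nat.add_succ_r. simpl. eapply Rle_trans; [apply (Cmod_sub_tri _ (g (N + m)%nat w))|].
        specialize (Hg (N + m)%nat w Hw). lra.
    - left. apply HN; lia. }
  assert (BG : Cmod (G z - g N z) <= eps / 4).
  { apply (clim_le (fun m => g (N + m)%nat z - g N z)%C).
    - apply clim_minus; [|apply clim_const].
      apply (clim_comp (fun n => g n z) _ (fun m => N + m)%nat); [intros; lia|auto].
    - intros m. auto. }
  pose proof (proj1 (cder_eps _ _ _) (Hd N z Hz) (eps / 4) ltac:(lra)) as HN'.
  generalize (near_and _ _ _ (near_ImP z y Hz) HN'). apply near_imp. intros w [Hw Hfw].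
  assert (BF : Cmod ((F w - f N w) - (F z - f N z)) <= eps / 4 * Cmod (w - z)).
  { apply (clim_le (fun m => (f (N + m)%nat w - f N w) - (f (N + m)%nat z - f N z))%C).
    - apply clim_minus; (apply clim_minus; [|apply clim_const]).
      apply (clim_comp (fun n => f n w) _ (fun m => N + m)%nat); [intros; lia|auto].
      apply (clim_comp (fun n => f n z) _ (fun m => N + m)%nat); [intros; lia|auto].
    - intros m.
      apply (mean_value_le (fun x => f (N + m)%nat x - f N x)%C (fun x => g (N + m)%nat x - g N x)%C).
      intros t Ht. pose proof (Im_segment z w y t Hz Hw Ht) as I. split.
      + apply cder_minus; auto.
      + auto. }
  replace (F w - F z - G z * (w - z))%C with
    ((F w - f N w - (F z - f N z)) + ((f N w - f N z - g N z * (w - z)) + (- (G z - g N z)) * (w - z)))%C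
    by ring.
  eapply Rle_trans; [apply Cmod_triangle|].
  eapply Rle_trans; [apply Rplus_le_compat_l, Cmod_triangle|].
  rewrite Cmod_mult, Cmod_opp. pose proof (Cmod_ge_0 (w - z)). nra.
Qed.

(** * The complex exponential *)

Lemma C_ext (a b : C) : Re a = Re b -> Im a = Im b -> a = b.
Proof. intros. now apply injective_projections. Qed.

Lemma Cexp_plus a b : Cexp (a + b) = (Cexp a * Cexp b)%C.
Proof.
  apply C_ext; unfold Cexp; rewrite re_plus, im_plus, exp_plus, ?cos_plus, ?sin_plus; simpl; ring.
Qed.

Lemma Cexp_0 : Cexp 0 = 1%C.
Proof. apply C_ext; unfold Cexp; simpl; rewrite exp_0, ?cos_0, ?sin_0; ring. Qed.

Lemma Cmod_Cexp z : Cmod (Cexp z) = exp (Re z).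
Proof.
  assert (P := exp_pos (Re z)).
  apply Rsqr_inj; [apply Cmod_ge_0|lra|].
  rewrite !Rsqr_pow2, Cmod2_alt. unfold Cexp. simpl.
  pose proof (sin2_cos2 (Im z)) as T. unfold Rsqr in T.
  set (E := exp (Re z)) in *. set (s := sin (Im z)) in *. set (c := cos (Im z)) in *.
  replace (E * c * (E * c * 1) + E * s * (E * s * 1)) with (E * E * (s * s + c * c)) by ring.
  rewrite T. ring.
Qed.

Lemma Cexp_neq_0 z : Cexp z <> 0%C.
Proof. apply (proj2 (Cmod_gt_0 _)). rewrite Cmod_Cexp. apply exp_pos. Qed.

Lemma exp_taylor1 x : Rabs x <= 1 / 2 -> 0 <= exp x - 1 - x <= 2 * (x * x).
Proof.
  intros Hx. apply Rabs_le_between in Hx.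
  pose proof (exp_ineq1_le x) as H1. pose proof (exp_ineq1_le (- x)) as H2.
  split; [lra|]. rewrite exp_Ropp in H2. pose proof (exp_pos x) as P.
  assert (exp x * (1 - x) <= 1).
  { apply Rmult_le_compat_l with (r := exp x) in H2; [|lra]. rewrite Rinv_r in H2 by lra. lra. }
  assert (exp x <= 1 + x + 2 * (x * x)); [|lra].
  apply Rmult_le_reg_r with (1 - x); [lra|]. nra.
Qed.

Lemma one_sub_cos_le y : 0 <= 1 - cos y <= y * y / 2.
Proof.
  split; [pose proof (COS_bound y); lra|].
  assert (E : 1 - cos y = 2 * (sin (y / 2) * sin (y / 2))).
  { replace y with (2 * (y / 2)) at 1 by field. rewrite cos_2a_sin. ring. }
  rewrite E.
  assert (S : Rabs (sin (y / 2)) <= Rabs (y / 2)).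
  { destruct (Rle_dec 0 (y / 2)) as [H|H].
    - rewrite (Rabs_pos_eq (y / 2)) by lra. apply Rabs_le.
      destruct (Rle_lt_or_eq_dec _ _ H) as [G|G]; [|rewrite <- G, sin_0; lra].
      split; [|left; now apply sin_lt_x].
      destruct (Rle_dec (y / 2) 1) as [L|L]; [|pose proof (SIN_bound (y / 2)); lra].
      assert (0 <= sin (y / 2)); [|lra]. apply sin_ge_0; pose proof PI2_1; lra.
    - rewrite <- (Rabs_Ropp (sin _)), <- sin_neg, <- (Rabs_Ropp (y / 2)).
      set (t := - (y / 2)). assert (H0 : 0 < t) by (unfold t; lra).
      rewrite (Rabs_pos_eq t) by lra. apply Rabs_le.
      split; [|left; now apply sin_lt_x].
      destruct (Rle_dec t 1) as [L|L]; [|pose proof (SIN_bound t); lra].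
      assert (0 <= sin t); [|lra]. apply sin_ge_0; pose proof PI2_1; lra. }
  apply Rsqr_le_abs_1 in S. unfold Rsqr in S. nra.
Qed.

Lemma abs_sin_le y : Rabs (sin y) <= Rabs y.
Proof.
  apply Rsqr_le_abs_0. unfold Rsqr.
  pose proof (one_sub_cos_le (2 * y)) as [_ H].
 rewrite cos_2a_sin in H. nra.
Qed.

Lemma sin_sub_le y : Rabs (sin y - y) <= y * y / 2 * Rabs y.
Proof.
  destruct (MVT_gen (fun t => sin t - t) 0 y (fun t => cos t - 1)) as [c [Hc E]].
  - intros t _. auto_derive; [auto|ring].
  - intros t _. apply continuity_pt_minus; [apply continuity_sin|]. apply derivable_continuous_pt, derivable_pt_id.
  - rewrite sin_0 in E. replace (sin y - y) with ((cos c - 1) * (y - 0)) by lra.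
    rewrite Rminus_0_r, Rabs_mult. apply Rmult_le_compat_r; [apply Rabs_pos|].
    pose proof (one_sub_cos_le c) as [H1 H2].
    rewrite Rabs_minus_sym, Rabs_pos_eq by lra.
    assert (c * c <= y * y); [|lra].
    assert (Rabs c <= Rabs y); [|apply Rsqr_le_abs_1 in H; exact H].
    revert Hc. unfold Rmin, Rmax. destruct (Rle_dec 0 y); intros Hc.
    + rewrite !Rabs_pos_eq; lra.
    + rewrite (Rabs_left1 c), (Rabs_left1 y); lra.
Qed.

Lemma Cexp_taylor1 h : Cmod h <= 1 / 2 -> Cmod (Cexp h - 1 - h) <= 8 * (Cmod h * Cmod h).
Proof.
  intros Hh. set (x := Re h). set (y := Im h).
  assert (Hx : Rabs x <= Cmod h) by apply re_le_Cmod.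
  assert (Hy : Rabs y <= Cmod h) by apply abs_Im_le_Cmod.
  set (m := Cmod h) in *.
  eapply Rle_trans; [apply Cmod_le_sum|]. rewrite !Re_minus, !Im_minus.
  fold x y. unfold Cexp. cbn [Re Im fst snd]. fold x y.
  rewrite re_RtoC, im_RtoC.
  pose proof (exp_taylor1 x ltac:(lra)) as E.
  pose proof (one_sub_cos_le y) as Co. pose proof (abs_sin_le y) as S. pose proof (sin_sub_le y) as S3.
  assert (xx : x * x <= m * m).
  { rewrite <- (Rabs_pos_eq (x * x)) by nra. rewrite Rabs_mult. pose proof (Rabs_pos x). nra. }
  assert (yy : y * y <= m * m).
  { rewrite <- (Rabs_pos_eq (y * y)) by nra. rewrite Rabs_mult. pose proof (Rabs_pos y). nra. }
  assert (X : Rabs x <= 1/2) by lra. apply Rabs_le_between in X.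
  assert (E2 : exp x <= 2) by nra. pose proof (exp_pos x) as E0.
  assert (A : Rabs (exp x * cos y - 1 - x) <= 3 * (m * m)).
  { replace (exp x * cos y - 1 - x) with ((exp x - 1 - x) - exp x * (1 - cos y)) by ring.
    assert (0 <= exp x * (1 - cos y) <= m * m) by nra.
    apply Rabs_le. nra. }
  assert (Em : Rabs (exp x - 1) <= 2 * m).
  { replace (exp x - 1) with ((exp x - 1 - x) + x) by ring.
    eapply Rle_trans; [apply Rabs_triang|]. rewrite Rabs_pos_eq by lra.
    assert (0 <= m) by apply Cmod_ge_0. assert (m * m <= m * (1 / 2)) by (apply Rmult_le_compat_l; lra). lra. }
  assert (Y : y * y / 2 * Rabs y <= m * m).
  { pose proof (Rabs_pos y). assert (0 <= y * y) by nra.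
    assert (y * y / 2 * Rabs y <= (m * m) * 1) by (apply Rmult_le_compat; lra). lra. }
  assert (B : Rabs (exp x * sin y - 0 - y) <= 3 * (m * m)).
  { replace (exp x * sin y - 0 - y) with ((exp x - 1) * sin y + (sin y - y)) by ring.
    eapply Rle_trans; [apply Rabs_triang|]. rewrite Rabs_mult.
    pose proof (Rabs_pos (sin y)). pose proof (Rabs_pos (exp x - 1)).
    assert (Rabs (exp x - 1) * Rabs (sin y) <= (2 * m) * m) by (apply Rmult_le_compat; lra).
    lra. }
  assert (0 <= m * m) by nra. lra.
Qed.

Lemma cder_Cexp z : cder Cexp z (Cexp z).
Proof.
  assert (H0 : cder Cexp 0 1).
  { apply cder_eps. intros eps He. exists (Rmin (1 / 2) (eps / 8)). split; [apply Rmin_glb_lt; lra|].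
    intros w Hw. replace (w - 0)%C with w in Hw |- * by ring. rewrite Cexp_0.
    pose proof (Rlt_le_trans _ _ _ Hw (Rmin_l _ _)). pose proof (Rlt_le_trans _ _ _ Hw (Rmin_r _ _)).
    replace (1 * w)%C with w by ring. eapply Rle_trans; [apply Cexp_taylor1; lra|].
    pose proof (Cmod_ge_0 w). nra. }
  apply (cder_ext (fun w => Cexp z * Cexp (w - z))%C).
  { intros w. rewrite <- Cexp_plus. f_equal. ring. }
  cut (cder (fun w => Cexp z * Cexp (w - z))%C z (Cexp z * (1 * (1 - 0)))).
  { intros D. replace (Cexp z * (1 * (1 - 0)))%C with (Cexp z) in D by ring. exact D. }
  apply (cder_scal _ (fun w => Cexp (w - z))). apply (cder_comp Cexp (fun w => w - z)%C).
  - apply cder_minus; [apply cder_id|apply cder_const].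
  - replace (z - z)%C with (RtoC 0) by ring. exact H0.
Qed.

Lemma e_plus a b : e (a + b) = (e a * e b)%C.
Proof. unfold e. rewrite <- Cexp_plus. f_equal. ring. Qed.

Lemma e_0 : e 0 = 1%C.
Proof. unfold e. rewrite <- Cexp_0. f_equal. ring. Qed.

Lemma e_neq_0 z : e z <> 0%C.
Proof. apply Cexp_neq_0. Qed.

Lemma Cmod_e z : Cmod (e z) = exp (- (2 * PI * Im z)).
Proof.
  unfold e. rewrite Cmod_Cexp. f_equal. destruct z as [x y]. simpl. ring.
Qed.

Lemma e_opp z : e (- z) = (/ e z)%C.
Proof.
  assert (E : (e (- z) * e z)%C = 1%C).
  { rewrite <- e_plus. replace (- z + z)%C with (RtoC 0) by ring. apply e_0. }
  replace (e (- z)) with (e (- z) * e z * / e z)%C by (field; apply e_neq_0). rewrite E. ring.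
Qed.

Lemma e_nat_mul n z : e (INR n * z) = (e z ^ n)%C.
Proof.
  induction n as [|n IH].
  - simpl INR. replace (0 * z)%C with (RtoC 0) by ring. apply e_0.
  - rewrite S_INR, RtoC_plus, Cpow_S, <- IH, <- e_plus. f_equal. ring.
Qed.

Lemma e_half : e (1 / 2) = (-1)%C.
Proof.
  unfold e, Cexp.
  replace (2 * PI * Ci * (1 / 2))%C with (Ci * PI)%C by field.
  apply C_ext; simpl.
  - replace (0 * PI - 1 * 0) with 0 by ring. replace (0 * 0 + 1 * PI) with PI by ring.
    rewrite exp_0, cos_PI. ring.
  - replace (0 * PI - 1 * 0) with 0 by ring. replace (0 * 0 + 1 * PI) with PI by ring.
    rewrite exp_0, sin_PI. ring.
Qed.

Lemma e_1 : e 1 = 1%C.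
Proof.
  assert (E : RtoC 1 = (1 / 2 + 1 / 2)%C) by field. rewrite E at 1. rewrite e_plus, e_half. ring.
Qed.

Lemma e_nat n : e (INR n) = 1%C.
Proof.
  replace (RtoC (INR n)) with (INR n * 1)%C by ring. rewrite e_nat_mul, e_1. apply Cpow_1_l.
Qed.

Lemma e_Z k : e (IZR k) = 1%C.
Proof.
  destruct k as [|p|p].
  - apply e_0.
  - rewrite <- (positive_nat_Z p), <- INR_IZR_INZ. apply e_nat.
  - change (Z.neg p) with (- Z.pos p)%Z. rewrite opp_IZR, RtoC_opp, e_opp.
    rewrite <- (positive_nat_Z p), <- INR_IZR_INZ, e_nat. field.
Qed.

Lemma e_plus_Z z k : e (z + IZR k) = e z.
Proof. rewrite e_plus, e_Z. ring. Qed.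

Lemma cder_e z : cder e z (2 * PI * Ci * e z).
Proof.
  replace (2 * PI * Ci * e z)%C with (e z * (2 * PI * Ci * 1))%C by ring.
  apply (cder_comp Cexp (fun w => 2 * PI * Ci * w)%C).
  - apply (cder_scal (2 * PI * Ci)%C (fun w => w)). apply cder_id.
  - apply cder_Cexp.
Qed.

Lemma Cmod_e_lt_1 z : UHP z -> Cmod (e z) < 1.
Proof.
  intros H. rewrite Cmod_e, <- exp_0. apply exp_increasing. unfold UHP in H.
  pose proof PI_RGT_0. nra.
Qed.

(** * Partial fractions of the cotangent and of the squared cosecant *)

(** Up to constants, 1 / sin^2(pi w) and cot(pi w), as rational functions of
    e w: [qcsc2 w] is -1 / (4 sin^2(pi w)) and [qcot w] is - i cot(pi w). *)
Definition qcsc2 (w : C) : C := (e w / ((1 - e w) * (1 - e w)))%C.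
Definition qcot (w : C) : C := ((e w + 1) / (e w - 1))%C.

Lemma e_double_neq w : e w <> 1%C -> e (w / 2) <> 1%C /\ e (w / 2) <> (-1)%C /\
   e w = (e (w / 2) * e (w / 2))%C /\ e ((w + 1) / 2) = (- e (w / 2))%C.
Proof.
  intros H. assert (E : e w = (e (w / 2) * e (w / 2))%C).
  { rewrite <- e_plus. f_equal. field. }
  repeat split; auto.
  - intros G. apply H. rewrite E, G. ring.
  - intros G. apply H. rewrite E, G. ring.
  - replace ((w + 1) / 2)%C with (w / 2 + 1 / 2)%C by field. rewrite e_plus, e_half. ring.
Qed.

Lemma one_sub_neq (p : C) : p <> 1%C -> (1 - p)%C <> 0%C.
Proof. intros H. apply Cminus_eq_contra. auto. Qed.

Lemma qcsc2_double w : e w <> 1%C ->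
  qcsc2 w = (/ 4 * (qcsc2 (w / 2) + qcsc2 ((w + 1) / 2)))%C.
Proof.
  intros H. destruct (e_double_neq w H) as [H1 [H2 [E1 E2]]].
  unfold qcsc2. rewrite E1, E2. set (p := e (w / 2)) in *.
  assert (A : (1 - p)%C <> 0%C) by now apply one_sub_neq.
  assert (B : (1 + p)%C <> 0%C).
  { intros G. apply H2. replace p with ((1 + p) - 1)%C by ring. rewrite G. ring. }
  field. repeat split; auto.
  - replace (1 - - p)%C with (1 + p)%C by ring. auto.
  - replace (1 - p * p)%C with ((1 - p) * (1 + p))%C by ring. now apply Cmult_neq_0.
Qed.

Lemma qcot_double w : e w <> 1%C ->
  qcot w = (/ 2 * (qcot (w / 2) + qcot ((w + 1) / 2)))%C.
Proof.
  intros H. destruct (e_double_neq w H) as [H1 [H2 [E1 E2]]].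
  unfold qcot. rewrite E1, E2. set (p := e (w / 2)) in *.
  assert (A : (p - 1)%C <> 0%C) by now apply Cminus_eq_contra.
  assert (B : (p + 1)%C <> 0%C).
  { intros G. apply H2. replace p with ((p + 1) - 1)%C by ring. rewrite G. ring. }
  field. repeat split; auto.
  - replace (- p - 1)%C with (- (1) * (p + 1))%C by ring. apply Cmult_neq_0; auto.
    intros G. apply C1_nz. replace (RtoC 1) with (- - (1))%C by ring. rewrite G. ring.
  - replace (p * p - 1)%C with ((p - 1) * (p + 1))%C by ring. now apply Cmult_neq_0.
Qed.

Lemma e_scale_neq k j (w : C) : e w <> 1%C -> e ((w + INR j) / 2 ^ k) <> 1%C.
Proof.
  intros H G. apply H.
  assert (P : (2 ^ k)%C <> 0%C) by (apply Cpow_nz; intro E; apply RtoC_inj in E; lra).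
  assert (E : (w + INR j = INR (2 ^ k) * ((w + INR j) / 2 ^ k))%C).
  { rewrite pow_INR. simpl (INR 2). replace (1 + 1) with 2 by ring. rewrite RtoC_pow. field. auto. }
  apply (f_equal e) in E. rewrite e_nat_mul, G, Cpow_1_l in E.
  rewrite INR_IZR_INZ, e_plus_Z in E. exact E.
Qed.

(** Iterating a duplication formula spreads the value at w over the points
    (w + n) / 2^k with n running from - 2^(k-1) to 2^(k-1) - 1. *)
Lemma duplication_iter (F : C -> C) (alpha : C) :
  (forall w, e w <> 1%C -> F w = (alpha * (F (w / 2) + F ((w + 1) / 2)))%C) ->
  forall k w, e w <> 1%C ->
    F w = (alpha ^ k * csum (fun j => F ((w + INR j) / 2 ^ k))%C (2 ^ k)%nat)%C.
Proof.
  intros HF. assert (T : RtoC 2 <> 0%C) by (intro E; apply RtoC_inj in E; lra).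
  induction k as [|k IH]; intros w Hw.
  - simpl. replace ((w + 0) / 1)%C with w by field. ring.
  - rewrite (IH w Hw). cbn [Cpow].
    replace (2 ^ S k)%nat with (2 ^ k + 2 ^ k)%nat by (simpl; lia).
    rewrite csum_add, <- csum_plus.
    rewrite (csum_ext _ (fun j => alpha * (F ((w + INR j) / (2 * 2 ^ k)) +
        F ((w + INR (2 ^ k + j)) / (2 * 2 ^ k))))%C).
    + rewrite csum_scal. ring.
    + intros j. rewrite HF by now apply e_scale_neq.
      assert (P : (2 ^ k)%C <> 0%C) by now apply Cpow_nz.
      f_equal. f_equal; f_equal.
      * field. auto.
      * rewrite plus_INR, pow_INR. simpl (INR 2). replace (1 + 1) with 2 by ring.
        rewrite RtoC_plus, RtoC_pow. field. auto.
Qed.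

Lemma duplication_symmetric (F : C -> C) (alpha : C) :
  (forall w, e w <> 1%C -> F w = (alpha * (F (w / 2) + F ((w + 1) / 2)))%C) ->
  (forall w, F (w + 1)%C = F w) ->
  forall k w, e w <> 1%C ->
    F w = csum (fun j => alpha ^ S k * (F ((w + INR j) / 2 ^ S k) +
                                       F ((w - 1 - INR j) / 2 ^ S k)))%C (2 ^ k)%nat.
Proof.
  intros HF HP k w Hw. assert (T : RtoC 2 <> 0%C) by (intro E; apply RtoC_inj in E; lra).
  assert (P : (2 ^ k)%C <> 0%C) by now apply Cpow_nz.
  rewrite (duplication_iter F alpha HF (S k) w Hw).
  replace (2 ^ S k)%nat with (2 ^ k + 2 ^ k)%nat by (simpl; lia).
  rewrite csum_scal, csum_add, csum_plus. f_equal. f_equal.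
  rewrite csum_rev. apply csum_ext_lt. intros j Hj.
  rewrite <- (HP ((w - 1 - INR j) / 2 ^ S k)%C). f_equal.
  replace (2 ^ k + (2 ^ k - 1 - j))%nat with (2 * 2 ^ k - (1 + j))%nat by lia.
  rewrite minus_INR by lia. rewrite mult_INR, plus_INR, pow_INR. simpl (INR 2). simpl (INR 1).
  replace (1 + 1) with 2 by ring. cbn [Cpow].
  rewrite RtoC_minus, RtoC_mult, RtoC_plus, RtoC_pow. field. auto.
Qed.

(** ** Estimates for [1 - e x] *)

(** From sin t = 4 sin(t/4) cos(t/4) cos(t/2); on this range the elementary
    bounds keep every factor away from 0. *)
Lemma sin_lower t : 0 <= t <= 5 / 2 -> t / 8 <= sin t.
Proof.
  intros Ht.
  replace t with (2 * (2 * (t / 4))) at 2 by field. rewrite sin_2a, (sin_2a (t / 4)).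
  replace (2 * (t / 4)) with (t / 2) by field.
  pose proof (one_sub_cos_le (t / 2)) as [_ C2]. pose proof (one_sub_cos_le (t / 4)) as [_ C4].
  pose proof (sin_sub_le (t / 4)) as S. rewrite (Rabs_pos_eq (t / 4)) in S by lra.
  apply Rabs_le_between in S.
  assert (T2 : t / 2 * (t / 2) <= 5 / 4 * (5 / 4)) by (apply Rmult_le_compat; lra).
  assert (T4 : t / 4 * (t / 4) <= 5 / 8 * (5 / 8)) by (apply Rmult_le_compat; lra).
  assert (c2 : 1 / 5 <= cos (t / 2)) by lra.
  assert (c4 : 4 / 5 <= cos (t / 4)) by lra.
  assert (s4 : 4 / 5 * (t / 4) <= sin (t / 4)).
  { assert (t / 4 * (t / 4) / 2 * (t / 4) <= 1 / 5 * (t / 4)); [|lra].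
    apply Rmult_le_compat_r; lra. }
  assert (4 / 5 * (t / 4) * (4 / 5) <= sin (t / 4) * cos (t / 4)) by (apply Rmult_le_compat; lra).
  assert (4 / 5 * (t / 4) * (4 / 5) * (1 / 5) <= sin (t / 4) * cos (t / 4) * cos (t / 2))
    by (apply Rmult_le_compat; lra).
  lra.
Qed.

(** With r = exp(- pi Im x), the square of |1 - e x| is
    (1 - r^2)^2 + 4 r^2 sin^2(pi Re x).  The range of Re x stays below 1, the
    next zero of the sine, and beyond 1/2, so that the points (w + n) / 2^k of the
    duplication formula fall into it for large k. *)
Lemma one_sub_e_lower x Y : Rabs (Re x) <= 5 / 8 -> Rabs (Im x) <= Y ->
  exp (- (PI * Y)) / 4 * Rabs (Re x) <= Cmod (1 - e x).
Proof.
  intros Hx HY. set (a := Re x) in *. set (b := Im x) in *.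
  pose proof PI_4 as P4. pose proof PI2_1 as P2.
  set (r := exp (- (PI * b))).
  assert (R0 : 0 < r) by apply exp_pos.
  assert (Hr : exp (- (PI * Y)) <= r).
  { apply Rabs_le_between in HY. unfold r.
    destruct (Req_dec b Y) as [->|]; [lra|]. left. apply exp_increasing. nra. }
  assert (S : Rabs a / 4 <= Rabs (sin (PI * a))).
  { assert (E : Rabs (sin (PI * a)) = Rabs (sin (PI * Rabs a))).
    { unfold Rabs at 3. destruct (Rcase_abs a); [|reflexivity].
      replace (PI * - a) with (- (PI * a)) by ring. rewrite sin_neg, Rabs_Ropp. reflexivity. }
    rewrite E. pose proof (Rabs_pos a).
    assert (2 * Rabs a <= PI * Rabs a) by (apply Rmult_le_compat_r; lra).
    assert (PI * Rabs a <= 4 * (5 / 8)) by (apply Rmult_le_compat; lra).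
    pose proof (sin_lower (PI * Rabs a) ltac:(lra)).
    rewrite (Rabs_pos_eq (sin _)) by lra. lra. }
  assert (E : Cmod (1 - e x) ^ 2 = (1 - r * r) ^ 2 + 4 * (r * r) * (sin (PI * a)) ^ 2).
  { rewrite Cmod2_alt, Re_minus, Im_minus, re_RtoC, im_RtoC.
    assert (Er : exp (- (2 * PI * b)) = r * r) by (unfold r; rewrite <- exp_plus; f_equal; ring).
    assert (Ec : Re (e x) = r * r * cos (2 * (PI * a)) /\ Im (e x) = r * r * sin (2 * (PI * a))).
    { rewrite <- Er. unfold a, b. destruct x as [u v]. unfold e, Cexp. simpl. split; f_equal; f_equal; ring. }
    destruct Ec as [-> ->]. rewrite cos_2a_sin, sin_2a.
    pose proof (sin2_cos2 (PI * a)) as T. unfold Rsqr in T.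
    set (s := sin (PI * a)) in *. set (c := cos (PI * a)) in *.
    transitivity ((1 - r * r * (1 - 2 * s * s)) ^ 2 + (r * r) ^ 2 * 4 * (s * s) * (c * c)); [ring|].
    replace (c * c) with (1 - s * s) by lra. ring. }
  assert (L : (r * Rabs a / 2) ^ 2 <= Cmod (1 - e x) ^ 2).
  { rewrite E. assert (0 <= (1 - r * r) ^ 2) by apply pow2_ge_0.
    assert ((Rabs a / 4) ^ 2 <= (sin (PI * a)) ^ 2).
    { rewrite <- (pow2_abs (sin _)). apply pow_incr. split; [pose proof (Rabs_pos a); lra|auto]. }
    assert (0 <= r * r) by nra. nra. }
  assert (M : r * Rabs a / 2 <= Cmod (1 - e x)).
  { apply Rsqr_incr_0_var; [|apply Cmod_ge_0]. rewrite !Rsqr_pow2. exact L. }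
  pose proof (Rabs_pos a). pose proof (exp_pos (- (PI * Y))). nra.
Qed.

Lemma Cmod_e_upper x Y : Rabs (Im x) <= Y -> Cmod (e x) <= exp (2 * PI * Y).
Proof.
  intros H. rewrite Cmod_e. apply Rabs_le_between in H. pose proof PI_RGT_0.
  destruct (Req_dec (- (2 * PI * Im x)) (2 * PI * Y)) as [->|]; [lra|].
  left. apply exp_increasing. assert (- (2 * PI * Im x) <= 2 * PI * Y) by nra. lra.
Qed.

Lemma e_sub_1_upper x Y : Rabs (Im x) <= Y -> Cmod (e x - 1) <= 2 * PI * exp (2 * PI * Y) * Cmod x.
Proof.
  intros H. pose proof PI_RGT_0.
  rewrite <- e_0. replace (Cmod x) with (Cmod (x - 0)) by (f_equal; ring).
  apply (mean_value_le e (fun w => 2 * PI * Ci * e w)%C).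
  intros t Ht. split; [apply cder_e|].
  rewrite !Cmod_mult, Cmod_Ci, !Cmod_R, !Rabs_pos_eq, Rmult_1_r by lra.
  apply Rmult_le_compat_l; [lra|]. apply Cmod_e_upper.
  replace (0 + t * (x - 0))%C with (t * x)%C by ring. rewrite im_scal_l, Rabs_mult, (Rabs_pos_eq t) by lra.
  pose proof (Rabs_pos (Im x)). nra.
Qed.

Lemma clim_half_pow (u : C) : clim (fun k => u / 2 ^ S k)%C 0.
Proof.
  apply (clim_0_le _ (fun k => Cmod u * (1 / 2) ^ S k)).
  - intros k. rewrite Cmod_div by (apply Cpow_nz; intro E; apply RtoC_inj in E; lra).
    rewrite Cmod_pow, Cmod_R, Rabs_pos_eq by lra. unfold Rdiv. rewrite Rmult_1_l, pow_inv. lra.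
  - replace 0 with (Cmod u * 0) by ring. apply (is_lim_seq_scal_l _ (Cmod u) 0).
    apply (is_lim_seq_incr_1 (fun k => (1/2)^k)). apply is_lim_seq_geom.
    rewrite Rabs_pos_eq; lra.
Qed.

Lemma clim_e_quotient (u : C) : u <> 0%C ->
  clim (fun k => 2 ^ S k * (e (u / 2 ^ S k) - 1))%C (2 * PI * Ci * u).
Proof.
  intros Hu. destruct (cder_e 0) as [phi [E [Hp Hn]]].
  rewrite e_0 in E.
  pose proof (clim_half_pow u) as L.
  destruct Hn as [d [D Hn]]. destruct (L d D) as [N HN].
  apply (clim_ext_from (fun k => u * phi (u / 2 ^ S k))%C _ _ N).
  - intros k Hk. specialize (HN k Hk). specialize (Hn _ HN). rewrite e_0 in Hn. rewrite Hn.
    field. apply Cpow_nz; intro F; apply RtoC_inj in F; lra.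
  - replace (2 * PI * Ci * u)%C with (u * phi 0)%C by (rewrite E; ring).
    apply clim_scal. apply ccont_clim; assumption.
Qed.

Lemma PI_neq_0C : RtoC PI <> 0%C.
Proof. intro E. apply RtoC_inj in E. now apply PI_neq0. Qed.

Lemma two_neq_0C : RtoC 2 <> 0%C.
Proof. intro E. apply RtoC_inj in E. lra. Qed.

Lemma Ci_sq : (Ci * Ci = -1)%C.
Proof. apply C_ext; simpl; ring. Qed.

Lemma clim_qcsc2_scaled (u : C) : u <> 0%C ->
  clim (fun k => (/ 4) ^ S k * qcsc2 (u / 2 ^ S k))%C (- / (4 * PI * PI * (u * u))).
Proof.
  intros Hu. pose proof PI_neq_0C as P. pose proof two_neq_0C as T. pose proof Ci_nz as I.
  assert (N : (2 * PI * Ci * u)%C <> 0%C) by (repeat apply Cmult_neq_0; auto).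
  pose proof (clim_e_quotient u Hu) as Q.
  pose proof (clim_inv _ _ N Q) as QI.
  pose proof (clim_mult _ _ _ _ QI QI) as Q2.
  pose proof (ccont_clim e 0 _ (cder_cont _ _ _ (cder_e 0)) (clim_half_pow u)) as E0.
  pose proof (clim_mult _ _ _ _ E0 Q2) as Q3. rewrite e_0 in Q3.
  replace (- / (4 * PI * PI * (u * u)))%C with (1 * (/ (2 * PI * Ci * u) * / (2 * PI * Ci * u)))%C.
  - revert Q3. apply clim_ext. intros k. unfold qcsc2.
    assert (Pk : (2 ^ S k)%C <> 0%C) by now apply Cpow_nz.
    replace ((/ 4) ^ S k)%C with (/ (2 ^ S k * 2 ^ S k))%C.
    + destruct (Ceq_dec (e (u / 2 ^ S k)) 1) as [G|G].
      * rewrite G. replace (2 ^ S k * (1 - 1))%C with (RtoC 0) by ring.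
        replace ((1 - 1) * (1 - 1))%C with (RtoC 0) by ring.
        assert (Z : (/ 0 = 0)%C) by (apply C_ext; simpl; unfold Rdiv; ring).
        unfold Cdiv. rewrite Z. ring.
      * field. repeat split; auto; now apply Cminus_eq_contra.
    + rewrite <- Cpow_mult_l. rewrite <- Cpow_inv by now apply Cmult_neq_0. f_equal. field.
  - assert (S : (Ci * Ci = -1)%C) by apply Ci_sq.
    transitivity (/ ((Ci * Ci) * (4 * PI * PI * (u * u))))%C; [field; auto|rewrite S; field; auto].
Qed.

Lemma clim_qcot_scaled (u : C) : u <> 0%C ->
  clim (fun k => (/ 2) ^ S k * qcot (u / 2 ^ S k))%C (/ (PI * Ci * u)).
Proof.
  intros Hu. pose proof PI_neq_0C as P. pose proof two_neq_0C as T. pose proof Ci_nz as I.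
  assert (N : (2 * PI * Ci * u)%C <> 0%C) by (repeat apply Cmult_neq_0; auto).
  pose proof (clim_inv _ _ N (clim_e_quotient u Hu)) as QI.
  pose proof (ccont_clim e 0 _ (cder_cont _ _ _ (cder_e 0)) (clim_half_pow u)) as E0.
  pose proof (clim_mult _ _ _ _ (clim_plus _ _ _ _ E0 (clim_const 1)) QI) as Q3. rewrite e_0 in Q3.
  replace (/ (PI * Ci * u))%C with ((1 + 1) * / (2 * PI * Ci * u))%C by (field; auto).
  revert Q3. apply clim_ext. intros k. unfold qcot.
  assert (Pk : (2 ^ S k)%C <> 0%C) by now apply Cpow_nz.
  rewrite Cpow_inv by auto.
  destruct (Ceq_dec (e (u / 2 ^ S k)) 1) as [G|G].
  - rewrite G. replace (2 ^ S k * (1 - 1))%C with (RtoC 0) by ring.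
    replace (1 - 1)%C with (RtoC 0) by ring.
    assert (Z : (/ 0 = 0)%C) by (apply C_ext; simpl; unfold Rdiv; ring).
    unfold Cdiv. rewrite Z. ring.
  - field. split; auto. now apply Cminus_eq_contra.
Qed.

Lemma pow2_C_neq k : (2 ^ k)%C <> 0%C.
Proof. apply Cpow_nz, two_neq_0C. Qed.

Lemma Re_div_pow2 v k : Re (v / 2 ^ k) = Re v / 2 ^ k.
Proof.
  rewrite <- RtoC_pow. unfold Cdiv. rewrite <- RtoC_inv by (apply pow_nonzero; lra).
  apply re_scal_r.
Qed.

Lemma Im_div_pow2 v k : Im (v / 2 ^ k) = Im v / 2 ^ k.
Proof.
  rewrite <- RtoC_pow. unfold Cdiv. rewrite <- RtoC_inv by (apply pow_nonzero; lra).
  apply im_scal_r.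
Qed.

Lemma one_sub_e_scaled v Y k : Rabs (Re v) <= 5 / 8 * 2 ^ k -> Rabs (Im v) <= Y ->
  exp (- (PI * Y)) / 4 * Rabs (Re v) <= 2 ^ k * Cmod (1 - e (v / 2 ^ k)) /\
  Rabs (Im (v / 2 ^ k)) <= Y.
Proof.
  intros HR HI. assert (P : 0 < 2 ^ k) by (apply pow_lt; lra).
  assert (P1 : 1 <= 2 ^ k) by (apply pow_R1_Rle; lra).
  assert (I : Rabs (Im (v / 2 ^ k)) <= Y).
  { rewrite Im_div_pow2. unfold Rdiv. rewrite Rabs_mult, (Rabs_pos_eq (/ _)) by (left; now apply Rinv_0_lt_compat).
    apply Rmult_le_reg_r with (2 ^ k); auto. rewrite Rmult_assoc, Rinv_l by lra.
    pose proof (Rabs_pos (Im v)). nra. }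
  split; auto.
  assert (R : Rabs (Re (v / 2 ^ k)) * 2 ^ k = Rabs (Re v)).
  { rewrite Re_div_pow2. unfold Rdiv. rewrite Rabs_mult, (Rabs_pos_eq (/ _)) by (left; now apply Rinv_0_lt_compat).
    rewrite Rmult_assoc, Rinv_l by lra. ring. }
  assert (B : Rabs (Re (v / 2 ^ k)) <= 5 / 8).
  { apply Rmult_le_reg_r with (2 ^ k); lra. }
  pose proof (one_sub_e_lower _ Y B I) as L. rewrite <- R.
  apply Rmult_le_compat_l with (r := 2 ^ k) in L; lra.
Qed.

Lemma Rsq_inv_le a b x y : 0 < a <= x -> 0 < b <= y -> / (x * y) <= / (a * b).
Proof. intros Ha Hb. apply Rinv_le_contravar; [nra|]. apply Rmult_le_compat; lra. Qed.

(** The factor 4^(-k) of the duplication formula is absorbed by the two factors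
    1 - e(v / 2^k) of the denominator, which leaves a bound independent of k. *)
Lemma qcsc2_scaled_le v Y k c : Rabs (Re v) <= 5 / 8 * 2 ^ k -> Rabs (Im v) <= Y ->
  0 < c <= Rabs (Re v) ->
  Cmod ((/ 4) ^ k * qcsc2 (v / 2 ^ k)) <=
    exp (2 * PI * Y) * (/ (exp (- (PI * Y)) / 4 * (exp (- (PI * Y)) / 4)) * / (c * c)).
Proof.
  intros HR HI Hc. destruct (one_sub_e_scaled v Y k HR HI) as [L I].
  set (kap := exp (- (PI * Y)) / 4) in *.
  assert (K : 0 < kap) by (unfold kap; pose proof (exp_pos (- (PI * Y))); lra).
  assert (P : 0 < 2 ^ k) by (apply pow_lt; lra).
  assert (D : kap * c <= 2 ^ k * Cmod (1 - e (v / 2 ^ k))) by nra.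
  assert (N : (1 - e (v / 2 ^ k))%C <> 0%C).
  { apply (proj2 (Cmod_gt_0 _)). assert (0 < kap * c) by nra. nra. }
  unfold qcsc2. rewrite Cmod_mult, Cmod_div by now apply Cmult_neq_0.
  rewrite Cmod_mult, Cmod_pow.
  replace (Cmod (/ 4)) with (/ (2 * 2)) by
    (rewrite <- RtoC_inv by lra; rewrite Cmod_R, Rabs_pos_eq; lra).
  rewrite pow_inv, Rpow_mult_distr.
  set (m := Cmod (1 - e (v / 2 ^ k))) in *.
  assert (M : 0 < m) by exact (proj1 (Cmod_gt_0 _) N).
  replace (/ (2 ^ k * 2 ^ k) * (Cmod (e (v / 2 ^ k)) / (m * m))) with
    (Cmod (e (v / 2 ^ k)) * / ((2 ^ k * m) * (2 ^ k * m))) by (field; lra).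
  rewrite <- Rinv_mult.
  replace (kap * kap * (c * c)) with ((kap * c) * (kap * c)) by ring.
  apply Rmult_le_compat; [apply Cmod_ge_0| |now apply Cmod_e_upper|].
  - left. apply Rinv_0_lt_compat. assert (0 < 2 ^ k * m) by nra. nra.
  - apply Rsq_inv_le; nra.
Qed.

(** A single cotangent would only give a bound of order 1 / j.  The two of a pair
    nearly cancel: with p and q their values of [e], the numerator of the sum is
    2 (p q - 1), and p q = e((2 w - 1) / 2^k) no longer depends on j. *)
Lemma qcot_pair_scaled_le w j Y k c :
  Rabs (Re (w + INR j)) <= 5 / 8 * 2 ^ k -> Rabs (Re (w - 1 - INR j)) <= 5 / 8 * 2 ^ k ->
  Rabs (Im w) <= Y ->
  0 < c -> c <= Rabs (Re (w + INR j)) -> c <= Rabs (Re (w - 1 - INR j)) ->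
  Cmod ((/ 2) ^ k * (qcot ((w + INR j) / 2 ^ k) + qcot ((w - 1 - INR j) / 2 ^ k))) <=
    (2 * (2 * PI * exp (2 * PI * (2 * Y)) * Cmod (2 * w - 1))) *
      (/ (exp (- (PI * Y)) / 4 * (exp (- (PI * Y)) / 4)) * / (c * c)).
Proof.
  intros R1 R2 HI Hc C1 C2.
  assert (I1 : Rabs (Im (w + INR j)) <= Y) by (rewrite im_plus, im_RtoC, Rplus_0_r; exact HI).
  assert (I2 : Rabs (Im (w - 1 - INR j)) <= Y) by (rewrite !Im_minus, !im_RtoC, !Rminus_0_r; exact HI).
  destruct (one_sub_e_scaled _ Y k R1 I1) as [L1 _].
  destruct (one_sub_e_scaled _ Y k R2 I2) as [L2 _].
  set (kap := exp (- (PI * Y)) / 4) in *.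
  assert (K : 0 < kap) by (unfold kap; pose proof (exp_pos (- (PI * Y))); lra).
  assert (P : 0 < 2 ^ k) by (apply pow_lt; lra).
  assert (P1 : 1 <= 2 ^ k) by (apply pow_R1_Rle; lra).
  set (v1 := (w + INR j)%C) in *. set (v2 := (w - 1 - INR j)%C) in *.
  assert (Y0 : 0 <= Y) by (eapply Rle_trans; [apply Rabs_pos|exact HI]).
  assert (Num : Cmod (e (v1 / 2 ^ k) * e (v2 / 2 ^ k) - 1) * 2 ^ k <=
     2 * PI * exp (2 * PI * (2 * Y)) * Cmod (2 * w - 1)).
  { rewrite <- e_plus.
    replace (v1 / 2 ^ k + v2 / 2 ^ k)%C with ((2 * w - 1) / 2 ^ k)%C
      by (unfold v1, v2; field; apply pow2_C_neq).
    assert (B : Rabs (Im ((2 * w - 1) / 2 ^ k)) <= 2 * Y).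
    { rewrite Im_div_pow2, Im_minus, im_scal_l, im_RtoC, Rminus_0_r.
      unfold Rdiv. rewrite !Rabs_mult, (Rabs_pos_eq 2), (Rabs_pos_eq (/ _)) by (try left; try apply Rinv_0_lt_compat; lra).
      apply Rmult_le_reg_r with (2 ^ k); auto. rewrite !Rmult_assoc, Rinv_l by lra.
      pose proof (Rabs_pos (Im w)). nra. }
    pose proof (e_sub_1_upper _ _ B) as U.
    apply Rmult_le_compat_r with (r := 2 ^ k) in U; [|lra].
    eapply Rle_trans; [exact U|]. right.
    rewrite Cmod_div by apply pow2_C_neq. rewrite Cmod_pow, Cmod_R, (Rabs_pos_eq 2) by lra.
    field. lra. }
  set (m1 := Cmod (1 - e (v1 / 2 ^ k))) in *. set (m2 := Cmod (1 - e (v2 / 2 ^ k))) in *.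
  assert (Q : 0 < kap * c) by nra.
  assert (M1 : 0 < m1) by nra. assert (M2 : 0 < m2) by nra.
  assert (N1 : (1 - e (v1 / 2 ^ k))%C <> 0%C) by exact (proj2 (Cmod_gt_0 _) M1).
  assert (N2 : (1 - e (v2 / 2 ^ k))%C <> 0%C) by exact (proj2 (Cmod_gt_0 _) M2).
  assert (E : ((/ 2) ^ k * (qcot (v1 / 2 ^ k) + qcot (v2 / 2 ^ k)) =
    2 * (e (v1 / 2 ^ k) * e (v2 / 2 ^ k) - 1) / (2 ^ k * ((1 - e (v1 / 2 ^ k)) * (1 - e (v2 / 2 ^ k)))))%C).
  { unfold qcot. rewrite Cpow_inv by apply two_neq_0C.
    set (p := e (v1 / 2 ^ k)) in *. set (q := e (v2 / 2 ^ k)) in *.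
    assert ((p - 1)%C <> 0%C).
    { intros G. apply N1. replace (1 - p)%C with (- (p - 1))%C by ring. rewrite G. ring. }
    assert ((q - 1)%C <> 0%C).
    { intros G. apply N2. replace (1 - q)%C with (- (q - 1))%C by ring. rewrite G. ring. }
    field. repeat split; auto; apply pow2_C_neq. }
  rewrite E, Cmod_div by (repeat apply Cmult_neq_0; auto; apply pow2_C_neq).
  rewrite !Cmod_mult, Cmod_pow, Cmod_R, (Rabs_pos_eq 2) by lra. fold m1 m2.
  set (X := Cmod (e (v1 / 2 ^ k) * e (v2 / 2 ^ k) - 1)) in *.
  replace (2 * X / (2 ^ k * (m1 * m2))) with ((2 * (X * 2 ^ k)) * / ((2 ^ k * m1) * (2 ^ k * m2)))
    by (field; lra).
  rewrite <- Rinv_mult.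
  replace (kap * kap * (c * c)) with ((kap * c) * (kap * c)) by ring.
  assert (0 <= X) by apply Cmod_ge_0.
  apply Rmult_le_compat; [nra| |lra|].
  - left. apply Rinv_0_lt_compat. assert (0 < 2 ^ k * m1) by nra. assert (0 < 2 ^ k * m2) by nra. nra.
  - apply Rsq_inv_le; nra.
Qed.

Lemma exists_pow2_ge x : exists K, forall k, (K <= k)%nat -> x <= 2 ^ k.
Proof.
  destruct (Pow_x_infinity 2) with (b := x) as [K HK]; [rewrite Rabs_pos_eq; lra|].
  exists K. intros k Hk. specialize (HK k Hk). rewrite Rabs_pos_eq in HK by (apply pow_le; lra). lra.
Qed.

Lemma Re_pm_bounds w j :
  (INR j + 1) / 2 <= INR j - Rabs (Re w) ->
  (INR j + 1) / 2 <= Rabs (Re (w + INR j)) /\ (INR j + 1) / 2 <= Rabs (Re (w - 1 - INR j)).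
Proof.
  intros H. rewrite re_plus, !Re_minus, !re_RtoC. revert H. unfold Rabs.
  repeat destruct (Rcase_abs _); intros; lra.
Qed.

Lemma Re_pm_upper w j k : (j < 2 ^ k)%nat -> 4 * Rabs (Re w) <= 2 ^ k ->
  Rabs (Re (w + INR j)) <= 5 / 8 * 2 ^ S k /\ Rabs (Re (w - 1 - INR j)) <= 5 / 8 * 2 ^ S k.
Proof.
  intros Hj H. rewrite re_plus, !Re_minus, !re_RtoC. simpl.
  assert (J : INR j + 1 <= 2 ^ k).
  { rewrite <- S_INR. replace (2 ^ k) with (INR (2 ^ k)); [apply le_INR; lia|].
    rewrite pow_INR. reflexivity. }
  pose proof (pos_INR j). revert H. unfold Rabs. repeat destruct (Rcase_abs _); intros; lra.
Qed.

(** Both expansions are a dominated passage to the limit in the symmetric form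
    of the iterated duplication formula. *)
Lemma partial_fractions (F : C -> C) (alpha : C) (f : C -> C) (w : C) (A : R) :
  e w <> 1%C -> 0 <= A ->
  (forall w, e w <> 1%C -> F w = (alpha * (F (w / 2) + F ((w + 1) / 2)))%C) ->
  (forall w, F (w + 1)%C = F w) ->
  (forall u : C, u <> 0%C -> clim (fun k => alpha ^ S k * F (u / 2 ^ S k))%C (f u)) ->
  (forall k j, 4 * Rabs (Re w) <= 2 ^ k -> (j < 2 ^ k)%nat ->
     (INR j + 1) / 2 <= INR j - Rabs (Re w) ->
     Cmod (alpha ^ S k * (F ((w + INR j) / 2 ^ S k) + F ((w - 1 - INR j) / 2 ^ S k)))%C <=
       A * / (INR j + 1) ^ 2) ->
  clim (csum (fun j => f (w + INR j)%C + f (w - 1 - INR j)%C)%C) (F w).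
Proof.
  intros Hw HA HF HP Hf HB.
  destruct (exists_pow2_ge (4 * Rabs (Re w))) as [K HK].
  destruct (INR_unbounded (2 * Rabs (Re w) + 2)) as [I HI].
  set (G := fun k j => if (j <? 2 ^ k)%nat then
     (alpha ^ S k * (F ((w + INR j) / 2 ^ S k) + F ((w - 1 - INR j) / 2 ^ S k)))%C else 0%C).
  apply (tannery_constant G _ (fun j => A * / (INR j + 1) ^ 2) (F w) K I).
  - apply summable_scal; [exact HA|apply summable_inv_sq].
  - intros k i Hk Hi. unfold G. destruct (Nat.ltb_spec i (2 ^ k)) as [L|L].
    + apply HB; auto. apply le_INR in Hi. lra.
    + rewrite Cmod_0. apply Rmult_le_pos; [exact HA|]. left. apply Rinv_0_lt_compat, pow_lt.
      pose proof (pos_INR i); lra.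
  - intros i.
    assert (Nz : forall n : Z, (w + IZR n)%C <> 0%C).
    { intros n E. apply Hw. rewrite <- (e_plus_Z w n), E. apply e_0. }
    assert (U1 : (w + INR i)%C <> 0%C) by (rewrite INR_IZR_INZ; apply Nz).
    assert (U2 : (w - 1 - INR i)%C <> 0%C).
    { replace (w - 1 - INR i)%C with (w + IZR (- 1 - Z.of_nat i))%C; [apply Nz|].
      rewrite minus_IZR, <- INR_IZR_INZ, RtoC_minus. ring. }
    destruct (exists_pow2_ge (INR i + 1)) as [K' HK'].
    apply (clim_ext_from (fun k => alpha ^ S k * F ((w + INR i) / 2 ^ S k) +
       alpha ^ S k * F ((w - 1 - INR i) / 2 ^ S k))%C _ _ K').
    + intros k Hk. unfold G. destruct (Nat.ltb_spec i (2 ^ k)) as [L|L]; [ring|].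
      exfalso. specialize (HK' k Hk). apply le_INR in L. rewrite pow_INR in L. simpl (INR 2) in L.
      replace (1 + 1) with 2 in L by ring. lra.
    + apply clim_plus; auto.
  - intros k Hk. apply (clim_ext_from (fun _ => F w) _ _ (2 ^ k)); [|apply clim_const].
    intros n Hn. rewrite (duplication_symmetric F alpha HF HP k w Hw).
    replace n with (2 ^ k + (n - 2 ^ k))%nat by lia. rewrite csum_add.
    rewrite (csum_ext (fun i => G k (2 ^ k + i)%nat) (fun _ => 0%C)).
    + rewrite csum_0, Cplus_0_r. apply csum_ext_lt. intros i Hi. unfold G.
      now apply Nat.ltb_lt in Hi as ->.
    + intros i. unfold G. now destruct (Nat.ltb_spec (2 ^ k + i) (2 ^ k)); [lia|].
Qed.

Lemma qcsc2_shift w : qcsc2 (w + 1) = qcsc2 w.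
Proof. unfold qcsc2. now rewrite e_plus, e_1, Cmult_1_r. Qed.

Lemma qcot_shift w : qcot (w + 1) = qcot w.
Proof. unfold qcot. now rewrite e_plus, e_1, Cmult_1_r. Qed.

Lemma inv_half_sq j : / ((INR j + 1) / 2 * ((INR j + 1) / 2)) = 4 * / (INR j + 1) ^ 2.
Proof. pose proof (pos_INR j). field. lra. Qed.

Lemma half_succ_pos j : 0 < (INR j + 1) / 2.
Proof. pose proof (pos_INR j). lra. Qed.

Lemma qcsc2_partial_fractions_half w : e w <> 1%C ->
  clim (csum (fun j => - / (4 * PI * PI * ((w + INR j) * (w + INR j))) +
     - / (4 * PI * PI * ((w - 1 - INR j) * (w - 1 - INR j))))%C) (qcsc2 w).
Proof.
  intros Hw. set (Y := Rabs (Im w)).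
  set (A := exp (2 * PI * Y) * / (exp (- (PI * Y)) / 4 * (exp (- (PI * Y)) / 4))).
  assert (HA : 0 <= A).
  { unfold A. pose proof (exp_pos (2 * PI * Y)). pose proof (exp_pos (- (PI * Y))).
    apply Rmult_le_pos; [lra|]. left. apply Rinv_0_lt_compat. nra. }
  apply (partial_fractions qcsc2 (/ 4)%C (fun u => - / (4 * PI * PI * (u * u)))%C w (8 * A)); auto.
  - lra.
  - apply qcsc2_double.
  - apply qcsc2_shift.
  - apply clim_qcsc2_scaled.
  - intros k j Hk Hj HI. pose proof (pos_INR j) as PJ.
    destruct (Re_pm_bounds w j HI) as [B1 B2]. destruct (Re_pm_upper w j k Hj Hk) as [U1 U2].
    rewrite Cmult_plus_distr_l. eapply Rle_trans; [apply Cmod_triangle|].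
    assert (I1 : Rabs (Im (w + INR j)) <= Y) by (rewrite im_plus, im_RtoC, Rplus_0_r; apply Rle_refl).
    assert (I2 : Rabs (Im (w - 1 - INR j)) <= Y) by (rewrite !Im_minus, !im_RtoC, !Rminus_0_r; apply Rle_refl).
    pose proof (qcsc2_scaled_le _ Y (S k) ((INR j + 1) / 2) U1 I1 (conj (half_succ_pos j) B1)) as Q1.
    pose proof (qcsc2_scaled_le _ Y (S k) ((INR j + 1) / 2) U2 I2 (conj (half_succ_pos j) B2)) as Q2.
    rewrite inv_half_sq, <- Rmult_assoc in Q1, Q2. fold A in Q1, Q2. lra.
Qed.

Lemma qcot_partial_fractions_half w : e w <> 1%C ->
  clim (csum (fun j => / (PI * Ci * (w + INR j)) + / (PI * Ci * (w - 1 - INR j)))%C) (qcot w).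
Proof.
  intros Hw. set (Y := Rabs (Im w)).
  set (A := (2 * (2 * PI * exp (2 * PI * (2 * Y)) * Cmod (2 * w - 1))) *
      / (exp (- (PI * Y)) / 4 * (exp (- (PI * Y)) / 4))).
  assert (HA : 0 <= A).
  { unfold A. pose proof (exp_pos (2 * PI * (2 * Y))). pose proof (exp_pos (- (PI * Y))).
    pose proof PI_RGT_0. pose proof (Cmod_ge_0 (2 * w - 1)).
    apply Rmult_le_pos; [|left; apply Rinv_0_lt_compat; nra].
    apply Rmult_le_pos; [lra|]. apply Rmult_le_pos; [|lra]. apply Rmult_le_pos; lra. }
  apply (partial_fractions qcot (/ 2)%C (fun u => / (PI * Ci * u))%C w (4 * A)); auto.
  - lra.
  - apply qcot_double.
  - apply qcot_shift.
  - apply clim_qcot_scaled.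
  - intros k j Hk Hj HI. pose proof (pos_INR j) as PJ.
    destruct (Re_pm_bounds w j HI) as [B1 B2]. destruct (Re_pm_upper w j k Hj Hk) as [U1 U2].
    pose proof (qcot_pair_scaled_le w j Y (S k) ((INR j + 1) / 2) U1 U2 (Rle_refl _) (half_succ_pos j) B1 B2) as Q.
    rewrite inv_half_sq, <- Rmult_assoc in Q. fold A in Q. lra.
Qed.

(** From the range - N .. N - 1 to the range - N .. N, centred at 0. *)
Lemma csum_recentre (g : R -> C) N :
  csum (fun j => g (INR j) + g (- 1 - INR j)%R)%C N =
  (g 0%R + csum (fun j => g (INR j + 1)%R + g (- (INR j + 1))%R) N - g (INR N))%C.
Proof.
  induction N as [|N IH].
  - simpl. ring.
  - cbn [csum]. rewrite IH, S_INR. replace (-1 - INR N) with (- (INR N + 1)) by ring. ring.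
Qed.

Lemma clim_inv_plus_INR (w : C) : clim (fun N => / (w + INR N))%C 0.
Proof.
  intros eps He. destruct (INR_unbounded (Cmod w + / eps + 1)) as [N HN].
  exists N. intros n Hn. apply le_INR in Hn.
  assert (P : 0 < / eps) by now apply Rinv_0_lt_compat.
  assert (B : INR n - Cmod w <= Cmod (w + INR n)).
  { pose proof (Cmod_triangle (w + INR n) (- w)) as T.
    replace (w + INR n + - w)%C with (RtoC (INR n)) in T by ring.
    rewrite Cmod_opp, Cmod_R, Rabs_pos_eq in T by apply pos_INR. lra. }
  assert (Nz : (w + INR n)%C <> 0%C) by (apply (proj2 (Cmod_gt_0 _)); pose proof (Cmod_ge_0 w); lra).
  replace (/ (w + INR n) - 0)%C with (/ (w + INR n))%C by ring.
  rewrite Cmod_inv by auto. rewrite <- (Rinv_inv eps). apply Rinv_lt_contravar; [|lra].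
  apply Rmult_lt_0_compat; [auto|]. pose proof (Cmod_ge_0 w); lra.
Qed.

Lemma csc2_partial_fractions w : e w <> 1%C ->
  clim (fun N => / (w * w) + csum (fun j => / ((w + (INR j + 1)%R) * (w + (INR j + 1)%R)) +
      / ((w - (INR j + 1)%R) * (w - (INR j + 1)%R))) N)%C (- (4 * PI * PI) * qcsc2 w).
Proof.
  intros Hw. pose proof PI_neq_0C as P.
  assert (Nz : forall n : Z, (w + IZR n)%C <> 0%C).
  { intros n E. apply Hw. rewrite <- (e_plus_Z w n), E. apply e_0. }
  pose proof (clim_scal _ _ (- (4 * PI * PI))%C (qcsc2_partial_fractions_half w Hw)) as L.
  pose proof (clim_inv_plus_INR w) as I. pose proof (clim_mult _ _ _ _ I I) as I2.
  pose proof (clim_plus _ _ _ _ L I2) as M.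
  replace (- (4 * PI * PI) * qcsc2 w + 0 * 0)%C with (- (4 * PI * PI) * qcsc2 w)%C in M by ring.
  revert M. apply clim_ext. intros N. rewrite <- csum_scal.
  rewrite (csum_ext _ (fun j => (fun x : R => / ((w + x) * (w + x))) (INR j) +
      (fun x : R => / ((w + x) * (w + x))) (- 1 - INR j)%R)%C).
  - pose proof (csum_recentre (fun x : R => / ((w + x) * (w + x)))%C N) as R.
    cbv beta in R |- *. rewrite R, Cplus_0_r.
    rewrite (csum_ext _ (fun j => / ((w + (INR j + 1)%R) * (w + (INR j + 1)%R)) +
      / ((w - (INR j + 1)%R) * (w - (INR j + 1)%R)))%C).
    + assert ((w + INR N)%C <> 0%C) by (rewrite INR_IZR_INZ; apply Nz).
      assert (w <> 0%C) by (replace w with (w + 0)%C by ring; apply (Nz 0%Z)).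
      set (S := csum _ N). field. auto.
    + intros j. rewrite RtoC_opp. reflexivity.
  - intros j.
    assert (U1 : (w + INR j)%C <> 0%C) by (rewrite INR_IZR_INZ; apply Nz).
    assert (U2 : (w - 1 - INR j)%C <> 0%C).
    { replace (w - 1 - INR j)%C with (w + IZR (- 1 - Z.of_nat j))%C; [apply Nz|].
      rewrite minus_IZR, <- INR_IZR_INZ, RtoC_minus. ring. }
    rewrite RtoC_minus.
    replace (w + (-1 - INR j))%C with (w - 1 - INR j)%C by ring. field. auto.
Qed.

Lemma cot_partial_fractions w : e w <> 1%C ->
  clim (fun N => / w + csum (fun j => / (w + (INR j + 1)%R) + / (w - (INR j + 1)%R)) N)%C
    (PI * Ci * qcot w).
Proof.
  intros Hw. pose proof PI_neq_0C as P. pose proof Ci_nz as PC.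
  assert (Nz : forall n : Z, (w + IZR n)%C <> 0%C).
  { intros n E. apply Hw. rewrite <- (e_plus_Z w n), E. apply e_0. }
  pose proof (clim_scal _ _ (PI * Ci)%C (qcot_partial_fractions_half w Hw)) as L.
  pose proof (clim_inv_plus_INR w) as I.
  pose proof (clim_plus _ _ _ _ L I) as M.
  replace (PI * Ci * qcot w + 0)%C with (PI * Ci * qcot w)%C in M by ring.
  revert M. apply clim_ext. intros N. rewrite <- csum_scal.
  rewrite (csum_ext _ (fun j => (fun x : R => / (w + x)) (INR j) +
      (fun x : R => / (w + x)) (- 1 - INR j)%R)%C).
  - pose proof (csum_recentre (fun x : R => / (w + x))%C N) as R.
    cbv beta in R |- *. rewrite R, Cplus_0_r.
    rewrite (csum_ext _ (fun j => / (w + (INR j + 1)%R) + / (w - (INR j + 1)%R))%C).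
    + ring.
    + intros j. rewrite RtoC_opp. reflexivity.
  - intros j.
    assert (U1 : (w + INR j)%C <> 0%C) by (rewrite INR_IZR_INZ; apply Nz).
    assert (U2 : (w - 1 - INR j)%C <> 0%C).
    { replace (w - 1 - INR j)%C with (w + IZR (- 1 - Z.of_nat j))%C; [apply Nz|].
      rewrite minus_IZR, <- INR_IZR_INZ, RtoC_minus. ring. }
    rewrite RtoC_minus.
    replace (w + (-1 - INR j))%C with (w - 1 - INR j)%C by ring. field. auto.
Qed.

(** The expansion of pi^2 / sin^2(pi w) at w = 1/2 gives the sum pi^2 / 8 over the
    odd numbers; the even numbers contribute a quarter of the whole sum. *)
Lemma zeta2 : clim (csum (fun j => / ((INR j + 1)%R * (INR j + 1)%R))%C) (PI * PI / 6).
Proof.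
  destruct (csum_converges (fun j => / ((INR j + 1)%R * (INR j + 1)%R))%C (fun j => / (INR j + 1) ^ 2))
    as [z Hz]; [apply summable_inv_sq| |].
  { intros j. pose proof (pos_INR j). rewrite <- RtoC_mult, <- RtoC_inv by nra.
    rewrite Cmod_R, Rabs_pos_eq; [right; f_equal; ring|]. left. apply Rinv_0_lt_compat. nra. }
  assert (Hh : e (1 / 2) <> 1%C).
  { rewrite e_half. intros G. apply RtoC_inj in G. lra. }
  pose proof PI_neq_0C as P. pose proof two_neq_0C as T2.
  assert (NZ : forall j, RtoC (INR j + 1) <> 0%C /\ RtoC (2 * INR j + 1) <> 0%C).
  { intros j. pose proof (pos_INR j). split; intros G; apply RtoC_inj in G; lra. }
  assert (O : clim (csum (fun j => / ((2 * INR j + 1)%R * (2 * INR j + 1)%R))%C) (PI * PI / 8)).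
  { pose proof (clim_scal _ _ (- (PI * PI) / 2)%C (qcsc2_partial_fractions_half (1 / 2) Hh)) as L.
    replace (- (PI * PI) / 2 * qcsc2 (1 / 2))%C with (PI * PI / 8)%C in L.
    - revert L. apply clim_ext. intros n. rewrite <- csum_scal. apply csum_ext. intros j.
      destruct (NZ j) as [_ N].
      assert (E1 : (1 / 2 + INR j = RtoC (2 * INR j + 1) / 2)%C).
      { rewrite RtoC_plus, RtoC_mult. field. }
      assert (E2 : (1 / 2 - 1 - INR j = - RtoC (2 * INR j + 1) / 2)%C).
      { rewrite RtoC_plus, RtoC_mult. field. }
      rewrite E1, E2. field. auto.
    - unfold qcsc2. rewrite e_half.
      replace ((1 - -1) * (1 - -1))%C with (2 * 2)%C by (rewrite <- RtoC_minus; replace (1 - -1) with 2 by ring; ring).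
      field. }
  assert (D : forall n, csum (fun j => / ((INR j + 1)%R * (INR j + 1)%R))%C (2 * n) =
     (csum (fun j => / ((2 * INR j + 1)%R * (2 * INR j + 1)%R)) n +
      / 4 * csum (fun j => / ((INR j + 1)%R * (INR j + 1)%R)) n)%C).
  { induction n as [|n IH]; [simpl; ring|].
    replace (2 * S n)%nat with (S (S (2 * n))) by lia. cbn [csum]. rewrite IH.
    destruct (NZ n) as [N1 N2].
    assert (A1 : INR (2 * n) + 1 = 2 * INR n + 1) by (rewrite mult_INR; simpl; ring).
    assert (A2 : INR (S (2 * n)) + 1 = 2 * (INR n + 1)) by (rewrite S_INR, mult_INR; simpl; ring).
    rewrite A1, A2, RtoC_mult. field. auto. }
  assert (E : z = (PI * PI / 8 + / 4 * z)%C).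
  { apply (clim_unique (fun n => csum (fun j => / ((INR j + 1)%R * (INR j + 1)%R))%C (2 * n))).
    - apply (clim_comp _ _ (fun n => 2 * n)%nat); [intros; lia|exact Hz].
    - eapply clim_ext; [intros n; symmetry; apply D|].
      apply clim_plus; [exact O|]. now apply clim_scal. }
  replace (PI * PI / 6)%C with z; [exact Hz|].
  replace z with (4 / 3 * (z - / 4 * z))%C by field. rewrite E at 1. field.
Qed.

(** * The Eisenstein series of weight two under z -> -1/z *)

Lemma Im_neq_0 z : Im z <> 0 -> z <> 0%C.
Proof. intros H ->. apply H. reflexivity. Qed.

Lemma e_neq_1 w : Im w <> 0 -> e w <> 1%C.
Proof.
  intros H E. apply (f_equal Cmod) in E. rewrite Cmod_e, Cmod_1 in E.
  rewrite <- exp_0 in E. apply exp_inv in E. pose proof PI_RGT_0.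
  apply H. apply Rmult_eq_reg_l with (2 * PI); lra.
Qed.

Lemma UHP_neq_0 z : UHP z -> z <> 0%C.
Proof. intros H. apply Im_neq_0. unfold UHP in H. lra. Qed.

Lemma Im_inv (z : C) : z <> 0%C -> Im (/ z) = - Im z / Cmod z ^ 2.
Proof. intros _. rewrite Cmod2_alt. destruct z as [x y]. simpl. reflexivity. Qed.

Lemma Im_inv_lt z : UHP z -> Im (/ z) < 0.
Proof.
  intros H. rewrite Im_inv by now apply UHP_neq_0.
  pose proof (proj1 (Cmod_gt_0 z) (UHP_neq_0 z H)). unfold UHP in H.
  assert (0 < Cmod z ^ 2) by now apply pow_lt.
  assert (0 < Im z / Cmod z ^ 2) by now apply Rdiv_lt_0_compat.
  unfold Rdiv in *. lra.
Qed.

Lemma UHP_S z : UHP z -> UHP (- / z).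
Proof. intros H. unfold UHP. rewrite im_opp. pose proof (Im_inv_lt z H). lra. Qed.

(** For |n| at most 2 M |z| the imaginary part M Im z is comparable with |n|;
    for larger |n| the term n dominates M z. *)
Lemma lattice_lower z : UHP z -> exists kap, 0 < kap /\
  forall M n : R, 1 <= M -> kap * (Rabs n + 1) <= Cmod (M * z + n).
Proof.
  intros H. unfold UHP in H. set (y := Im z) in *.
  assert (Zy : y <= Cmod z).
  { pose proof (abs_Im_le_Cmod z). fold y in H0. rewrite Rabs_pos_eq in H0; lra. }
  set (r := Cmod z) in *.
  exists (Rmin (y / (2 * r)) y / 2).
  assert (0 < y / (2 * r)) by (apply Rdiv_lt_0_compat; lra).
  split; [assert (0 < Rmin (y / (2 * r)) y) by (now apply Rmin_glb_lt); lra|].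
  intros M n HM.
  assert (A : y <= Cmod (M * z + n)).
  { pose proof (abs_Im_le_Cmod (M * z + n)) as B.
    rewrite im_plus, im_RtoC, im_scal_l, Rplus_0_r in B. fold y in B.
    rewrite Rabs_pos_eq in B by nra. nra. }
  assert (B : y / (2 * r) * Rabs n <= Cmod (M * z + n)).
  { destruct (Rle_dec (2 * (M * r)) (Rabs n)) as [L|L].
    - assert (Rabs n - M * r <= Cmod (M * z + n)).
      { pose proof (Cmod_triangle (M * z + n) (- (M * z))) as T.
        replace (M * z + n + - (M * z))%C with (RtoC n) in T by ring.
        rewrite Cmod_opp, Cmod_mult, !Cmod_R, (Rabs_pos_eq M) in T by lra. fold r in T. lra. }
      assert (y / (2 * r) <= 1 / 2).
      { apply Rmult_le_reg_r with (2 * r); [lra|]. unfold Rdiv at 1. rewrite Rmult_assoc, Rinv_l by lra. lra. }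
      pose proof (Rabs_pos n). nra.
    - pose proof (abs_Im_le_Cmod (M * z + n)) as B.
      rewrite im_plus, im_RtoC, im_scal_l, Rplus_0_r in B. fold y in B.
      rewrite Rabs_pos_eq in B by nra. eapply Rle_trans; [|exact B].
      apply Rle_trans with (y / (2 * r) * (2 * (M * r))).
      + apply Rmult_le_compat_l; lra.
      + right. field. lra. }
  assert (P := Rabs_pos n).
  pose proof (Rmin_l (y / (2 * r)) y). pose proof (Rmin_r (y / (2 * r)) y).
  set (k := Rmin (y / (2 * r)) y) in *.
  assert (k * Rabs n <= y / (2 * r) * Rabs n) by (apply Rmult_le_compat_r; lra). lra.
Qed.

(** [1 / w^2] minus a telescoping term: what remains is of order [w^-4], hence
    absolutely summable over the lattice. *)
Definition csc_rest (w : C) : C := (/ (w * w) - (/ (w - / 2) - / (w + / 2)))%C.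

Definition lattice_rest (z : C) (m n : nat) : C :=
  let w := ((INR m + 1)%R * z)%C in
  match n with
  | O => csc_rest w
  | S j => (csc_rest (w + (INR j + 1)%R) + csc_rest (w - (INR j + 1)%R))%C
  end.

Lemma half_RtoC : (/ 2)%C = RtoC (/ 2).
Proof. now rewrite RtoC_inv by lra. Qed.

Lemma csc_rest_le z : UHP z -> exists D, 0 <= D /\ forall m (n : R),
  Cmod (csc_rest ((INR m + 1)%R * z + n)) <= D * / (INR m + 1) ^ 2 * / (Rabs n + 1) ^ 2.
Proof.
  intros H. destruct (lattice_lower z H) as [kap [K HK]].
  unfold UHP in H. set (y := Im z) in *.
  exists (/ 4 * / (kap ^ 2 * y ^ 2)). split.
  { assert (0 < kap ^ 2 * y ^ 2) by (apply Rmult_lt_0_compat; now apply pow_lt).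
    apply Rmult_le_pos; [lra|]. left. now apply Rinv_0_lt_compat. }
  intros m n. pose proof (pos_INR m) as PM. set (M := INR m + 1).
  set (w := (M * z + n)%C).
  assert (L : kap * (Rabs n + 1) <= Cmod w) by (apply HK; unfold M; lra).
  assert (I : forall x : R, Im (w + x) = M * y).
  { intros x. unfold w. rewrite !im_plus, !im_RtoC, im_scal_l. fold y. ring. }
  assert (L2 : forall x : R, M * y <= Cmod (w + x)).
  { intros x. rewrite <- (I x). eapply Rle_trans; [apply Rle_abs|apply abs_Im_le_Cmod]. }
  pose proof (L2 (/ 2)) as L3. pose proof (L2 (- / 2)) as L4.
  assert (MY : 0 < M * y) by (unfold M; nra).
  rewrite RtoC_opp, <- half_RtoC in L4. rewrite <- half_RtoC in L3.
  change (w + - / 2)%C with (w - / 2)%C in L4.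
  assert (Pn := Rabs_pos n).
  assert (L0 : 0 < kap * (Rabs n + 1)) by nra.
  assert (W0 : w <> 0%C) by (apply (proj2 (Cmod_gt_0 _)); lra).
  assert (W1 : (w - / 2)%C <> 0%C) by (apply (proj2 (Cmod_gt_0 _)); lra).
  assert (W2 : (w + / 2)%C <> 0%C) by (apply (proj2 (Cmod_gt_0 _)); lra).
  assert (E : csc_rest w = (- / 4 * / ((w * w) * ((w - / 2) * (w + / 2))))%C).
  { unfold csc_rest.
    assert (A1 : (2 * w - 1)%C <> 0%C).
    { replace (2 * w - 1)%C with (2 * (w - / 2))%C by field. apply Cmult_neq_0; auto using two_neq_0C. }
    assert (A2 : (2 * w + 1)%C <> 0%C).
    { replace (2 * w + 1)%C with (2 * (w + / 2))%C by field. apply Cmult_neq_0; auto using two_neq_0C. }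
    field. repeat split; auto. all: rewrite Cmult_comm; auto. }
  rewrite E, Cmod_mult, Cmod_inv by (repeat apply Cmult_neq_0; auto).
  rewrite !Cmod_mult, Cmod_opp. replace (Cmod (/ 4)) with (/ 4) by
    (rewrite <- RtoC_inv by lra; rewrite Cmod_R, Rabs_pos_eq; lra).
  rewrite !Rmult_assoc. apply Rmult_le_compat_l; [lra|].
  rewrite <- !Rinv_mult. apply Rinv_le_contravar.
  - assert (0 < M) by (unfold M; lra).
    apply Rmult_lt_0_compat; apply Rmult_lt_0_compat; apply pow_lt; lra.
  - replace (kap ^ 2 * y ^ 2 * (M ^ 2 * (Rabs n + 1) ^ 2)) with
      ((kap * (Rabs n + 1)) * ((kap * (Rabs n + 1)) * ((M * y) * (M * y)))) by ring.
    assert (0 <= (M * y) * (M * y)) by nra.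
    assert ((M * y) * (M * y) <= Cmod (w - / 2) * Cmod (w + / 2)) by (apply Rmult_le_compat; lra).
    apply Rmult_le_compat; [lra|nra|assumption|].
    apply Rmult_le_compat; [lra|assumption|assumption|assumption].
Qed.

(** The telescoping terms of a row leave only their two ends. *)
Lemma csum_lattice_rest z m N :
  let w := ((INR m + 1)%R * z)%C in
  csum (lattice_rest z m) (S N) =
   (/ (w * w) + csum (fun j => / ((w + (INR j + 1)%R) * (w + (INR j + 1)%R)) +
      / ((w - (INR j + 1)%R) * (w - (INR j + 1)%R))) N
    - (/ (w - (INR N + / 2)%R) - / (w + (INR N + / 2)%R)))%C.
Proof.
  intros w. induction N as [|N IH].
  - simpl. unfold csc_rest. rewrite Rplus_0_l, <- half_RtoC. fold w. ring.
  - change (csum (lattice_rest z m) (S (S N))) with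
      (csum (lattice_rest z m) (S N) + lattice_rest z m (S N))%C.
    rewrite IH. cbn [csum]. unfold lattice_rest, csc_rest. fold w.
    replace (w + (INR N + 1)%R - / 2)%C with (w + (INR N + / 2)%R)%C
      by (rewrite !RtoC_plus, <- half_RtoC; field).
    replace (w - (INR N + 1)%R + / 2)%C with (w - (INR N + / 2)%R)%C
      by (rewrite !RtoC_plus, <- half_RtoC; field).
    replace (w + (INR N + 1)%R + / 2)%C with (w + (INR (S N) + / 2)%R)%C
      by (rewrite S_INR, !RtoC_plus, <- half_RtoC; ring).
    replace (w - (INR N + 1)%R - / 2)%C with (w - (INR (S N) + / 2)%R)%C
      by (rewrite S_INR, !RtoC_plus, <- half_RtoC; ring).
    ring.
Qed.

Lemma Rabs_succ_pm j : Rabs (INR j + 1) = INR j + 1 /\ Rabs (- (INR j + 1)) = INR j + 1.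
Proof. rewrite Rabs_Ropp, Rabs_pos_eq by (pose proof (pos_INR j); lra). auto. Qed.

Lemma lattice_rest_le z : UHP z -> exists b, summable b /\
  forall N m, Cmod (csum (lattice_rest z m) N) <= b m.
Proof.
  intros H. destruct (csc_rest_le z H) as [D [D0 HD]].
  destruct summable_inv_sq as [_ [B HB]].
  assert (B0 : 0 <= B) by exact (HB O).
  exists (fun m => (2 * D * B) * / (INR m + 1) ^ 2). split.
  { apply summable_scal; [|apply summable_inv_sq]. apply Rmult_le_pos; lra. }
  intros N m. set (a := / (INR m + 1) ^ 2).
  assert (a0 : 0 < a) by (unfold a; apply Rinv_0_lt_compat, pow_lt; pose proof (pos_INR m); lra).
  eapply Rle_trans.
  { apply Cmod_csum_le with (b := fun n => (2 * D * a) * / (INR n + 1) ^ 2).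
    intros [|j].
    - simpl lattice_rest. specialize (HD m 0). rewrite Rabs_R0, Cplus_0_r in HD. fold a in HD.
      simpl INR. eapply Rle_trans; [exact HD|].
      replace (/ (0 + 1) ^ 2) with 1 by field. nra.
    - simpl lattice_rest. eapply Rle_trans; [apply Cmod_triangle|].
      pose proof (HD m (INR j + 1)) as H1. pose proof (HD m (- (INR j + 1))) as H2.
      destruct (Rabs_succ_pm j) as [R1 R2]. rewrite R1 in H1. rewrite R2, RtoC_opp in H2.
      fold a in H1, H2. rewrite S_INR.
      change ((INR m + 1)%R * z + - (INR j + 1)%R)%C with ((INR m + 1)%R * z - (INR j + 1)%R)%C in H2.
      lra. }
  rewrite rsum_scal. specialize (HB N). fold a.
  replace (2 * D * B * a) with (2 * D * a * B) by ring.
  apply Rmult_le_compat_l; [nra|exact HB].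
Qed.

Lemma affine_pm_neq_0 z (M x : R) : UHP z -> 0 < M ->
  (M * z + x <> 0 /\ M * z - x <> 0 /\ x - M * z <> 0 /\ x + M * z <> 0)%C.
Proof.
  intros Hz HM. unfold UHP in Hz. repeat split; apply Im_neq_0;
    rewrite ?Im_minus, ?im_plus, im_scal_l, im_RtoC; nra.
Qed.

Lemma clim_inv_half w : clim (fun N => / (w - (INR N + / 2)%R) - / (w + (INR N + / 2)%R))%C 0.
Proof.
  pose proof (clim_inv_plus_INR (- w + / 2)) as L1.
  pose proof (clim_inv_plus_INR (w + / 2)) as L2.
  pose proof (clim_minus _ _ _ _ (clim_opp _ _ L1) L2) as L.
  replace (- 0 - 0)%C with (RtoC 0) in L by ring.
  revert L. apply clim_ext. intros N. rewrite RtoC_plus, <- half_RtoC.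
  replace (w + / 2 + INR N)%C with (w + (INR N + / 2))%C by ring.
  replace (w - (INR N + / 2))%C with (- (- w + / 2 + INR N))%C by ring.
  set (v := (- w + / 2 + INR N)%C).
  replace (/ - v)%C with (- / v)%C; [reflexivity|].
  destruct (Ceq_dec v 0) as [E|E].
  - rewrite E. replace (- 0)%C with (RtoC 0) by ring. apply C_ext; simpl; unfold Rdiv; ring.
  - field. auto.
Qed.

Lemma qcsc2_opp w : e w <> 1%C -> qcsc2 (- w) = qcsc2 w.
Proof.
  intros H. unfold qcsc2. rewrite e_opp. pose proof (e_neq_0 w).
  field. repeat split; auto; apply Cminus_eq_contra; auto.
Qed.

Lemma clim_qcot_up z : UHP z -> clim (fun N => qcot ((INR N + / 2)%R / z))%C 1.
Proof.
  intros H. pose proof (Im_inv_lt z H) as B. set (b := - Im (/ z)). assert (b0 : 0 < b) by (unfold b; lra).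
  pose proof PI_RGT_0 as P.
  assert (L : clim (fun N => qcot ((INR N + / 2)%R / z) - 1)%C 0).
  { apply (clim_0_le _ (fun N => (1 / (PI * b)) * / (INR N + / 2))).
    - intros N. pose proof (pos_INR N) as PN. set (K := INR N + / 2).
      assert (K0 : 0 < K) by (unfold K; lra).
      assert (I : Im (K / z) = - (K * b)) by (unfold Cdiv, b; rewrite im_scal_l; ring).
      assert (E : 1 + 2 * PI * (K * b) <= Cmod (e (K / z))).
      { rewrite Cmod_e, I. replace (- (2 * PI * - (K * b))) with (2 * PI * (K * b)) by ring.
        apply exp_ineq1_le. }
      assert (E1 : 2 * PI * (K * b) <= Cmod (e (K / z) - 1)).
      { pose proof (Cmod_triangle (e (K / z) - 1) 1) as T.
        replace (e (K / z) - 1 + 1)%C with (e (K / z)) in T by ring. rewrite Cmod_1 in T. lra. }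
      assert (Q0 : 0 < PI * b) by nra.
      assert (Q : 0 < 2 * PI * (K * b)) by nra.
      assert (Nz : (e (K / z) - 1)%C <> 0%C) by (apply (proj2 (Cmod_gt_0 _)); lra).
      replace (qcot (K / z) - 1)%C with (2 / (e (K / z) - 1))%C by (unfold qcot; field; auto).
      rewrite Cmod_div, Cmod_R, Rabs_pos_eq by (auto; lra).
      replace (1 / (PI * b) * / K) with (2 / (2 * PI * (K * b))) by (field; lra).
      unfold Rdiv. apply Rmult_le_compat_l; [lra|]. apply Rinv_le_contravar; lra.
    - replace 0 with (1 / (PI * b) * 0) by ring. apply (is_lim_seq_scal_l _ (1 / (PI * b)) 0).
      replace (Finite 0) with (Rbar_inv p_infty) by reflexivity.
      apply is_lim_seq_inv; [|discriminate].
      eapply is_lim_seq_plus; [apply is_lim_seq_INR|apply is_lim_seq_const|]. reflexivity. }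
  pose proof (clim_plus _ _ _ _ L (clim_const 1)) as M.
  replace (0 + 1)%C with (RtoC 1) in M by ring. revert M. apply clim_ext. intros; ring.
Qed.

(** Summing the rest by columns instead of rows.  The rows produce the series
    at [z]; the columns the series at [-1/z], up to the cotangent that the
    telescoping terms leave behind, and the cotangent tends to a constant. *)
Lemma eisenstein2_S z H1 H2 : UHP z ->
  clim (csum (fun m => qcsc2 ((INR m + 1)%R * z)))%C H1 ->
  clim (csum (fun m => qcsc2 ((INR m + 1)%R * (- / z))))%C H2 ->
  (- (4 * PI * PI) * H1 =
    PI * PI / 6 * (/ (z * z) - 1) - 4 * PI * PI * H2 / (z * z) + PI * Ci / z)%C.
Proof.
  intros Hz L1 L2. pose proof (UHP_neq_0 z Hz) as z0. pose proof (Im_inv_lt z Hz) as Iz.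
  assert (NZ : forall x : R, 0 < x -> RtoC x <> 0%C) by (intros x Hx G; apply RtoC_inj in G; lra).
  assert (Ndiv : forall x : R, 0 < x -> e (x / z) <> 1%C).
  { intros x Hx. apply e_neq_1. unfold Cdiv. rewrite im_scal_l. nra. }
  set (cN := fun (z : C) N m => csum (lattice_rest z m) (S N)).
  set (U := fun N => (PI * PI / 6 / (z * z) +
     csum (fun j => / (z * z) * (- (4 * PI * PI) * qcsc2 ((INR j + 1)%R / z)) - / ((INR j + 1)%R * (INR j + 1)%R)) N)%C).
  set (T := fun N => (/ (INR N + / 2)%R - / z * (PI * Ci * qcot ((INR N + / 2)%R / z)))%C).
  destruct (lattice_rest_le z Hz) as [b [Hb HB]].
  assert (A : clim (fun N => U N - T N)%C (- (4 * PI * PI) * H1)%C).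
  { apply (tannery (cN z) (fun m => - (4 * PI * PI) * qcsc2 ((INR m + 1)%R * z))%C b); auto.
    - intros k i. apply HB.
    - intros m. assert (Hw : e ((INR m + 1)%R * z) <> 1%C).
      { apply e_neq_1. rewrite im_scal_l. unfold UHP in Hz. pose proof (pos_INR m). nra. }
      pose proof (clim_minus _ _ _ _ (csc2_partial_fractions _ Hw) (clim_inv_half ((INR m + 1)%R * z))) as L.
      match type of L with clim _ ?l => replace l with (- (4 * PI * PI) * qcsc2 ((INR m + 1)%R * z))%C in L by ring end.
      revert L. apply clim_ext. intros N. unfold cN. symmetry. apply csum_lattice_rest.
    - intros N.
      assert (C0 : clim (csum (fun m => / (((INR m + 1)%R * z) * ((INR m + 1)%R * z))))%C (PI * PI / 6 / (z * z))).
      { pose proof (clim_scal _ _ (/ (z * z))%C zeta2) as L.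
        replace (PI * PI / 6 / (z * z))%C with (/ (z * z) * (PI * PI / 6))%C by (field; auto).
        revert L. apply clim_ext. intros n. rewrite <- csum_scal. apply csum_ext. intros j.
        assert (RtoC (INR j + 1) <> 0%C) by (apply NZ; pose proof (pos_INR j); lra).
        field. auto. }
      assert (Cj : forall j, clim (csum (fun m =>
          / (((INR m + 1)%R * z + (INR j + 1)%R) * ((INR m + 1)%R * z + (INR j + 1)%R)) +
          / (((INR m + 1)%R * z - (INR j + 1)%R) * ((INR m + 1)%R * z - (INR j + 1)%R))))%C
          (/ (z * z) * (- (4 * PI * PI) * qcsc2 ((INR j + 1)%R / z)) - / ((INR j + 1)%R * (INR j + 1)%R))%C).
      { intros j. assert (X0 : 0 < INR j + 1) by (pose proof (pos_INR j); lra).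
        pose proof (NZ _ X0) as X. set (x := INR j + 1) in *.
        pose proof (clim_minus _ _ _ _ (clim_scal _ _ (/ (z * z))%C (csc2_partial_fractions _ (Ndiv x X0)))
          (clim_const (/ (x * x))%C)) as L.
        revert L. apply clim_ext. intros n. rewrite Cmult_plus_distr_l, <- csum_scal.
        replace (/ (z * z) * / (x / z * (x / z)))%C with (/ (x * x))%C by (field; auto).
        match goal with |- (?a + ?s - ?a = _)%C => replace (a + s - a)%C with s by ring end.
        apply csum_ext. intros m. set (M := INR m + 1).
        assert (M0 : 0 < M) by (unfold M; pose proof (pos_INR m); lra).
        destruct (affine_pm_neq_0 z M x Hz M0) as [N1 [N2 [N3 N4]]].
        field. repeat split; auto. }
      assert (Ct : clim (csum (fun m => / ((INR m + 1)%R * z - (INR N + / 2)%R) - / ((INR m + 1)%R * z + (INR N + / 2)%R)))%C (T N)).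
      { assert (X0 : 0 < INR N + / 2) by (pose proof (pos_INR N); lra).
        pose proof (NZ _ X0) as X. unfold T. set (x := INR N + / 2) in *.
        pose proof (clim_minus _ _ _ _ (clim_const (/ x)%C) (clim_scal _ _ (/ z)%C (cot_partial_fractions _ (Ndiv x X0)))) as L.
        revert L. apply clim_ext. intros n. rewrite Cmult_plus_distr_l, <- csum_scal.
        replace (/ z * / (x / z))%C with (/ x)%C by (field; auto).
        match goal with |- (?a - (?a + ?s) = _)%C => replace (a - (a + s))%C with (-1 * s)%C by ring end.
        rewrite <- csum_scal.
        apply csum_ext. intros m. set (M := INR m + 1).
        assert (M0 : 0 < M) by (unfold M; pose proof (pos_INR m); lra).
        destruct (affine_pm_neq_0 z M x Hz M0) as [N1 [N2 [N3 N4]]].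
        field. repeat split; auto. }
      assert (Cs : clim (fun M => csum (fun j => csum (fun m =>
          / (((INR m + 1)%R * z + (INR j + 1)%R) * ((INR m + 1)%R * z + (INR j + 1)%R)) +
          / (((INR m + 1)%R * z - (INR j + 1)%R) * ((INR m + 1)%R * z - (INR j + 1)%R))) M) N)%C
          (csum (fun j => / (z * z) * (- (4 * PI * PI) * qcsc2 ((INR j + 1)%R / z)) - / ((INR j + 1)%R * (INR j + 1)%R))%C N)).
      { exact (clim_csum (fun M j => csum _ M) _ N Cj). }
      pose proof (clim_minus _ _ _ _ (clim_plus _ _ _ _ C0 Cs) Ct) as L.
      revert L. apply clim_ext. intros M. rewrite <- csum_swap, <- csum_plus, <- csum_minus.
      apply csum_ext. intros m. unfold cN. rewrite csum_lattice_rest. reflexivity.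
    - apply (clim_ext (fun n => - (4 * PI * PI) * csum (fun m => qcsc2 ((INR m + 1)%R * z)) n)%C).
      + intros n. now rewrite <- csum_scal.
      + now apply clim_scal. }
  assert (LU : clim U (PI * PI / 6 / (z * z) + (/ (z * z) * (- (4 * PI * PI) * H2) - PI * PI / 6))%C).
  { apply clim_plus; [apply clim_const|].
    pose proof (clim_minus _ _ _ _ (clim_scal _ _ (/ (z * z))%C (clim_scal _ _ (- (4 * PI * PI))%C L2)) zeta2) as L.
    revert L. apply clim_ext. intros n. rewrite <- !csum_scal, <- csum_minus. apply csum_ext.
    intros j. do 3 f_equal.
    assert (X0 : 0 < INR j + 1) by (pose proof (pos_INR j); lra).
    rewrite <- (qcsc2_opp ((INR j + 1)%R / z)%C) by now apply Ndiv. f_equal. field. auto. }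
  assert (LT : clim T (0 - / z * (PI * Ci * 1))%C).
  { apply clim_minus.
    - apply (clim_ext (fun N => / (/ 2 + INR N))%C); [|apply clim_inv_plus_INR].
      intros N. f_equal. rewrite RtoC_plus, <- half_RtoC. ring.
    - apply clim_scal, clim_scal, clim_qcot_up, Hz. }
  rewrite (clim_unique _ _ _ A (clim_minus _ _ _ _ LU LT)). field. auto.
Qed.

(** * The infinite product of the eta function *)

Lemma summable_arith_geom r : 0 <= r < 1 -> summable (fun n => (INR n + 1) * r ^ n).
Proof.
  intros Hr. split.
  - intros n. apply Rmult_le_pos; [pose proof (pos_INR n); lra|apply pow_le; lra].
  - destruct (summable_geom r Hr) as [_ [B HB]].
    exists (B / (1 - r)). intros n.
    assert (E : (1 - r) * rsum (fun i => (INR i + 1) * r ^ i) n = rsum (fun i => r ^ i) n - INR n * r ^ n).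
    { induction n as [|n IH]; [simpl; ring|]. cbn [rsum].
      rewrite Rmult_plus_distr_l, IH, S_INR. simpl. ring. }
    apply Rmult_le_reg_l with (1 - r); [lra|]. rewrite E.
    replace ((1 - r) * (B / (1 - r))) with B by (field; lra).
    assert (0 <= INR n * r ^ n) by (apply Rmult_le_pos; [apply pos_INR|apply pow_le; lra]).
    specialize (HB n). lra.
Qed.

Lemma Cmod_Cprod_le (u : nat -> C) (b : nat -> R) n :
  (forall k, Cmod (u (S k)) <= b k) -> Cmod (Cprod (fun k => 1 + u k)%C n) <= exp (rsum b n).
Proof.
  intros H. induction n as [|n IH]; simpl.
  - rewrite Cmod_1, exp_0. lra.
  - rewrite Cmod_mult, exp_plus. apply Rmult_le_compat; try apply Cmod_ge_0; auto.
    eapply Rle_trans; [apply Cmod_triangle|]. rewrite Cmod_1. specialize (H n).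
    eapply Rle_trans; [|apply exp_ineq1_le]. lra.
Qed.

Lemma Cprod_increment u n :
  (Cprod (fun k => 1 + u k) (S n) - Cprod (fun k => 1 + u k) n = Cprod (fun k => 1 + u k) n * u (S n))%C.
Proof. simpl. ring. Qed.

Lemma Cprod_converges (u : nat -> C) (b : nat -> R) :
  summable b -> (forall k, Cmod (u (S k)) <= b k) -> exists l, clim (Cprod (fun k => 1 + u k)%C) l.
Proof.
  intros Hb H. pose proof Hb as [B0 [B HB]].
  destruct (csum_converges (fun n => Cprod (fun k => 1 + u k) (S n) - Cprod (fun k => 1 + u k) n)%C
    (fun n => exp B * b n)) as [l Hl].
  - apply summable_scal; auto. left; apply exp_pos.
  - intros n. rewrite Cprod_increment, Cmod_mult.
    apply Rmult_le_compat; try apply Cmod_ge_0; auto.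
    eapply Rle_trans; [now apply Cmod_Cprod_le with (b := b)|].
    destruct (Rle_lt_or_eq_dec _ _ (HB n)) as [G|G]; [left; now apply exp_increasing|rewrite G; lra].
  - exists (l + 1)%C. pose proof (clim_plus _ _ _ _ Hl (clim_const 1)) as L.
    revert L. apply clim_ext. intros n.
    assert (E : csum (fun n => Cprod (fun k => 1 + u k) (S n) - Cprod (fun k => 1 + u k) n)%C n =
      (Cprod (fun k => 1 + u k) n - 1)%C).
    { induction n as [|n IH]; [simpl; ring|]. cbn [csum]. rewrite IH. simpl. ring. }
    rewrite E. ring.
Qed.

Lemma Cprod_ext u v n : (forall k, u (S k) = v (S k)) -> Cprod u n = Cprod v n.
Proof. intros H. induction n as [|n IH]; simpl; [reflexivity|]. now rewrite IH, H. Qed.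

Definition eprod (z : C) : nat -> C := Cprod (fun n => 1 - e (INR n * z))%C.
Definition eprod_inf (z : C) : C := Cprod_inf (fun n => 1 - e (INR n * z))%C.

Lemma Cmod_e_nat n z : Cmod (e (INR n * z)) = Cmod (e z) ^ n.
Proof. now rewrite e_nat_mul, Cmod_pow. Qed.

Lemma clim_filterlim u (l : C) :
  clim u l <-> filterlim u eventually (locally (T := C_UniformSpace) l).
Proof.
  split.
  - intros H P HP. apply (locally_norm_le_locally (K := C_AbsRing) (V := C_NormedModule)) in HP.
    destruct HP as [eps HP]. destruct (H eps (cond_pos eps)) as [N G].
    exists N. intros n Hn. apply HP. apply G, Hn.
  - intros H eps He.
    assert (L : locally (T := C_UniformSpace) l (fun w => Cmod (w - l) < eps)).
    { apply (locally_le_locally_norm (K := C_AbsRing) (V := C_NormedModule)).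
      exists (mkposreal eps He). intros w Hw. exact Hw. }
    destruct (H _ L) as [N G]. exists N. exact G.
Qed.

Lemma clim_eprod z : UHP z -> clim (eprod z) (eprod_inf z).
Proof.
  intros H. pose proof (Cmod_e_lt_1 z H) as Hq. pose proof (Cmod_ge_0 (e z)) as Hq0.
  destruct (Cprod_converges (fun n => - e (INR n * z))%C (fun n => Cmod (e z) ^ n)) as [l Hl].
  - apply summable_geom; lra.
  - intros k. rewrite Cmod_opp, Cmod_e_nat. simpl. pose proof (pow_le (Cmod (e z)) k Hq0). nra.
  - assert (E : eprod_inf z = l).
    { unfold eprod_inf, Cprod_inf. apply (iota_unique (V := C_CompleteNormedModule)).
      - intros y Hy. apply (clim_unique (eprod z)); [now apply clim_filterlim|exact Hl].
      - apply clim_filterlim. exact Hl. }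
    rewrite E. exact Hl.
Qed.

Lemma one_sub_lower (x : C) (r : R) n : Cmod x <= r ^ S n -> 0 <= r < 1 -> 1 - r <= Cmod (1 - x).
Proof.
  intros Hx Hr. pose proof (Cmod_triangle (1 - x) x) as T.
  replace (1 - x + x)%C with (RtoC 1) in T by ring. rewrite Cmod_1 in T.
  assert (r ^ S n <= r); [|lra]. simpl.
  assert (r ^ n <= 1) by (rewrite <- (pow1 n); apply pow_incr; lra).
  pose proof (pow_le r n ltac:(lra)). nra.
Qed.

Lemma one_sub_e_neq_0 n z : UHP z -> (1 - e (INR (S n) * z))%C <> 0%C.
Proof.
  intros H. apply (proj2 (Cmod_gt_0 _)). pose proof (Cmod_e_lt_1 z H). pose proof (Cmod_ge_0 (e z)).
  pose proof (one_sub_lower (e (INR (S n) * z)) (Cmod (e z)) n). rewrite Cmod_e_nat in H2. lra.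
Qed.

(** The products of the inverses 1 / (1 - q^n) = 1 + q^n / (1 - q^n) converge as
    well, and their limit is an inverse of the product. *)
Lemma eprod_inf_neq_0 z : UHP z -> eprod_inf z <> 0%C.
Proof.
  intros H. pose proof (Cmod_e_lt_1 z H) as Hq. pose proof (Cmod_ge_0 (e z)) as Hq0.
  set (r := Cmod (e z)) in *.
  destruct (Cprod_converges (fun n => e (INR n * z) / (1 - e (INR n * z)))%C (fun n => / (1 - r) * r ^ n)) as [l Hl].
  - apply summable_scal; [left; apply Rinv_0_lt_compat; lra|]. apply summable_geom; lra.
  - intros k. rewrite Cmod_div by now apply one_sub_e_neq_0.
    pose proof (one_sub_lower (e (INR (S k) * z)) r k) as L. rewrite Cmod_e_nat in L |- *. fold r in L |- *.
    specialize (L (Rle_refl _) (conj Hq0 Hq)). rewrite Rmult_comm. unfold Rdiv.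
    apply Rmult_le_compat.
    + apply pow_le; lra.
    + left; apply Rinv_0_lt_compat; lra.
    + simpl. pose proof (pow_le r k Hq0). nra.
    + apply Rinv_le_contravar; lra.
  - pose proof (clim_mult _ _ _ _ (clim_eprod z H) Hl) as M.
    assert (E : (eprod_inf z * l = 1)%C).
    { apply (clim_unique _ _ _ M). apply (clim_ext (fun _ => 1%C)); [|apply clim_const].
      intros n. unfold eprod. induction n as [|n IH]; [simpl; ring|].
      cbn [Cprod]. pose proof (one_sub_e_neq_0 n z H) as Nz.
      set (x := e (INR (S n) * z)) in *.
      match goal with |- (_ = ?A * _ * (?B * _))%C =>
        transitivity ((A * B) * ((1 - x) * (1 + x / (1 - x))))%C; [|ring] end.
      rewrite <- IH. field. auto. }
    intros G. rewrite G in E. apply C1_nz. rewrite <- E. ring.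
Qed.

(** ** The logarithmic derivative *)

(** The logarithmic derivative of the factor 1 - q^(j+1). *)
Definition elog_term (z : C) (j : nat) : C :=
  (- (2 * PI * Ci) * ((INR j + 1)%R * e (INR (S j) * z) / (1 - e (INR (S j) * z))))%C.

Lemma cder_e_scaled (c z : C) : cder (fun w => e (c * w))%C z (2 * PI * Ci * c * e (c * z)).
Proof.
  replace (2 * PI * Ci * c * e (c * z))%C with ((2 * PI * Ci * e (c * z)) * (c * 1))%C by ring.
  apply (cder_comp e (fun w => c * w)%C); [|apply cder_e].
  apply (cder_scal c (fun w => w)). apply cder_id.
Qed.

Lemma cder_eprod n z : UHP z -> cder (fun w => eprod w n) z (eprod z n * csum (elog_term z) n).
Proof.
  intros H. induction n as [|n IH].
  - cbn [csum]. replace (eprod z 0 * 0)%C with (RtoC 0) by ring. apply (cder_const 1).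
  - unfold eprod. cbn [Cprod csum].
    pose proof (cder_minus _ _ _ _ _ (cder_const 1 z) (cder_e_scaled (INR (S n)) z)) as D.
    pose proof (cder_mult _ _ _ _ _ IH D) as M. unfold eprod in M.
    replace (Cprod (fun k => 1 - e (INR k * z)) n * (1 - e (INR (S n) * z)) * (csum (elog_term z) n + elog_term z n))%C
      with (Cprod (fun k => 1 - e (INR k * z)) n * csum (elog_term z) n * (1 - e (INR (S n) * z)) +
       Cprod (fun k => 1 - e (INR k * z)) n * (0 - 2 * PI * Ci * INR (S n) * e (INR (S n) * z)))%C; [exact M|].
    unfold elog_term. pose proof (one_sub_e_neq_0 n z H). rewrite <- S_INR. field. auto.
Qed.

Lemma elog_term_le z r j : Cmod (e z) <= r -> r < 1 ->
  Cmod (elog_term z j) <= 2 * PI / (1 - r) * ((INR j + 1) * r ^ j).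
Proof.
  intros Hr H1. pose proof PI_RGT_0. pose proof (Cmod_ge_0 (e z)) as Hq0. pose proof (pos_INR j) as Pj.
  assert (B : Cmod (e (INR (S j) * z)) <= r ^ S j) by (rewrite Cmod_e_nat; apply pow_incr; lra).
  pose proof (one_sub_lower _ r j B ltac:(lra)) as L.
  assert (N : (1 - e (INR (S j) * z))%C <> 0%C) by (apply (proj2 (Cmod_gt_0 _)); lra).
  unfold elog_term. rewrite Cmod_mult, Cmod_opp, Cmod_div by auto.
  rewrite !Cmod_mult, Cmod_Ci, !Cmod_R, !Rabs_pos_eq, Rmult_1_r by lra.
  unfold Rdiv. rewrite !Rmult_assoc. apply Rmult_le_compat_l; [lra|]. apply Rmult_le_compat_l; [lra|].
  rewrite <- (Rmult_comm ((INR j + 1) * r ^ j)), !Rmult_assoc. apply Rmult_le_compat_l; [lra|].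
  apply Rmult_le_compat; [apply Cmod_ge_0|left; apply Rinv_0_lt_compat; lra| |apply Rinv_le_contravar; lra].
  eapply Rle_trans; [exact B|]. simpl. pose proof (pow_le r j ltac:(lra)). nra.
Qed.

Lemma elog_converges z : UHP z -> exists D, clim (csum (elog_term z)) D.
Proof.
  intros H. pose proof (Cmod_e_lt_1 z H). pose proof (Cmod_ge_0 (e z)). pose proof PI_RGT_0.
  eapply csum_converges.
  - apply summable_scal; [|apply (summable_arith_geom (Cmod (e z))); lra].
    apply (Rdiv_le_0_compat (2 * PI) (1 - Cmod (e z))); lra.
  - intros i. apply elog_term_le; lra.
Qed.

(** On the half plane above half the height of z, the derivatives of the partial
    products converge uniformly, at the rate of a series in n r^n. *)
Lemma cder_eprod_inf z D : UHP z -> clim (csum (elog_term z)) D ->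
  cder eprod_inf z (eprod_inf z * D).
Proof.
  intros H HD. set (y := Im z / 2). unfold UHP in H.
  pose proof PI_RGT_0 as P.
  set (r := exp (- (2 * PI * y))).
  assert (r0 : 0 < r) by apply exp_pos.
  assert (r1 : r < 1) by (unfold r; rewrite <- exp_0; apply exp_increasing; unfold y; nra).
  assert (Q : forall w, y < Im w -> Cmod (e w) <= r).
  { intros w Hw. rewrite Cmod_e. left. apply exp_increasing. nra. }
  assert (U : forall w, y < Im w -> UHP w) by (unfold UHP, y; intros; lra).
  destruct (summable_geom r ltac:(lra)) as [_ [B HB]].
  set (c := 2 * PI / (1 - r)).
  assert (c0 : 0 <= c) by (unfold c; apply Rdiv_le_0_compat; lra).
  set (d := fun j => c * ((INR j + 1) * r ^ j)).
  assert (Sd : summable d) by (apply summable_scal; auto; apply summable_arith_geom; lra).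
  pose proof Sd as [d0 [E HE]].
  assert (PB : forall w n, y < Im w -> Cmod (eprod w n) <= exp B).
  { intros w n Hw. eapply Rle_trans.
    - apply (Cmod_Cprod_le (fun k => - e (INR k * w))%C (fun k => r ^ k)).
      intros k. rewrite Cmod_opp, Cmod_e_nat. specialize (Q w Hw).
      eapply Rle_trans; [apply pow_incr; split; [apply Cmod_ge_0|exact Q]|].
      simpl. pose proof (pow_le r k ltac:(lra)). nra.
    - specialize (HB n). destruct (Rle_lt_or_eq_dec _ _ HB) as [G|G]; [left; now apply exp_increasing|rewrite G; lra]. }
  assert (DB : forall w n, y < Im w -> Cmod (csum (elog_term w) n) <= E).
  { intros w n Hw. eapply Rle_trans; [|apply (HE n)]. apply Cmod_csum_le. intros i.
    apply elog_term_le; auto. }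
  assert (G : exists G : C -> C, forall w, y < Im w -> clim (csum (elog_term w)) (G w)).
  { exists (fun w => iota (T := C_CompleteNormedModule) (fun l => clim (csum (elog_term w)) l)).
    intros w Hw. destruct (elog_converges w (U w Hw)) as [l Hl].
    rewrite (iota_unique (V := C_CompleteNormedModule) _ l); auto.
    intros x Hx. apply (clim_unique _ _ _ Hx Hl). }
  destruct G as [G HG].
  assert (Hz : y < Im z) by (unfold y; lra).
  rewrite <- (clim_unique _ _ _ (HG z Hz) HD).
  apply (cder_lim y (fun n w => eprod w n) (fun n w => eprod w n * csum (elog_term w) n)%C eprod_inf
    (fun w => eprod_inf w * G w)%C (fun n => (exp B * E) * r ^ n + exp B * d n)).
  - pose proof (exp_pos B). assert (0 <= E) by (apply (HE O)).
    apply summable_plus; apply summable_scal; auto; try nra.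
    apply summable_geom; lra.
  - intros n w Hw. apply cder_eprod; auto.
  - intros n w Hw.
    replace (eprod w (S n) * csum (elog_term w) (S n) - eprod w n * csum (elog_term w) n)%C with
      ((eprod w n * - e (INR (S n) * w)) * csum (elog_term w) (S n) + eprod w n * elog_term w n)%C.
    2: { unfold eprod. cbn [Cprod csum]. ring. }
    eapply Rle_trans; [apply Cmod_triangle|]. rewrite !Cmod_mult, Cmod_opp, Cmod_e_nat.
    assert (A1 := PB w n Hw). assert (A2 := DB w (S n) Hw).
    assert (A3 := elog_term_le w r n (Q w Hw) r1).
    assert (A4 : Cmod (e w) ^ S n <= r ^ n).
    { eapply Rle_trans; [apply pow_incr; split; [apply Cmod_ge_0|apply Q, Hw]|].
      simpl. pose proof (pow_le r n ltac:(lra)). nra. }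
    assert (A5 : 0 <= Cmod (e w) ^ S n) by (apply pow_le, Cmod_ge_0).
    apply Rplus_le_compat.
    + replace (exp B * E * r ^ n) with (exp B * r ^ n * E) by ring.
      apply Rmult_le_compat; auto; try apply Cmod_ge_0.
      * apply Rmult_le_pos; auto. apply Cmod_ge_0.
      * apply Rmult_le_compat; auto. apply Cmod_ge_0.
    + apply Rmult_le_compat; auto; apply Cmod_ge_0.
  - intros w Hw. apply clim_eprod; auto.
  - intros w Hw. apply clim_mult; [apply clim_eprod; auto|auto].
  - exact Hz.
Qed.

Lemma clim_geom_sum (x : C) : Cmod x < 1 -> clim (csum (fun k => x ^ k)%C) (/ (1 - x)).
Proof.
  intros H. pose proof (Cmod_ge_0 x).
  assert (N : (1 - x)%C <> 0%C).
  { intros G. apply Ceq_minus in G. rewrite <- G, Cmod_1 in H. lra. }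
  assert (L : clim (fun n => x ^ n)%C 0).
  { apply (clim_0_le _ (fun n => Cmod x ^ n)); [intros; rewrite Cmod_pow; lra|].
    apply is_lim_seq_geom. now rewrite Rabs_pos_eq. }
  pose proof (clim_scal _ _ (/ (1 - x))%C (clim_minus _ _ _ _ (clim_const 1) L)) as M.
  replace (/ (1 - x) * (1 - 0))%C with (/ (1 - x))%C in M by ring.
  revert M. apply clim_ext. intros n.
  assert (E : ((1 - x) * csum (fun k => x ^ k) n = 1 - x ^ n)%C).
  { induction n as [|n IH]; [simpl; ring|]. cbn [csum]. rewrite Cmult_plus_distr_l, IH, Cpow_S. ring. }
  rewrite <- E. field. auto.
Qed.

Lemma clim_arith_geom_sum (x : C) : Cmod x < 1 ->
  clim (csum (fun k => (INR k + 1)%R * x ^ k)%C) (/ ((1 - x) * (1 - x))).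
Proof.
  intros H. pose proof (Cmod_ge_0 x).
  assert (N : (1 - x)%C <> 0%C).
  { intros G. apply Ceq_minus in G. rewrite <- G, Cmod_1 in H. lra. }
  assert (L : clim (fun n => INR n * x ^ n)%C 0).
  { intros eps He.
    destruct (summable_tail _ (summable_arith_geom (Cmod x) ltac:(lra)) eps He) as [N0 HN].
    exists N0. intros n Hn. specialize (HN n (S n) Hn ltac:(lia)). simpl in HN.
    replace (INR n * x ^ n - 0)%C with (INR n * x ^ n)%C by ring.
    rewrite Cmod_mult, Cmod_pow, Cmod_R, Rabs_pos_eq by apply pos_INR.
    pose proof (pow_le (Cmod x) n H0). lra. }
  pose proof (clim_scal _ _ (/ (1 - x))%C (clim_minus _ _ _ _ (clim_geom_sum x H) L)) as M.
  replace (/ (1 - x) * (/ (1 - x) - 0))%C with (/ ((1 - x) * (1 - x)))%C in M by (field; auto).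
  revert M. apply clim_ext. intros n.
  assert (E : ((1 - x) * csum (fun k => (INR k + 1)%R * x ^ k) n = csum (fun k => x ^ k) n - INR n * x ^ n)%C).
  { induction n as [|n IH]; [simpl; ring|]. cbn [csum].
    rewrite Cmult_plus_distr_l, IH, S_INR, Cpow_S, RtoC_plus. ring. }
  rewrite <- E. field. auto.
Qed.

(** Domination by a product reduces the interchange to Tannery's theorem for the
    partial row sums. *)
Lemma double_series_swap (a : nat -> nat -> C) (al be : nat -> R) (A B : nat -> C) (S : C) :
  summable al -> summable be -> (forall m n, Cmod (a m n) <= al m * be n) ->
  (forall m, clim (csum (a m)) (A m)) ->
  (forall n, clim (csum (fun m => a m n)) (B n)) ->
  clim (csum A) S -> clim (csum B) S.
Proof.
  intros Ha Hb H HA HB HS. pose proof Hb as [b0 [E HE]].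
  apply (tannery (fun N m => csum (a m) N) A (fun m => E * al m)); auto.
  - apply summable_scal; auto. apply (HE O).
  - intros N m. eapply Rle_trans; [apply Cmod_csum_le; intros; apply H|].
    rewrite rsum_scal, Rmult_comm. apply Rmult_le_compat_r; [apply Ha|apply HE].
  - intros N. apply (clim_ext (fun M => csum (fun n => csum (fun m => a m n) M) N)).
    + intros M. apply csum_swap.
    + now apply (clim_csum (fun M n => csum (fun m => a m n) M)).
Qed.

(** Both are rearrangements of the double series of the j q^(j k): by rows it is
    the logarithmic derivative of the product, by columns the series of the
    q^k / (1 - q^k)^2. *)
Lemma elog_qcsc2 z D : UHP z -> clim (csum (elog_term z)) D ->
  exists H, clim (csum (fun m => qcsc2 ((INR m + 1)%R * z)))%C H /\ D = (- (2 * PI * Ci) * H)%C.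
Proof.
  intros Hz HD. pose proof (Cmod_e_lt_1 z Hz) as Hq. pose proof (Cmod_ge_0 (e z)) as Hq0.
  set (r := Cmod (e z)) in *.
  assert (I0 : (- (2 * PI * Ci))%C <> 0%C).
  { intros G. assert (X : (2 * PI * Ci)%C = 0%C) by (replace (2 * PI * Ci)%C with (- - (2 * PI * Ci))%C by ring; rewrite G; ring).
    revert X. repeat apply Cmult_neq_0; auto using two_neq_0C, PI_neq_0C, Ci_nz. }
  exists (/ - (2 * PI * Ci) * D)%C. split; [|field; auto].
  2: { repeat split; auto using two_neq_0C, PI_neq_0C, Ci_nz. }
  assert (Lt : forall k, Cmod (e (INR (S k) * z)) < 1).
  { intros k. rewrite Cmod_e_nat. fold r. rewrite <- tech_pow_Rmult.
    assert (r ^ k <= 1) by (rewrite <- (pow1 k); apply pow_incr; lra).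
    pose proof (pow_le r k Hq0). nra. }
  apply (double_series_swap (fun j k => (INR j + 1)%R * e (INR (S j * S k) * z))%C
    (fun j => (INR j + 1) * r ^ j) (fun k => r ^ k)
    (fun j => (INR j + 1)%R * e (INR (S j) * z) / (1 - e (INR (S j) * z)))%C).
  - apply summable_arith_geom; lra.
  - apply summable_geom; lra.
  - intros j k. pose proof (pos_INR j).
    rewrite Cmod_mult, Cmod_R, Rabs_pos_eq, Cmod_e_nat by lra. fold r.
    rewrite Rmult_assoc. apply Rmult_le_compat_l; [lra|]. rewrite <- pow_add.
    replace (S j * S k)%nat with (j + k + (j * k + 1))%nat by lia.
    rewrite (pow_add r (j + k)).
    assert (r ^ (j * k + 1) <= 1) by (rewrite <- (pow1 (j * k + 1)); apply pow_incr; lra).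
    pose proof (pow_le r (j + k) Hq0). pose proof (pow_le r (j * k + 1) Hq0). nra.
  - intros j. pose proof (clim_scal _ _ ((INR j + 1)%R * e (INR (S j) * z))%C (clim_geom_sum _ (Lt j))) as L.
    revert L. apply clim_ext. intros n. rewrite <- csum_scal. apply csum_ext. intros k.
    replace (INR (S j * S k) * z)%C with (INR (S j) * z + INR k * (INR (S j) * z))%C.
    2: { rewrite mult_INR, (S_INR k), RtoC_mult, RtoC_plus. ring. }
    rewrite e_plus, (e_nat_mul k). ring.
  - intros k. pose proof (clim_scal _ _ (e (INR (S k) * z)) (clim_arith_geom_sum _ (Lt k))) as L.
    rewrite <- S_INR. unfold qcsc2. revert L. apply clim_ext. intros n. rewrite <- csum_scal. apply csum_ext. intros j.
    replace (INR (S j * S k) * z)%C with (INR (S k) * z + INR j * (INR (S k) * z))%C.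
    + rewrite e_plus, (e_nat_mul j). ring.
    + rewrite mult_INR, (S_INR j), RtoC_mult, RtoC_plus. ring.
  - apply (clim_ext (fun n => / - (2 * PI * Ci) * csum (elog_term z) n)%C); [|now apply clim_scal].
    intros n. rewrite <- csum_scal. apply csum_ext. intros j. unfold elog_term.
    pose proof (one_sub_e_neq_0 j z Hz). field. repeat split; auto using two_neq_0C, PI_neq_0C, Ci_nz.
Qed.

Lemma eta_eprod z : eta z = (e (z / 24) * eprod_inf z)%C.
Proof. reflexivity. Qed.

Lemma eta_neq_0 z : UHP z -> eta z <> 0%C.
Proof. intros H. apply Cmult_neq_0; [apply e_neq_0|now apply eprod_inf_neq_0]. Qed.

Lemma cder_eta z : UHP z -> exists H,
  clim (csum (fun m => qcsc2 ((INR m + 1)%R * z)))%C H /\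
  cder eta z (eta z * (2 * PI * Ci * (/ 24 - H))).
Proof.
  intros Hz. destruct (elog_converges z Hz) as [D HD].
  destruct (elog_qcsc2 z D Hz HD) as [H [HH ->]]. exists H. split; auto.
  pose proof (cder_e_scaled (/ 24)%C z) as D1.
  pose proof (cder_mult _ _ _ _ _ D1 (cder_eprod_inf z _ Hz HD)) as M.
  replace (eta z * (2 * PI * Ci * (/ 24 - H)))%C with
   (2 * PI * Ci * / 24 * e (/ 24 * z) * eprod_inf z + e (/ 24 * z) * (eprod_inf z * (- (2 * PI * Ci) * H)))%C.
  - revert M. apply cder_ext. intros w. rewrite eta_eprod. do 2 f_equal. unfold Cdiv. ring.
  - rewrite eta_eprod. replace (/ 24 * z)%C with (z / 24)%C by (unfold Cdiv; ring). ring.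
Qed.

(** * The transformation of eta under z -> -1/z *)

(** The principal square root. *)
Definition csqrt (w : C) : C :=
  (sqrt ((Cmod w + Re w) / 2),
   (if Rlt_dec (Im w) 0 then -1 else 1) * sqrt ((Cmod w - Re w) / 2)).

Lemma csqrt_sqr w : (csqrt w * csqrt w = w)%C.
Proof.
  pose proof (Cmod2_alt w) as M. pose proof (re_le_Cmod w) as B.
  apply Rabs_le_between in B. pose proof (Cmod_ge_0 w) as P.
  assert (A1 : 0 <= (Cmod w + Re w) / 2) by lra.
  assert (A2 : 0 <= (Cmod w - Re w) / 2) by lra.
  pose proof (sqrt_sqrt _ A1) as S1. pose proof (sqrt_sqrt _ A2) as S2.
  assert (S3 : sqrt ((Cmod w + Re w) / 2) * sqrt ((Cmod w - Re w) / 2) = Rabs (Im w) / 2).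
  { rewrite <- sqrt_mult by auto.
    replace ((Cmod w + Re w) / 2 * ((Cmod w - Re w) / 2)) with ((Rabs (Im w) / 2) * (Rabs (Im w) / 2)).
    - apply sqrt_square. pose proof (Rabs_pos (Im w)). lra.
    - assert (Rabs (Im w) * Rabs (Im w) = Im w ^ 2) by (rewrite <- Rabs_mult, Rabs_pos_eq; nra). nra. }
  set (a := sqrt ((Cmod w + Re w) / 2)) in *. set (b := sqrt ((Cmod w - Re w) / 2)) in *.
  unfold csqrt. fold a b. apply C_ext.
  - rewrite re_mult. cbn [Re Im fst snd]. destruct (Rlt_dec (Im w) 0); lra.
  - rewrite im_mult. cbn [Re Im fst snd]. destruct (Rlt_dec (Im w) 0) as [L|L].
    + rewrite Rabs_left in S3 by lra. lra.
    + rewrite Rabs_pos_eq in S3 by lra. lra.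
Qed.

Lemma csqrt_Re_pos w : Im w <> 0 \/ 0 < Re w -> 0 < Re (csqrt w).
Proof.
  intros H. apply sqrt_lt_R0.
  pose proof (Cmod2_alt w) as M. pose proof (Cmod_ge_0 w) as P.
  pose proof (re_le_Cmod w) as B. apply Rabs_le_between in B.
  destruct H as [H|H]; [|lra].
  assert (0 < Im w ^ 2) by (rewrite <- Rsqr_pow2; now apply Rlt_0_sqr).
  destruct (Req_dec (Cmod w + Re w) 0) as [E|E]; [|lra].
  replace (Cmod w) with (- Re w) in M by lra. lra.
Qed.

Lemma sqr_eq_Re_pos (s t : C) : (s * s = t * t)%C -> 0 < Re s -> 0 < Re t -> s = t.
Proof.
  intros E Hs Ht.
  destruct (Ceq_dec (s - t) 0) as [G|G]; [now apply Ceq_minus|].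
  exfalso. assert (X : (s + t)%C = 0%C).
  { replace (s + t)%C with ((s * s - t * t) / (s - t))%C by (field; auto). rewrite E.
    replace (t * t - t * t)%C with (RtoC 0) by ring. unfold Cdiv. ring. }
  apply (f_equal Re) in X. rewrite re_plus, re_RtoC in X. lra.
Qed.

(** The factorisation (s w - s z) (s w + s z) = w - z gives the continuity and
    then the derivative, as s w + s z has real part at least that of s z. *)
Lemma cder_csqrt z : UHP z -> cder csqrt z (/ (2 * csqrt z)).
Proof.
  intros H. unfold UHP in H.
  assert (P : forall w, 0 < Im w -> 0 < Re (csqrt w)) by (intros; apply csqrt_Re_pos; left; lra).
  pose proof (near_ImP z 0 H) as N. pose proof (P z H) as Pz.
  assert (L : forall w, 0 < Im w -> Re (csqrt z) <= Cmod (csqrt w + csqrt z)).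
  { intros w Hw. eapply Rle_trans; [|apply re_le_Cmod]. rewrite re_plus. specialize (P w Hw).
    rewrite Rabs_pos_eq; lra. }
  assert (D : forall w, 0 < Im w -> (csqrt w - csqrt z = / (csqrt w + csqrt z) * (w - z))%C).
  { intros w Hw. rewrite <- (csqrt_sqr w) at 3. rewrite <- (csqrt_sqr z) at 3.
    field. apply (proj2 (Cmod_gt_0 _)). specialize (L w Hw). lra. }
  assert (Cc : ccont csqrt z).
  { intros eps He.
    assert (N' : near z (fun w => Cmod (w - z) < eps * Re (csqrt z))).
    { exists (eps * Re (csqrt z)). split; auto. nra. }
    generalize (near_and _ _ _ N N'). apply near_imp. intros w [Hw Hz].
    rewrite (D w Hw), Cmod_mult, Cmod_inv.
    - specialize (L w Hw). apply Rmult_lt_reg_l with (Cmod (csqrt w + csqrt z)); [lra|].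
      rewrite <- Rmult_assoc, Rinv_r by lra. nra.
    - apply (proj2 (Cmod_gt_0 _)). specialize (L w Hw). lra. }
  exists (fun w => / (csqrt w + csqrt z))%C. split; [f_equal; ring|]. split.
  - apply ccont_inv; [|apply ccont_plus; [exact Cc|apply ccont_const]].
    apply (proj2 (Cmod_gt_0 _)). specialize (L z H). lra.
  - generalize N. apply near_imp. intros w Hw. now apply D.
Qed.

Lemma e_quarter : e (1 / 4) = Ci.
Proof.
  unfold e. replace (2 * PI * Ci * (1 / 4))%C with (Ci * (PI / 2)%R)%C
    by (rewrite RtoC_div by lra; field).
  unfold Cexp. apply C_ext; simpl.
  - replace (0 * (PI / 2) - 1 * 0) with 0 by ring. replace (0 * 0 + 1 * (PI / 2)) with (PI / 2) by ring.
    rewrite cos_PI2. ring.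
  - replace (0 * (PI / 2) - 1 * 0) with 0 by ring. replace (0 * 0 + 1 * (PI / 2)) with (PI / 2) by ring.
    rewrite sin_PI2, exp_0. ring.
Qed.

Lemma e_eighth_sqr : (e (1 / 8) * e (1 / 8) = Ci)%C.
Proof. rewrite <- e_plus, <- e_quarter. f_equal. field. Qed.

Lemma Re_e_eighth : 0 < Re (e (1 / 8)).
Proof.
  unfold e. replace (2 * PI * Ci * (1 / 8))%C with (Ci * (PI / 4)%R)%C
    by (rewrite RtoC_div by lra; field).
  unfold Cexp. cbn [Re Im fst snd Ci RtoC Cmult].
  replace (0 * (PI / 4) - 1 * 0) with 0 by ring. replace (0 * 0 + 1 * (PI / 4)) with (PI / 4) by ring.
  rewrite exp_0, cos_PI4, Rmult_1_l. pose proof Rlt_sqrt2_0. apply Rdiv_lt_0_compat; lra.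
Qed.

Lemma UHP_Ci : UHP Ci.
Proof. unfold UHP. simpl. lra. Qed.

(** The logarithmic derivatives of both sides agree, by the transformation of
    the Eisenstein series; the constant is read off at the fixed point [Ci]. *)
Lemma eta_S z s : UHP z -> (s * s = z)%C -> 0 < Re s ->
  eta (- / z) = (e (- (1 / 8)) * (s * eta z))%C.
Proof.
  intros Hz Hs Ps.
  assert (Es : forall w, UHP w -> 0 < Re (csqrt w)).
  { intros w Hw. apply csqrt_Re_pos. left. unfold UHP in Hw. lra. }
  assert (E : s = csqrt z).
  { apply sqr_eq_Re_pos; auto. now rewrite csqrt_sqr. }
  subst s. clear Hs Ps.
  assert (S0 : forall w, UHP w -> csqrt w <> 0%C).
  { intros w Hw G. specialize (Es w Hw). rewrite G, re_RtoC in Es. lra. }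
  set (rho := fun w => (eta (- / w) * / (csqrt w * eta w))%C).
  assert (D : forall w, UHP w -> cder rho w 0).
  { intros w Hw. pose proof (UHP_neq_0 w Hw) as w0. pose proof (UHP_S w Hw) as Hw'.
    destruct (cder_eta w Hw) as [H1 [L1 D1]].
    destruct (cder_eta (- / w) Hw') as [H2 [L2 D2]].
    pose proof (eisenstein2_S w H1 H2 Hw L1 L2) as E2.
    assert (Di : cder (fun w => - / w)%C w (/ (w * w))%C).
    { pose proof (cder_scal (-1)%C _ _ _ (cder_inv (fun w => w) w 1 w0 (cder_id w))) as X.
      replace (/ (w * w))%C with (-1 * (- (1) / (w * w)))%C by (field; auto).
      revert X. apply cder_ext. intros; ring. }
    pose proof (cder_comp eta _ _ _ _ Di D2) as DA.
    pose proof (cder_mult _ _ _ _ _ (cder_csqrt w Hw) D1) as DB.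
    pose proof (S0 w Hw) as s0. pose proof (eta_neq_0 w Hw) as h0.
    pose proof (cder_inv (fun w => csqrt w * eta w)%C _ _ (Cmult_neq_0 _ _ s0 h0) DB) as DC.
    pose proof (cder_mult _ _ _ _ _ DA DC) as DD.
    match type of DD with cder _ _ ?l => replace (RtoC 0) with l; [exact DD|] end.
    set (A := eta (- / w)) in *. set (B := eta w) in *. set (t := csqrt w) in *.
    assert (T : (t * t = w)%C) by apply csqrt_sqr.
    (* the transformation of the Eisenstein series, multiplied by i / (2 pi) *)
    assert (K : (2 * PI * Ci * (/ 24 - H2) / (w * w) = / (2 * w) + 2 * PI * Ci * (/ 24 - H1))%C).
    { pose proof two_neq_0C. pose proof PI_neq_0C. pose proof Ci_nz.
      assert (I : (Ci / (2 * PI) * (- (4 * PI * PI) * H1) = - (2 * PI * Ci * H1))%C) by (field; auto).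
      rewrite E2 in I.
      replace (2 * PI * Ci * (/ 24 - H1))%C with (2 * PI * Ci / 24 + - (2 * PI * Ci * H1))%C by field.
      rewrite <- I.
      transitivity ((2 * PI * Ci * (/ 24 - H2) / (w * w)) + (1 + Ci * Ci) / (2 * w))%C.
      - rewrite Ci_sq. field. auto.
      - field. auto. }
    transitivity (A / (t * B) * (2 * PI * Ci * (/ 24 - H2) / (w * w) -
       (/ (2 * (t * t)) + 2 * PI * Ci * (/ 24 - H1))))%C.
    - field. repeat split; auto.
    - rewrite T, K. ring. }
  assert (R : rho z = e (- (1 / 8))).
  { rewrite (cder_0_constant rho D Ci z UHP_Ci Hz). unfold rho.
    assert (EI : (- / Ci = Ci)%C) by (rewrite Ci_inv; ring). rewrite EI.
    assert (ES : csqrt Ci = e (1 / 8)).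
    { apply sqr_eq_Re_pos; [rewrite csqrt_sqr, e_eighth_sqr; reflexivity|apply Es, UHP_Ci|apply Re_e_eighth]. }
    rewrite ES, e_opp. pose proof (eta_neq_0 Ci UHP_Ci). pose proof (e_neq_0 (1 / 8)). field. auto. }
  rewrite <- R. unfold rho. pose proof (eta_neq_0 z Hz). pose proof (S0 z Hz). field. auto.
Qed.

Lemma eta_T z k : UHP z -> eta (z + IZR k) = (e (IZR k / 24) * eta z)%C.
Proof.
  intros Hz. rewrite !eta_eprod.
  replace ((z + IZR k) / 24)%C with (IZR k / 24 + z / 24)%C by (unfold Cdiv; ring).
  rewrite e_plus, <- Cmult_assoc. do 2 f_equal.
  assert (Hz' : UHP (z + IZR k)) by (unfold UHP in *; rewrite im_plus, im_RtoC; lra).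
  apply (clim_unique (eprod z)); [|now apply clim_eprod].
  apply (clim_ext (eprod (z + IZR k))); [|now apply clim_eprod].
  intros n. apply Cprod_ext. intros j.
  cut (e (INR (S j) * (z + IZR k)) = e (INR (S j) * z)); [intros ->; reflexivity|].
  rewrite Cmult_plus_distr_l, <- RtoC_mult, INR_IZR_INZ, <- mult_IZR. apply e_plus_Z.
Qed.

(** * The multiplier of eta *)

Definition e24 (k : Z) : C := e (IZR k / 24).

Lemma e24_plus k l : e24 (k + l) = (e24 k * e24 l)%C.
Proof. unfold e24. rewrite <- e_plus, plus_IZR, RtoC_plus. f_equal. field. Qed.

Lemma e24_24 k : e24 (24 * k) = 1%C.
Proof.
  unfold e24. rewrite mult_IZR, RtoC_mult. rewrite <- (e_Z k). f_equal.
  field.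
Qed.

Lemma e24_cong k l m : (k = l + 24 * m)%Z -> e24 k = e24 l.
Proof. intros ->. rewrite e24_plus, e24_24. ring. Qed.

Lemma e24_0 : e24 0 = 1%C.
Proof. exact (e24_24 0). Qed.

Lemma e24_3 : e24 3 = e (1 / 8).
Proof. unfold e24. f_equal. field. Qed.

Lemma e24_opp k : e24 (- k) = (/ e24 k)%C.
Proof. unfold e24. rewrite <- e_opp, opp_IZR, RtoC_opp. f_equal. field. Qed.

Lemma e24_m3 : e24 (-3) = e (- (1 / 8)).
Proof. change (-3)%Z with (- (3))%Z. now rewrite e24_opp, e24_3, e_opp. Qed.

Lemma e24_6 : e24 6 = Ci.
Proof. rewrite <- e_quarter. unfold e24. f_equal. field. Qed.

Lemma e24_m6 : e24 (-6) = (- Ci)%C.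
Proof. change (-6)%Z with (- (6))%Z. now rewrite e24_opp, e24_6, Ci_inv. Qed.

(** The multiplier of eta at (a, b; c, d) for odd positive d, as a power of a
    24th root of unity: Petersson's formula, whose Jacobi symbol (c/d)
    enters as a multiple of 12. *)
Definition eta_exponent (a b c d : Z) : Z :=
  (a * c * (1 - d * d) + d * (b - c) + 3 * (d - 1) + 12 * Z.b2z (jac c d))%Z.

Definition eta_rule (a b c d : Z) : Prop :=
  forall z w, UHP z -> (w * w = IZR c * z + IZR d)%C -> 0 < Re w ->
    eta ((IZR a * z + IZR b) / (IZR c * z + IZR d)) =
      (e24 (eta_exponent a b c d) * (w * eta z))%C.

Lemma Im_affine (c d : R) z : Im (c * z + d) = c * Im z.
Proof. rewrite im_plus, im_scal_l, im_RtoC. ring. Qed.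

Lemma Re_affine (c d : R) z : Re (c * z + d) = c * Re z + d.
Proof. rewrite re_plus, re_scal_l, re_RtoC. ring. Qed.

Lemma affine_neq_0 (a b c d : R) z : 0 < a * d - b * c -> UHP z -> (c * z + d)%C <> 0%C.
Proof.
  intros Hd Hz E. unfold UHP in Hz.
  pose proof (f_equal Im E) as I. rewrite Im_affine, im_RtoC in I.
  pose proof (f_equal Re E) as R. rewrite Re_affine, re_RtoC in R.
  assert (c = 0) by nra. subst c. assert (d = 0) by lra. subst d. lra.
Qed.

Lemma UHP_moebius (a b c d : R) z : 0 < a * d - b * c -> UHP z ->
  UHP ((a * z + b) / (c * z + d)).
Proof.
  intros Hd Hz. pose proof (affine_neq_0 a b c d z Hd Hz) as N. unfold UHP in *.
  unfold Cdiv. rewrite im_mult, Im_inv by auto.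
  assert (M0 : 0 < Cmod (c * z + d)) by exact (proj1 (Cmod_gt_0 _) N).
  assert (M : 0 < Cmod (c * z + d) ^ 2) by now apply pow_lt.
  assert (R : Re (/ (c * z + d)) = Re (c * z + d) / Cmod (c * z + d) ^ 2).
  { rewrite Cmod2_alt. destruct z as [x y]. simpl. reflexivity. }
  rewrite R, !Im_affine, !Re_affine.
  replace ((a * Re z + b) * (- (c * Im z) / Cmod (c * z + d) ^ 2) +
    a * Im z * ((c * Re z + d) / Cmod (c * z + d) ^ 2)) with
    ((a * d - b * c) * Im z / Cmod (c * z + d) ^ 2) by (field; lra).
  apply Rdiv_lt_0_compat; [nra|auto].
Qed.

Lemma Im_pos_of_sqr s z : UHP z -> (s * s = z)%C -> 0 < Re s -> 0 < Im s.
Proof. intros Hz E H. unfold UHP in Hz. rewrite <- E, im_mult in Hz. nra. Qed.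

(** The parabolic element (1 0; 1 1), conjugate of a translation by the inversion. *)
Lemma eta_V z v : UHP z -> (v * v = z + 1)%C -> 0 < Re v ->
  eta (z / (z + 1)) = (e24 (-1) * (v * eta z))%C.
Proof.
  intros Hz Ev Pv. pose proof (UHP_neq_0 z Hz) as z0.
  assert (z1 : (z + 1)%C <> 0%C).
  { apply Im_neq_0. rewrite im_plus, im_RtoC. unfold UHP in Hz. lra. }
  set (s := csqrt z). assert (Es : (s * s = z)%C) by apply csqrt_sqr.
  assert (Ps : 0 < Re s) by (apply csqrt_Re_pos; left; unfold UHP in Hz; lra).
  set (z2 := (- / z + IZR (-1))%C).
  pose proof (UHP_S z Hz) as H1.
  assert (H2 : UHP z2) by (unfold UHP, z2 in *; rewrite im_plus, im_RtoC; lra).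
  set (t := csqrt z2). assert (Et : (t * t = z2)%C) by apply csqrt_sqr.
  assert (Pt : 0 < Re t) by (apply csqrt_Re_pos; left; unfold UHP in H2; lra).
  pose proof (Im_pos_of_sqr s z Hz Es Ps) as Is. pose proof (Im_pos_of_sqr t z2 H2 Et Pt) as It.
  replace (z / (z + 1))%C with (- / z2)%C.
  2: { unfold z2. field. split; auto.
    replace (-1 + IZR (-1) * z)%C with (- (z + 1))%C by ring. split; auto.
    intros G. apply z1. replace (z + 1)%C with (- - (z + 1))%C by ring. rewrite G. ring. }
  rewrite (eta_S z2 t H2 Et Pt). unfold z2. rewrite (eta_T _ (-1) H1), (eta_S z s Hz Es Ps).
  fold (e24 (-1)). rewrite <- !e24_m3.
  assert (E : v = (- Ci * (t * s))%C).
  { apply sqr_eq_Re_pos; auto.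
    - replace (- Ci * (t * s) * (- Ci * (t * s)))%C with (Ci * Ci * (t * t) * (s * s))%C by ring.
      rewrite Ev, Ci_sq, Et, Es. unfold z2. field. auto.
    - replace (- Ci * (t * s))%C with (- ((t * s) * Ci))%C by ring.
      rewrite re_opp, re_mult_Ci, im_mult. nra. }
  rewrite E. replace (- Ci)%C with (e24 (-3) * e24 (-3))%C; [ring|].
  rewrite <- e24_plus. exact e24_m6.
Qed.

(** The cocycle relation of the principal square roots of c z + d. *)
Lemma V_sqrt (c d : R) z v w1 w : 0 < d -> UHP z ->
  (v * v = z + 1)%C -> 0 < Re v ->
  (w1 * w1 = c * (z / (z + 1)) + d)%C -> 0 < Re w1 ->
  (w * w = (c + d)%R * z + d)%C -> 0 < Re w -> w = (w1 * v)%C.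
Proof.
  intros Hd Hz Ev Pv E1 P1 Ew Pw.
  assert (z1 : (z + 1)%C <> 0%C).
  { apply Im_neq_0. rewrite im_plus, im_RtoC. unfold UHP in Hz. lra. }
  assert (H1 : UHP (z + 1)) by (unfold UHP in *; rewrite im_plus, im_RtoC; lra).
  pose proof (Im_pos_of_sqr v _ H1 Ev Pv) as Iv.
  assert (E : ((w1 * v) * (w1 * v) = (c + d)%R * z + d)%C).
  { replace (w1 * v * (w1 * v))%C with ((w1 * w1) * (v * v))%C by ring.
    rewrite E1, Ev, RtoC_plus. field. auto. }
  apply sqr_eq_Re_pos; auto; [now rewrite E|].
  destruct (Rle_dec (Im w1) 0) as [L|L]; [rewrite re_mult; nra|].
  (* otherwise w1 v lies in the upper half plane, and so does its square *)
  assert (Iz : 0 < Im (z / (z + 1))).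
  { replace (z / (z + 1))%C with ((1%R * z + 0%R) / (1%R * z + 1%R))%C by (field; auto).
    apply UHP_moebius; [lra|auto]. }
  assert (c0 : 0 < c).
  { pose proof (f_equal Im E1) as I. rewrite Im_affine, im_mult in I. nra. }
  assert (I : 0 < Im (w1 * v)) by (rewrite im_mult; nra).
  pose proof (f_equal Im E) as J. rewrite Im_affine, im_mult in J. unfold UHP in Hz. nra.
Qed.

Lemma odd_cube_24 d : (d mod 2 = 1)%Z -> exists m, ((1 - d * d) * d = 24 * m)%Z.
Proof.
  intros H. assert (E : exists k, d = (2 * k + 1)%Z).
  { exists (d / 2)%Z. pose proof (Z.div_mod d 2). lia. }
  destruct E as [k ->].
  assert (X : (6 | k * (k + 1) * (2 * k + 1))%Z).
  { apply Z.mod_divide; [lia|].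
    assert (B : (0 <= k mod 6 < 6)%Z) by (apply Z.mod_pos_bound; lia).
    rewrite (Z.div_mod k 6) by lia. set (q := (k / 6)%Z). set (r := (k mod 6)%Z) in *.
    replace ((6 * q + r) * (6 * q + r + 1) * (2 * (6 * q + r) + 1))%Z with
      (r * (r + 1) * (2 * r + 1) + (q * (6 * q + r + 1) * (2 * (6 * q + r) + 1) + r * q * (2 * (6 * q + r) + 1) + r * (r + 1) * 2 * q) * 6)%Z by ring.
    rewrite Z.mod_add by lia.
    assert (D : (r = 0 \/ r = 1 \/ r = 2 \/ r = 3 \/ r = 4 \/ r = 5)%Z) by lia.
    destruct D as [-> | [-> | [-> | [-> | [-> | ->]]]]]; reflexivity. }
  destruct X as [m Hm]. exists (- m)%Z.
  replace ((1 - (2 * k + 1) * (2 * k + 1)) * (2 * k + 1))%Z with (- 4 * (k * (k + 1) * (2 * k + 1)))%Z by ring.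
  rewrite Hm. ring.
Qed.

Lemma affine_csqrt_Re (c d : R) z : 0 < d -> UHP z -> 0 < Re (csqrt (c * z + d)).
Proof.
  intros Hd Hz. apply csqrt_Re_pos. rewrite Im_affine, Re_affine. unfold UHP in Hz.
  destruct (Req_dec c 0) as [->|Hc]; [right; lra|left].
  apply Rmult_integral_contrapositive_currified; lra.
Qed.

(** The exponent changes by (1 - d^2) d (2 a + b) - 1, and 24 divides
    (1 - d^2) d for odd d. *)
Lemma eta_exponent_V a b c d : (a * d - b * c = 1)%Z -> (d mod 2 = 1)%Z -> (0 < d)%Z ->
  e24 (eta_exponent (a + b) b (c + d) d) = (e24 (eta_exponent a b c d) * e24 (-1))%C.
Proof.
  intros D Ho Hp. rewrite <- e24_plus. destruct (odd_cube_24 d Ho) as [m Hm].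
  apply e24_cong with (m * (2 * a + b))%Z. unfold eta_exponent.
  replace (jac (c + d) d) with (jac c d) by (rewrite <- (jac_shift c d 1 Hp); f_equal; ring).
  replace (24 * (m * (2 * a + b)))%Z with ((1 - d * d) * d * (2 * a + b))%Z by (rewrite Hm; ring).
  assert (X : (a * d = 1 + b * c)%Z) by lia.
  replace ((1 - d * d) * d * (2 * a + b))%Z with ((1 - d * d) * (a * d + a * d + b * d))%Z by ring.
  rewrite X at 2. ring.
Qed.

(** An equivalence, so that c may be changed by multiples of d in both
    directions. *)
Lemma eta_rule_V a b c d : (a * d - b * c = 1)%Z -> (d mod 2 = 1)%Z -> (0 < d)%Z ->
  eta_rule a b c d <-> eta_rule (a + b) b (c + d) d.
Proof.
  intros D Ho Hp.
  assert (dR : 0 < IZR d) by now apply (IZR_lt 0).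
  assert (DR : 0 < IZR a * IZR d - IZR b * IZR c).
  { rewrite <- !mult_IZR, <- minus_IZR, D. lra. }
  assert (DR' : 0 < IZR (a + b) * IZR d - IZR b * IZR (c + d)).
  { rewrite !plus_IZR. lra. }
  (* both rules speak of the same value of eta when z' = z / (z + 1) *)
  assert (key : forall z w w1, UHP z ->
     (w1 * w1 = IZR c * (z / (z + 1)) + IZR d)%C -> 0 < Re w1 ->
     (w * w = IZR (c + d) * z + IZR d)%C -> 0 < Re w ->
     ((IZR (a + b) * z + IZR b) / (IZR (c + d) * z + IZR d) =
       (IZR a * (z / (z + 1)) + IZR b) / (IZR c * (z / (z + 1)) + IZR d))%C /\
     (e24 (eta_exponent (a + b) b (c + d) d) * (w * eta z) =
      e24 (eta_exponent a b c d) * (w1 * eta (z / (z + 1))))%C).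
  { intros z w w1 Hz E1 P1 Ew Pw.
    assert (z1 : (z + 1)%C <> 0%C).
    { apply Im_neq_0. rewrite im_plus, im_RtoC. unfold UHP in Hz. lra. }
    pose proof (affine_neq_0 _ _ _ _ z DR' Hz) as N.
    split.
    - rewrite !plus_IZR, !RtoC_plus in *. field. repeat split; auto.
      intros G. apply N. rewrite <- G. ring.
    - set (v := csqrt (z + 1)). assert (Ev : (v * v = z + 1)%C) by apply csqrt_sqr.
      assert (Pv : 0 < Re v) by (apply csqrt_Re_pos; left; rewrite im_plus, im_RtoC; unfold UHP in Hz; lra).
      rewrite plus_IZR in Ew.
      rewrite (V_sqrt _ _ z v w1 w dR Hz Ev Pv E1 P1 Ew Pw).
      rewrite (eta_V z v Hz Ev Pv), eta_exponent_V by assumption. ring. }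
  assert (UV : forall z, UHP z -> UHP (z / (z + 1))).
  { intros z Hz. assert ((z + 1)%C <> 0%C).
    { apply Im_neq_0. rewrite im_plus, im_RtoC. unfold UHP in Hz. lra. }
    replace (z / (z + 1))%C with ((1%R * z + 0%R) / (1%R * z + 1%R))%C by (field; auto).
    apply UHP_moebius; [lra|auto]. }
  split; intros R.
  - intros z w Hz Ew Pw. set (w1 := csqrt (IZR c * (z / (z + 1)) + IZR d)).
    assert (E1 : (w1 * w1 = IZR c * (z / (z + 1)) + IZR d)%C) by apply csqrt_sqr.
    assert (P1 : 0 < Re w1) by (apply affine_csqrt_Re; auto).
    destruct (key z w w1 Hz E1 P1 Ew Pw) as [K1 K2].
    rewrite K1, K2. apply R; auto.
  - intros z w1 Hz E1 P1. set (x := (z / (1 - z))%C).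
    assert (z1 : (1 - z)%C <> 0%C).
    { apply Im_neq_0. rewrite Im_minus, im_RtoC. unfold UHP in Hz. lra. }
    assert (Hx : UHP x).
    { unfold x. replace (z / (1 - z))%C with ((1%R * z + 0%R) / ((-1)%R * z + 1%R))%C.
      - apply UHP_moebius; [lra|auto].
      - field. exact z1. }
    assert (Ex : (x / (x + 1) = z)%C).
    { unfold x. field. split; auto. replace (z + (1 - z))%C with (RtoC 1) by ring. apply C1_nz. }
    set (w := csqrt (IZR (c + d) * x + IZR d)).
    assert (Ew : (w * w = IZR (c + d) * x + IZR d)%C) by apply csqrt_sqr.
    assert (Pw : 0 < Re w) by (apply affine_csqrt_Re; auto).
    rewrite <- Ex in E1. destruct (key x w w1 Hx E1 P1 Ew Pw) as [K1 K2].
    rewrite Ex in K1, K2. rewrite <- K1, <- K2. apply R; auto.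
Qed.

Lemma eta_rule_V_iter k : forall a b c d, (a * d - b * c = 1)%Z -> (d mod 2 = 1)%Z -> (0 < d)%Z ->
  eta_rule a b c d <-> eta_rule (a + k * b) b (c + k * d) d.
Proof.
  assert (N : forall n a b c d, (a * d - b * c = 1)%Z -> (d mod 2 = 1)%Z -> (0 < d)%Z ->
    eta_rule a b c d <-> eta_rule (a + Z.of_nat n * b) b (c + Z.of_nat n * d) d).
  { induction n as [|n IH]; intros a b c d D Ho Hp.
    - simpl. rewrite !Z.add_0_r. tauto.
    - rewrite (IH a b c d D Ho Hp).
      rewrite (eta_rule_V (a + Z.of_nat n * b) b (c + Z.of_nat n * d) d) by (auto; lia).
      replace (a + Z.of_nat (S n) * b)%Z with (a + Z.of_nat n * b + b)%Z by lia.
      replace (c + Z.of_nat (S n) * d)%Z with (c + Z.of_nat n * d + d)%Z by lia. tauto. }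
  intros a b c d D Ho Hp. destruct (Z_le_gt_dec 0 k) as [L|L].
  - rewrite <- (Z2Nat.id k L). now apply N.
  - rewrite (N (Z.to_nat (- k)) (a + k * b)%Z b (c + k * d)%Z d) by (auto; lia).
    rewrite Z2Nat.id by lia.
    replace (a + k * b + - k * b)%Z with a by ring.
    replace (c + k * d + - k * d)%Z with c by ring. tauto.
Qed.

Lemma eta_rule_T b : eta_rule 1 b 0 1.
Proof.
  intros z w Hz Ew Pw.
  assert (W : w = RtoC 1).
  { apply sqr_eq_Re_pos; auto; [rewrite Ew; ring|rewrite re_RtoC; lra]. }
  rewrite W. replace ((IZR 1 * z + IZR b) / (IZR 0 * z + IZR 1))%C with (z + IZR b)%C by field.
  rewrite eta_T by auto. unfold e24. replace (eta_exponent 1 b 0 1) with b.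
  - ring.
  - unfold eta_exponent. change (jac 0 1) with false. cbn [Z.b2z]. ring.
Qed.

Lemma coprime_of_det a b c d : (a * d - b * c = 1)%Z -> Z.gcd c d = 1%Z.
Proof.
  intros D. apply Zgcd_1_rel_prime. apply bezout_rel_prime.
  apply Bezout_intro with (- b)%Z a. lia.
Qed.

Lemma b2z_xorb_cong x y : exists m, (Z.b2z (xorb x y) = Z.b2z x + Z.b2z y + 2 * m)%Z.
Proof.
  destruct x, y; simpl;
    [exists (-1)%Z|exists 0%Z|exists 0%Z|exists 0%Z]; reflexivity.
Qed.

Lemma b2z_odd_cong n : exists m, (Z.b2z (Z.odd n) = n + 2 * m)%Z.
Proof.
  exists (- (n / 2))%Z. pose proof (Z.div_mod n 2 ltac:(lia)). pose proof (Zmod_odd n).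
  destruct (Z.odd n); cbn [Z.b2z]; lia.
Qed.

(** Exchanging the two entries of an odd bottom row costs a square root of i
    and a reciprocity law. *)
Lemma eta_rule_S_neg a b c d : (a * d - b * c = 1)%Z -> (c mod 2 = 1)%Z -> (d mod 2 = 1)%Z ->
  (0 < d)%Z -> (c < 0)%Z -> eta_rule b (- a) d (- c) -> eta_rule a b c d.
Proof.
  intros D Oc Od Hd Hc R z w Hz Ew Pw.
  pose proof (UHP_neq_0 z Hz) as z0.
  assert (DR : 0 < IZR a * IZR d - IZR b * IZR c).
  { rewrite <- !mult_IZR, <- minus_IZR, D. lra. }
  pose proof (affine_neq_0 _ _ _ _ z DR Hz) as N.
  set (s := csqrt z). assert (Es : (s * s = z)%C) by apply csqrt_sqr.
  assert (Ps : 0 < Re s) by (apply csqrt_Re_pos; left; unfold UHP in Hz; lra).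
  pose proof (UHP_S z Hz) as Hz'.
  set (w' := csqrt (IZR d * (- / z) + IZR (- c))).
  assert (Ew' : (w' * w' = IZR d * (- / z) + IZR (- c))%C) by apply csqrt_sqr.
  assert (Pw' : 0 < Re w').
  { apply affine_csqrt_Re; auto. apply (IZR_lt 0). lia. }
  specialize (R (- / z)%C w' Hz' Ew' Pw').
  replace ((IZR a * z + IZR b) / (IZR c * z + IZR d))%C with
    ((IZR b * - / z + IZR (- a)) / (IZR d * - / z + IZR (- c)))%C.
  2: { rewrite !opp_IZR, !RtoC_opp. field. repeat split; auto.
       intros G. apply N. replace (IZR c * z + IZR d)%C with (- (IZR d * -1 + - IZR c * z))%C by ring.
       rewrite G. ring. }
  rewrite R, (eta_S z s Hz Es Ps).
  assert (U' : UHP (IZR d * - / z + IZR (- c))).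
  { unfold UHP in *. rewrite Im_affine. apply Rmult_lt_0_compat; auto. now apply (IZR_lt 0). }
  pose proof (Im_pos_of_sqr s z Hz Es Ps) as Is. pose proof (Im_pos_of_sqr w' _ U' Ew' Pw') as Iw.
  assert (E : w = (- Ci * (w' * s))%C).
  { apply sqr_eq_Re_pos; auto.
    - replace (- Ci * (w' * s) * (- Ci * (w' * s)))%C with (Ci * Ci * (w' * w') * (s * s))%C by ring.
      rewrite Ew, Ci_sq, Ew', Es, opp_IZR, RtoC_opp. field. auto.
    - replace (- Ci * (w' * s))%C with (- ((w' * s) * Ci))%C by ring.
      rewrite re_opp, re_mult_Ci, im_mult. nra. }
  rewrite E, <- e24_m3.
  rewrite <- e24_m6.
  cut (e24 (eta_exponent b (- a) d (- c)) * e24 (-3) = e24 (eta_exponent a b c d) * e24 (-6))%C.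
  { intros X. transitivity ((e24 (eta_exponent b (- a) d (- c)) * e24 (-3)) * (w' * (s * eta z)))%C; [ring|].
    rewrite X. ring. }
  rewrite <- !e24_plus.
  pose proof (coprime_of_det a b c d D) as G.
  assert (G' : Z.gcd (- c) d = 1%Z) by (rewrite Z.gcd_opp_l; exact G).
  assert (Oc' : ((- c) mod 2 = 1)%Z) by (clear -Oc; Z.to_euclidean_division_equations; lia).
  pose proof (jac_opp (- c) d G' Od Hd) as J1. rewrite Z.opp_involutive in J1.
  pose proof (jac_reciprocity (- c) d G' Oc' Od ltac:(lia) Hd) as J2.
  set (h := ((d - 1) / 2)%Z) in *. set (k := ((- c - 1) / 2)%Z) in *.
  assert (Eh : (d = 2 * h + 1)%Z) by (unfold h; clear -Od; Z.to_euclidean_division_equations; lia).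
  assert (Ek : (- c = 2 * k + 1)%Z) by (unfold k; clear -Oc'; Z.to_euclidean_division_equations; lia).
  destruct (b2z_xorb_cong (Z.odd h) (jac (- c) d)) as [m1 M1]. rewrite <- J1 in M1.
  destruct (b2z_xorb_cong (jac (- c) d) (jac d (- c))) as [m2 M2]. rewrite J2 in M2.
  destruct (b2z_odd_cong h) as [m3 M3]. destruct (b2z_odd_cong (k * h)) as [m4 M4].
  clearbody h k.
  apply (e24_cong _ _ (m4 - h - Z.b2z (jac (- c) d) - m2 - m1 - m3)).
  unfold eta_exponent. rewrite M1, M3.
  replace (Z.b2z (jac d (- c))) with (k * h + 2 * m4 - Z.b2z (jac (- c) d) - 2 * m2)%Z by lia.
  generalize (Z.b2z (jac (- c) d)). intros j.
  assert (C' : (c = - (2 * k + 1))%Z) by lia. clear -D C' Eh. subst c d.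
  apply Z.sub_move_0_r.
  transitivity ((1 - (a * (2 * h + 1) - b * - (2 * k + 1))) * ((2 * h + 1) * (2 * k + 1)))%Z; [ring|].
  rewrite D. ring.
Qed.

Lemma eta_rule_S_pos a b c d : (a * d - b * c = 1)%Z -> (c mod 2 = 1)%Z -> (d mod 2 = 1)%Z ->
  (0 < d)%Z -> (0 < c)%Z -> eta_rule (- b) a (- d) c -> eta_rule a b c d.
Proof.
  intros D Oc Od Hd Hc R z w Hz Ew Pw.
  pose proof (UHP_neq_0 z Hz) as z0.
  assert (DR : 0 < IZR a * IZR d - IZR b * IZR c).
  { rewrite <- !mult_IZR, <- minus_IZR, D. lra. }
  pose proof (affine_neq_0 _ _ _ _ z DR Hz) as N.
  set (s := csqrt z). assert (Es : (s * s = z)%C) by apply csqrt_sqr.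
  assert (Ps : 0 < Re s) by (apply csqrt_Re_pos; left; unfold UHP in Hz; lra).
  pose proof (UHP_S z Hz) as Hz'.
  set (w' := csqrt (IZR (- d) * (- / z) + IZR c)).
  assert (Ew' : (w' * w' = IZR (- d) * (- / z) + IZR c)%C) by apply csqrt_sqr.
  assert (Pw' : 0 < Re w').
  { apply affine_csqrt_Re; auto. now apply (IZR_lt 0). }
  specialize (R (- / z)%C w' Hz' Ew' Pw').
  replace ((IZR a * z + IZR b) / (IZR c * z + IZR d))%C with
    ((IZR (- b) * - / z + IZR a) / (IZR (- d) * - / z + IZR c))%C.
  2: { rewrite !opp_IZR, !RtoC_opp. field. repeat split; auto. }
  rewrite R, (eta_S z s Hz Es Ps).
  assert (U' : 0 < - Im (w' * w')).
  { rewrite Ew', Im_affine, opp_IZR. unfold UHP in Hz'.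
    assert (0 < IZR d) by now apply (IZR_lt 0). nra. }
  pose proof (Im_pos_of_sqr s z Hz Es Ps) as Is.
  assert (Iw : Im w' < 0) by (rewrite im_mult in U'; nra).
  assert (E : w = (w' * s)%C).
  { apply sqr_eq_Re_pos; auto.
    - replace (w' * s * (w' * s))%C with ((w' * w') * (s * s))%C by ring.
      rewrite Ew, Ew', Es, opp_IZR, RtoC_opp. field. auto.
    - rewrite re_mult. nra. }
  rewrite E, <- e24_m3.
  cut (e24 (eta_exponent (- b) a (- d) c) * e24 (-3) = e24 (eta_exponent a b c d))%C.
  { intros X. rewrite <- X. ring. }
  rewrite <- !e24_plus.
  pose proof (coprime_of_det a b c d D) as G.
  assert (G' : Z.gcd d c = 1%Z) by (rewrite Z.gcd_comm; exact G).
  pose proof (jac_opp d c G' Oc Hc) as J1.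
  pose proof (jac_reciprocity c d G Oc Od Hc Hd) as J2.
  set (h := ((d - 1) / 2)%Z) in *. set (k := ((c - 1) / 2)%Z) in *.
  assert (Eh : (d = 2 * h + 1)%Z) by (unfold h; clear -Od; Z.to_euclidean_division_equations; lia).
  assert (Ek : (c = 2 * k + 1)%Z) by (unfold k; clear -Oc; Z.to_euclidean_division_equations; lia).
  destruct (b2z_xorb_cong (Z.odd k) (jac d c)) as [m1 M1]. rewrite <- J1 in M1.
  destruct (b2z_xorb_cong (jac c d) (jac d c)) as [m2 M2]. rewrite J2 in M2.
  destruct (b2z_odd_cong k) as [m3 M3]. destruct (b2z_odd_cong (k * h)) as [m4 M4].
  clearbody h k.
  apply (e24_cong _ _ (k * h + k + m1 + m3 + m4 - m2 - Z.b2z (jac c d))).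
  unfold eta_exponent. rewrite M1, M3.
  replace (Z.b2z (jac d c)) with (k * h + 2 * m4 - Z.b2z (jac c d) - 2 * m2)%Z by lia.
  generalize (Z.b2z (jac c d)). intros j.
  clear -D Eh Ek. subst c d.
  apply Z.sub_move_0_r.
  transitivity (((a * (2 * h + 1) - b * (2 * k + 1)) - 1) * ((2 * h + 1) * (2 * k + 1)))%Z; [ring|].
  rewrite D. ring.
Qed.

(** Descent on d: powers of (1 0; 1 1) make the lower left
    entry odd and smaller than d, and the inversion then exchanges the two. *)
Theorem eta_multiplier a b c d : (a * d - b * c = 1)%Z -> (d mod 2 = 1)%Z -> (0 < d)%Z ->
  eta_rule a b c d.
Proof.
  intros D Od Hd. revert a b c D.
  pattern d. refine (Z_lt_induction (fun d => (d mod 2 = 1)%Z -> (0 < d)%Z -> forall a b c, (a * d - b * c = 1)%Z -> eta_rule a b c d) _ d _ Od Hd); [|lia].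
  clear d Od Hd. intros d IH Od Hd a b c D.
  destruct (Z.eq_dec d 1) as [->|Nd].
  - apply (eta_rule_V_iter (- c) a b c 1 D Od Hd).
    replace (c + - c * 1)%Z with 0%Z by ring. replace (a + - c * b)%Z with 1%Z by lia.
    apply eta_rule_T.
  - assert (Hk : exists k, ((c + k * d) mod 2 = 1 /\ - d < c + k * d < d)%Z).
    { pose proof (Z.div_mod c d ltac:(lia)) as E. pose proof (Z.mod_pos_bound c d Hd) as B.
      destruct (Z.eq_dec ((c mod d) mod 2) 1) as [O|O].
      - exists (- (c / d))%Z. replace (c + - (c / d) * d)%Z with (c mod d)%Z by lia. lia.
      - exists (- (c / d) - 1)%Z. replace (c + (- (c / d) - 1) * d)%Z with (c mod d - d)%Z by lia.
        assert (c mod d <> 0)%Z.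
        { intros Z0. apply Z.mod_divide in Z0; [|lia]. pose proof (coprime_of_det a b c d D) as G.
          apply Z.divide_gcd_iff in Z0; [|lia]. rewrite Z.gcd_comm in Z0. lia. }
        split; [|lia]. clear -O Od. set (r := (c mod d)%Z) in *. clearbody r.
        Z.to_euclidean_division_equations; lia. }
    destruct Hk as [k [Ok Bk]].
    apply (eta_rule_V_iter k a b c d D Od Hd).
    assert (D' : ((a + k * b) * d - b * (c + k * d) = 1)%Z) by lia.
    set (a' := (a + k * b)%Z) in *. set (c' := (c + k * d)%Z) in *. clearbody a' c'.
    destruct (Z_lt_le_dec c' 0) as [L|L].
    + apply eta_rule_S_neg; auto. apply IH; try lia.
      clear -Ok. Z.to_euclidean_division_equations; lia.
    + assert (c' <> 0)%Z by (intros ->; discriminate).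
      apply eta_rule_S_pos; auto; [lia|]. apply IH; lia.
Qed.

(** * The transformation of the eta product *)

Lemma comm_monoid_Cmult : comm_monoid Cmult 1%C.
Proof. repeat split; intros; ring. Qed.

Lemma comm_monoid_Rmult : comm_monoid Rmult 1.
Proof. repeat split; intros; ring. Qed.

Definition eta_prod (ps : list nat) (z : C) : C :=
  iter_op Cmult 1%C (divs ps) (fun v => eta (INR v * z)).

Lemma DeltaN_eta_prod r ps z : distinct_primes ps ->
  DeltaN r (prod_list ps) z = (eta_prod ps z ^ ellN r (prod_list ps))%C.
Proof.
  intros H. unfold DeltaN, eta_prod.
  rewrite <- (iter_op_Permutation _ _ _ _ _ comm_monoid_Cmult (divisors_Permutation ps H)).
  f_equal. generalize (divisors (prod_list ps)). unfold iter_op.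
  induction l as [|v l IH]; simpl; [reflexivity|]. now rewrite IH.
Qed.

Lemma iter_Cmult_const l c : iter_op Cmult 1%C l (fun _ => c) = (c ^ length l)%C.
Proof. unfold iter_op. induction l as [|x l IH]; simpl; [reflexivity|]. now rewrite IH. Qed.

Lemma iter_Cmult_RtoC l F : iter_op Cmult 1%C l (fun v => RtoC (F v)) = RtoC (iter_op Rmult 1 l F).
Proof. unfold iter_op. induction l as [|x l IH]; simpl; [reflexivity|]. now rewrite IH, RtoC_mult. Qed.

Lemma iter_Cmult_e24 l F : iter_op Cmult 1%C l (fun v => e24 (F v)) = e24 (iter_op Z.add 0%Z l F).
Proof.
  unfold iter_op. induction l as [|x l IH]; simpl; [symmetry; apply e24_0|]. now rewrite IH, e24_plus.
Qed.

Lemma e24_pow k n : (e24 k ^ n)%C = e24 (Z.of_nat n * k).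
Proof.
  induction n as [|n IH]; [symmetry; apply e24_0|].
  rewrite Cpow_S, IH, <- e24_plus. f_equal. lia.
Qed.

Definition sqrt_prod (ps : list nat) : R := iter_op Rmult 1 (divs ps) (fun v => sqrt (INR v)).

Lemma iter_Rmult_const l c : iter_op Rmult 1 l (fun _ => c) = c ^ length l.
Proof. unfold iter_op. induction l as [|x l IH]; simpl; [reflexivity|]. now rewrite IH. Qed.

(** The product of the divisors of N is N^(tau(N)/2); the fourth power avoids both
    the square roots and a case distinction on the parity of tau(N). *)
Lemma sqrt_prod_pow4 ps : 0 <= sqrt_prod ps /\ sqrt_prod ps ^ 4 = INR (prod_list ps) ^ (2 ^ length ps).
Proof.
  unfold sqrt_prod. induction ps as [|p ps [IH0 IH]].
  - unfold iter_op. simpl. rewrite sqrt_1. lra.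
  - cbn [divs]. rewrite iter_op_app, iter_op_map by apply comm_monoid_Rmult.
    rewrite (iter_op_ext _ _ _ (fun v => sqrt (INR (p * v))) (fun v => sqrt (INR p) * sqrt (INR v)))
      by (intros; rewrite mult_INR, sqrt_mult by apply pos_INR; reflexivity).
    rewrite iter_op_op by apply comm_monoid_Rmult. rewrite iter_Rmult_const, length_divs.
    set (X := iter_op Rmult 1 (divs ps) (fun v => sqrt (INR v))) in *.
    pose proof (sqrt_pos (INR p)) as S0. split.
    + repeat apply Rmult_le_pos; auto. now apply pow_le.
    + cbn [prod_list fold_right length]. fold (prod_list ps).
      rewrite mult_INR, !Rpow_mult_distr, <- !pow_mult, IH.
      replace (2 ^ length ps * 4)%nat with (2 * 2 ^ S (length ps))%nat by (simpl; lia).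
      rewrite (pow_mult (sqrt (INR p))). simpl (sqrt (INR p) ^ 2).
      rewrite Rmult_1_r, sqrt_sqrt by apply pos_INR.
      replace (2 ^ S (length ps))%nat with (2 ^ length ps + 2 ^ length ps)%nat by (simpl; lia).
      rewrite !pow_add. ring.
Qed.

Lemma pow4_inj x y : 0 <= x -> 0 <= y -> x ^ 4 = y ^ 4 -> x = y.
Proof.
  intros Hx Hy E. apply Rsqr_inj; auto. apply Rsqr_inj; try apply Rle_0_sqr.
  unfold Rsqr. simpl in E. lra.
Qed.

(** ** The sum of the exponents *)

Lemma divsumZ_linear ps (K1 K2 K3 : Z) (j : nat -> Z) : distinct_primes ps ->
  divsumZ ps (fun y => K1 * Z.of_nat (prod_list ps / y) + K2 * Z.of_nat y + K3 + 12 * j y)%Z =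
  ((K1 + K2) * divsumZ ps Z.of_nat + K3 * 2 ^ Z.of_nat (length ps) + 12 * divsumZ ps j)%Z.
Proof.
  intros H. unfold divsumZ.
  rewrite (iter_op_op Z.add 0%Z _ (fun y => K1 * Z.of_nat (prod_list ps / y) + K2 * Z.of_nat y + K3)%Z) by apply comm_monoid_Zadd.
  rewrite (iter_op_op Z.add 0%Z _ (fun y => K1 * Z.of_nat (prod_list ps / y) + K2 * Z.of_nat y)%Z) by apply comm_monoid_Zadd.
  rewrite iter_op_op by apply comm_monoid_Zadd.
  rewrite iter_Zadd_const, !iter_Zadd_scal, length_divs.
  rewrite (iter_op_divs_compl Z.add 0%Z ps Z.of_nat comm_monoid_Zadd H).
  rewrite Nat2Z.inj_pow. change (Z.of_nat 2) with 2%Z. ring.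
Qed.

Lemma iter_Zadd_swap l l' (F : nat -> nat -> Z) :
  iter_op Z.add 0%Z l (fun x => iter_op Z.add 0%Z l' (F x)) =
  iter_op Z.add 0%Z l' (fun y => iter_op Z.add 0%Z l (fun x => F x y)).
Proof.
  induction l as [|x l IH].
  - unfold iter_op at 1. simpl. induction l' as [|y l' IH]; [reflexivity|]. unfold iter_op in *. simpl in *. lia.
  - change (iter_op Z.add 0%Z l' (F x) + iter_op Z.add 0%Z l (fun x => iter_op Z.add 0%Z l' (F x)) =
      iter_op Z.add 0%Z l' (fun y => F x y + iter_op Z.add 0%Z l (fun x => F x y)))%Z.
    rewrite IH, <- iter_op_op by apply comm_monoid_Zadd. reflexivity.
Qed.

Lemma iter_Zadd_even l (F : nat -> Z) : (forall x, In x l -> exists m, F x = (2 * m)%Z) ->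
  exists m, iter_op Z.add 0%Z l F = (2 * m)%Z.
Proof.
  induction l as [|x l IH]; intros H; [exists 0%Z; reflexivity|].
  destruct IH as [m Hm]; [intros; apply H; simpl; auto|].
  destruct (H x (or_introl eq_refl)) as [k Hk]. unfold iter_op in *. cbn [fold_right].
  exists (k + m)%Z. lia.
Qed.

Lemma mod2_mul_l a b : ((a * b) mod 2 = 1 -> a mod 2 = 1)%Z.
Proof.
  rewrite !Zmod_odd, Z.odd_mul. destruct (Z.odd a); simpl; auto.
Qed.

Lemma coprime_divisors u v x y : Z.gcd x y = 1%Z -> (u | x)%Z -> (v | y)%Z -> Z.gcd u v = 1%Z.
Proof.
  intros H [k ->] [l ->]. rewrite Z.mul_comm in H. apply coprime_factor_r in H.
  rewrite Z.gcd_comm in H. apply coprime_factor_l in H. now rewrite Z.gcd_comm.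
Qed.

Lemma in_divs_Z ps v : distinct_primes ps -> In v (divs ps) ->
  (Z.of_nat v | Z.of_nat (prod_list ps))%Z /\ (0 < Z.of_nat v)%Z /\
  (Z.of_nat (prod_list ps / v) * Z.of_nat v = Z.of_nat (prod_list ps))%Z.
Proof.
  intros H D. pose proof (divs_pos ps v H D). apply in_divs in D; auto.
  repeat split; [now apply divide_Z_nat|lia|].
  destruct D as [k ->]. rewrite Nat.div_mul by lia. lia.
Qed.

(** One of f and g has at least two prime factors.  If it is g, the symbols
    cancel for each x by multiplicativity in the top; if it is f, for each y by
    multiplicativity in the bottom. *)
Lemma jac_cancels fs gs (c d : Z) :
  distinct_primes fs -> distinct_primes gs -> (3 <= length fs + length gs)%nat ->
  (0 < d)%Z -> ((d * Z.of_nat (prod_list fs)) mod 2 = 1)%Z ->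
  Z.gcd (c * Z.of_nat (prod_list gs)) (d * Z.of_nat (prod_list fs)) = 1%Z ->
  exists m, divsumZ fs (fun x => divsumZ gs (fun y =>
    Z.b2z (jac (c * Z.of_nat (prod_list gs / y)) (d * Z.of_nat x)))) = (2 * m)%Z.
Proof.
  intros Hf Hg L Hd Ho Hc. set (f := Z.of_nat (prod_list fs)) in *. set (g := Z.of_nat (prod_list gs)) in *.
  assert (DX : forall x, In x (divs fs) -> (0 < d * Z.of_nat x)%Z /\ ((d * Z.of_nat x) mod 2 = 1)%Z /\ (d * Z.of_nat x | d * f)%Z).
  { intros x Hx. destruct (in_divs_Z fs x Hf Hx) as [[k D] [P _]]. fold f in D. repeat split; [nia| |].
    - apply mod2_mul_l with k. rewrite <- Ho, D. f_equal. ring.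
    - exists k. rewrite D. ring. }
  destruct (le_lt_dec 2 (length gs)) as [G|G].
  - apply iter_Zadd_even. intros x Hx. destruct (DX x Hx) as [P [O D]].
    unfold divsumZ.
    rewrite (iter_op_divs_compl Z.add 0%Z gs (fun y => Z.b2z (jac (c * Z.of_nat y) (d * Z.of_nat x))) comm_monoid_Zadd Hg).
    assert (M : forall p v, Nat.divide (p * v) (prod_list gs) ->
      jac (c * Z.of_nat (p * v)) (d * Z.of_nat x) = xorb (jac (Z.of_nat p) (d * Z.of_nat x)) (jac (c * Z.of_nat v) (d * Z.of_nat x))).
    { intros p v Q. apply divide_Z_nat in Q. fold g in Q. rewrite Nat2Z.inj_mul in Q |- *. destruct Q as [k Q].
      replace (c * (Z.of_nat p * Z.of_nat v))%Z with (Z.of_nat p * (c * Z.of_nat v))%Z by ring.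
      apply jac_mul_top; auto; apply (coprime_divisors _ _ _ _ Hc); auto.
      - exists (c * k * Z.of_nat v)%Z. rewrite Q. ring.
      - exists (k * Z.of_nat p)%Z. rewrite Q. ring. }
    destruct gs as [|p [|q gs]]; [simpl in G; lia|simpl in G; lia|].
    pose proof (distinct_primes_tail _ _ Hg) as Hg'. pose proof (distinct_primes_tail _ _ Hg') as Hg''.
    apply (sign_cancels p q gs (fun y => jac (c * Z.of_nat y) (d * Z.of_nat x))
       (jac (Z.of_nat p) (d * Z.of_nat x)) (jac (Z.of_nat q) (d * Z.of_nat x))).
    + intros v Hv. apply M. apply in_divs in Hv; auto.
      apply (Nat.mul_divide_mono_l _ _ p). exact Hv.
    + intros v Hv. apply M. apply in_divs in Hv; auto.
      apply Nat.divide_mul_r. apply (Nat.mul_divide_mono_l _ _ q). exact Hv.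
  - unfold divsumZ. rewrite iter_Zadd_swap. apply iter_Zadd_even. intros y Hy.
    destruct (in_divs_Z gs y Hg Hy) as [_ [Py Ey]]. fold g in Ey. set (y' := Z.of_nat (prod_list gs / y)) in *.
    assert (M : forall p v, Nat.divide (p * v) (prod_list fs) -> (0 < p)%nat -> (0 < v)%nat ->
      jac (c * y') (d * Z.of_nat (p * v)) = xorb (jac (c * y') (Z.of_nat p)) (jac (c * y') (d * Z.of_nat v))).
    { intros p v Q Pp Pv. apply divide_Z_nat in Q. fold f in Q. rewrite Nat2Z.inj_mul in Q |- *. destruct Q as [k Q].
      replace (d * (Z.of_nat p * Z.of_nat v))%Z with (Z.of_nat p * (d * Z.of_nat v))%Z by ring.
      apply jac_mul_bottom; try nia.
      - apply (coprime_divisors _ _ _ _ Hc).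
        + exists (Z.of_nat y). rewrite <- Ey. ring.
        + exists k. rewrite Q. ring.
      - apply mod2_mul_l with (d * k * Z.of_nat v)%Z. rewrite <- Ho, Q. f_equal. ring.
      - apply mod2_mul_l with (k * Z.of_nat p)%Z. rewrite <- Ho, Q. f_equal. ring. }
    destruct fs as [|p [|q fs]]; [simpl in L; lia|simpl in L; lia|].
    pose proof (distinct_primes_tail _ _ Hf) as Hf'. pose proof (distinct_primes_tail _ _ Hf') as Hf''.
    destruct (distinct_primes_head _ _ Hf) as [Pp _]. destruct (distinct_primes_head _ _ Hf') as [Pq _].
    apply prime_nat_gt_1 in Pp, Pq.
    apply (sign_cancels p q fs (fun x => jac (c * y') (d * Z.of_nat x))
       (jac (c * y') (Z.of_nat p)) (jac (c * y') (Z.of_nat q))).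
    + intros v Hv. apply M; [|lia|now apply (divs_pos (q :: fs))].
      apply in_divs in Hv; auto. apply (Nat.mul_divide_mono_l _ _ p). exact Hv.
    + intros v Hv. apply M; [|lia|now apply (divs_pos fs)]. apply in_divs in Hv; auto.
      apply Nat.divide_mul_r. apply (Nat.mul_divide_mono_l _ _ q). exact Hv.
Qed.

Definition total_exponent (fs gs : list nat) (a b c d : Z) : Z :=
  divsumZ fs (fun x => divsumZ gs (fun y =>
    eta_exponent (a * Z.of_nat (prod_list fs / x)) (b * Z.of_nat y)
      (c * Z.of_nat (prod_list gs / y)) (d * Z.of_nat x))).

(** This is where the value of ell enters.  The sum of the exponents has three
    parts: a multiple of sigma(N), cancelled because 24 divides ell sigma(N);
    three times d sigma(f) tau(g) - tau(N), a multiple of 2^r, cancelled because 8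
    divides ell 2^r; and twelve times the number of negative symbols, which is
    even unless ell is. *)
Lemma total_exponent_24 fs gs (a b c d : Z) :
  distinct_primes (fs ++ gs) -> (0 < d)%Z ->
  (Z.of_nat (prod_list fs) * a * d - b * (c * Z.of_nat (prod_list gs)) = 1)%Z ->
  ((d * Z.of_nat (prod_list fs)) mod 2 = 1)%Z ->
  exists m, (Z.of_nat (ellN (length (fs ++ gs)) (prod_list (fs ++ gs))) * total_exponent fs gs a b c d = 24 * m)%Z.
Proof.
  intros H Hd D Ho. destruct (distinct_primes_app _ _ H) as [Hf Hg].
  destruct (weight_facts _ H) as [h [_ [[h' Eh] [E4 [[n En] [Odd _]]]]]].
  set (l := ellN (length (fs ++ gs)) (prod_list (fs ++ gs))) in *.
  pose proof (sigma_divs _ H) as Es. rewrite divsumZ_app in Es.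
  set (f := Z.of_nat (prod_list fs)) in *. set (g := Z.of_nat (prod_list gs)) in *.
  set (J := fun x y => Z.b2z (jac (c * Z.of_nat (prod_list gs / y)) (d * Z.of_nat x))).
  assert (Inner : forall x, In x (divs fs) -> divsumZ gs (fun y =>
    eta_exponent (a * Z.of_nat (prod_list fs / x)) (b * Z.of_nat y)
      (c * Z.of_nat (prod_list gs / y)) (d * Z.of_nat x)) =
    ((a * c * divsumZ gs Z.of_nat) * Z.of_nat (prod_list fs / x) +
     ((- a * c * d * d * f - d * c + d * b) * divsumZ gs Z.of_nat + 3 * d * 2 ^ Z.of_nat (length gs)) * Z.of_nat x +
     (- 3 * 2 ^ Z.of_nat (length gs)) + 12 * divsumZ gs (J x))%Z).
  { intros x Hx. destruct (in_divs_Z fs x Hf Hx) as [_ [_ Ex]]. fold f in Ex.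
    set (x' := Z.of_nat (prod_list fs / x)) in *.
    rewrite <- Ex.
    unfold divsumZ at 1.
    rewrite (iter_op_ext _ _ _ _ (fun y =>
      (a * x' * c * (1 - (d * Z.of_nat x) * (d * Z.of_nat x)) - d * Z.of_nat x * c) * Z.of_nat (prod_list gs / y) +
      (d * Z.of_nat x * b) * Z.of_nat y + (3 * (d * Z.of_nat x - 1)) + 12 * J x y)%Z).
    - change (iter_op Z.add 0%Z (divs gs) ?F) with (divsumZ gs F). rewrite divsumZ_linear by exact Hg. ring.
    - intros y Hy. unfold eta_exponent, J. ring. }
  assert (Tot : total_exponent fs gs a b c d =
    ((a * c + - a * c * d * d * f - d * c + d * b) * (divsumZ fs Z.of_nat * divsumZ gs Z.of_nat)
     + 3 * 2 ^ Z.of_nat (length gs) * (d * divsumZ fs Z.of_nat - 2 ^ Z.of_nat (length fs))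
     + 12 * divsumZ fs (fun x => divsumZ gs (J x)))%Z).
  { unfold total_exponent. unfold divsumZ at 1. rewrite (iter_op_ext _ _ _ _ _ Inner).
    change (iter_op Z.add 0%Z (divs fs) ?F) with (divsumZ fs F). rewrite divsumZ_linear by exact Hf. ring. }
  rewrite Tot, <- Es.
  assert (P1 : (Z.of_nat l * Z.of_nat (Defs.sigma (prod_list (fs ++ gs))) = 24 * Z.of_nat n)%Z) by lia.
  assert (P2 : (2 ^ Z.of_nat (length fs) * 2 ^ Z.of_nat (length gs) * Z.of_nat l = 8 * Z.of_nat h')%Z).
  { rewrite <- Z.pow_add_r by lia. rewrite <- Nat2Z.inj_add, <- length_app.
    change 2%Z with (Z.of_nat 2). rewrite <- Nat2Z.inj_pow. lia. }
  assert (P3 : exists m, (Z.of_nat l * divsumZ fs (fun x => divsumZ gs (J x)) = 2 * m)%Z).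
  { destruct Odd as [[k Ev]|L3].
    - exists (Z.of_nat k * divsumZ fs (fun x => divsumZ gs (J x)))%Z. rewrite Ev. lia.
    - destruct (jac_cancels fs gs c d Hf Hg) as [m Hm]; auto.
      + rewrite <- length_app. exact L3.
      + fold f g. apply Zgcd_1_rel_prime, bezout_rel_prime. apply Bezout_intro with (- b)%Z a. lia.
      + exists (Z.of_nat l * m)%Z. unfold J. rewrite Hm. ring. }
  destruct P3 as [m3 P3].
  destruct (pow2_divide_sigma fs) as [F' EF].
  { intros p Hp. assert (Q : Nat.divide p (prod_list fs)).
    { clear - Hp. induction fs as [|q fs IH]; [contradiction|]. simpl. destruct Hp as [->|Hp].
      - apply Nat.divide_factor_l.
      - apply Nat.divide_mul_r, IH, Hp. }
    apply divide_Z_nat in Q. fold f in Q. destruct Q as [k Q].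
    assert (X : (Z.of_nat p mod 2 = 1)%Z) by (apply mod2_mul_l with (d * k)%Z; rewrite <- Ho, Q; f_equal; ring).
    change 2%Z with (Z.of_nat 2) in X. rewrite <- Nat2Z.inj_mod in X. lia. }
  rewrite EF.
  set (K := (a * c + - a * c * d * d * f - d * c + d * b)%Z).
  exists (K * Z.of_nat n + Z.of_nat h' * (d * F' - 1) + m3)%Z.
  set (S := Z.of_nat (Defs.sigma (prod_list (fs ++ gs)))) in *.
  set (T := divsumZ fs (fun x => divsumZ gs (J x))) in *.
  set (A := (2 ^ Z.of_nat (length fs))%Z) in *. set (B := (2 ^ Z.of_nat (length gs))%Z) in *.
  replace (Z.of_nat l * (K * S + 3 * B * (d * (F' * A) - A) + 12 * T))%Z with
    (K * (Z.of_nat l * S) + 3 * (A * B * Z.of_nat l) * (d * F' - 1) + 12 * (Z.of_nat l * T))%Z by ring.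
  rewrite P1, P2, P3. ring.
Qed.

Lemma eta_prod_app fs gs z : eta_prod (fs ++ gs) z =
  iter_op Cmult 1%C (divs fs) (fun x => iter_op Cmult 1%C (divs gs) (fun y => eta (INR (x * y) * z)%C)).
Proof. unfold eta_prod. now rewrite iter_op_divs_app by apply comm_monoid_Cmult. Qed.

Lemma sqrt_prod_power ps (t l h : nat) : (2 ^ length ps * 2 ^ t * l = 4 * h)%nat ->
  (sqrt_prod ps ^ (2 ^ t)) ^ l = INR (prod_list ps) ^ h.
Proof.
  intros E. destruct (sqrt_prod_pow4 ps) as [P0 P4].
  apply pow4_inj; [repeat apply pow_le; auto|apply pow_le, pos_INR|].
  transitivity ((sqrt_prod ps ^ 4) ^ (2 ^ t * l)).
  - rewrite <- !pow_mult. f_equal. lia.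
  - rewrite P4, <- !pow_mult. f_equal. lia.
Qed.

(** With f = prod fs and g = N / f, the matrix (f a, b; N c, f d) / sqrt f sends
    v = (f / x) y to a multiplier of SL(2, Z) applied to x y z. *)
Lemma eta_prod_transform fs gs (a b c d : Z) z :
  distinct_primes (fs ++ gs) -> (0 < d)%Z ->
  (Z.of_nat (prod_list fs) * a * d - b * (c * Z.of_nat (prod_list gs)) = 1)%Z ->
  ((d * Z.of_nat (prod_list fs)) mod 2 = 1)%Z -> UHP z ->
  let f := INR (prod_list fs) in let N := INR (prod_list (fs ++ gs)) in
  let j := (RtoC (N * IZR c) * z + RtoC (f * IZR d))%C in
  eta_prod (fs ++ gs) ((RtoC (f * IZR a) * z + IZR b) / j) =
    (e24 (total_exponent fs gs a b c d) *
     ((csqrt j / sqrt f) ^ 2 ^ length (fs ++ gs) * RtoC (sqrt_prod fs ^ 2 ^ length gs))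
     * eta_prod (fs ++ gs) z)%C.
Proof.
  intros H Hd D Ho Hz f N j. destruct (distinct_primes_app _ _ H) as [Hf Hg].
  pose proof (prod_list_pos fs Hf) as f0. pose proof (prod_list_pos gs Hg) as g0.
  assert (F0 : 0 < f) by (apply lt_0_INR; lia).
  assert (G0 : 0 < INR (prod_list gs)) by (apply lt_0_INR; lia).
  assert (EN : N = f * INR (prod_list gs)) by (unfold N, f; rewrite prod_list_app; apply mult_INR).
  assert (D0 : 0 < IZR d) by now apply (IZR_lt 0).
  rewrite !eta_prod_app.
  rewrite <- (iter_op_divs_compl Cmult 1%C fs _ comm_monoid_Cmult Hf).
  set (W := (csqrt j / sqrt f)%C).
  assert (S0 : 0 < sqrt f) by now apply sqrt_lt_R0.
  assert (SC : RtoC (sqrt f) <> 0%C) by (intro E; apply RtoC_inj in E; lra).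
  assert (Term : forall x y, In x (divs fs) -> In y (divs gs) ->
    eta (INR (prod_list fs / x * y) * ((RtoC (f * IZR a) * z + IZR b) / j))%C =
    (e24 (eta_exponent (a * Z.of_nat (prod_list fs / x)) (b * Z.of_nat y)
      (c * Z.of_nat (prod_list gs / y)) (d * Z.of_nat x)) * ((W * RtoC (sqrt (INR x))) * eta (INR (x * y) * z)))%C).
  { intros x y Hx Hy.
    destruct (in_divs_Z fs x Hf Hx) as [_ [Px Ex]]. destruct (in_divs_Z gs y Hg Hy) as [_ [Py Ey]].
    set (x' := (prod_list fs / x)%nat) in *. set (y' := (prod_list gs / y)%nat) in *.
    set (A := (a * Z.of_nat x')%Z). set (B := (b * Z.of_nat y)%Z).
    set (C' := (c * Z.of_nat y')%Z). set (D' := (d * Z.of_nat x)%Z).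
    assert (Det : (A * D' - B * C' = 1)%Z).
    { rewrite <- D, <- Ex, <- Ey. unfold A, B, C', D'. ring. }
    assert (Od : (D' mod 2 = 1)%Z).
    { apply mod2_mul_l with (Z.of_nat x'). rewrite <- Ho, <- Ex. unfold D'. f_equal. ring. }
    assert (PD : (0 < D')%Z) by (unfold D'; nia).
    assert (Rx : 0 < INR x) by (rewrite INR_IZR_INZ; now apply (IZR_lt 0)).
    assert (Ry : 0 < INR y) by (rewrite INR_IZR_INZ; now apply (IZR_lt 0)).
    assert (Exf : INR x' * INR x = f) by (unfold f; rewrite !INR_IZR_INZ, <- mult_IZR, Ex; reflexivity).
    assert (Eyg : INR y' * INR y = INR (prod_list gs)) by (rewrite !INR_IZR_INZ, <- mult_IZR, Ey; reflexivity).
    assert (Rx' : 0 < INR x') by (apply Rmult_lt_reg_r with (INR x); [auto|]; rewrite Exf; lra).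
    assert (NX : RtoC (INR x) <> 0%C) by (intro E; apply RtoC_inj in E; lra).
    assert (NX' : RtoC (INR x') <> 0%C) by (intro E; apply RtoC_inj in E; lra).
    assert (Ux : UHP (INR (x * y) * z)).
    { unfold UHP in *. rewrite im_scal_l, mult_INR. repeat apply Rmult_lt_0_compat; auto. }
    assert (Ej : j = (INR x' * (IZR C' * (INR (x * y) * z) + IZR D'))%C).
    { unfold j, C', D'. rewrite EN, <- Exf, <- Eyg, !mult_IZR, !mult_INR, <- !INR_IZR_INZ, !RtoC_mult. ring. }
    assert (Nj : (IZR C' * (INR (x * y) * z) + IZR D')%C <> 0%C).
    { apply (affine_neq_0 (IZR A) (IZR B)); [|exact Ux]. rewrite <- !mult_IZR, <- minus_IZR, Det. lra. }
    replace (INR (x' * y) * ((RtoC (f * IZR a) * z + IZR b) / j))%C with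
      ((IZR A * (INR (x * y) * z) + IZR B) / (IZR C' * (INR (x * y) * z) + IZR D'))%C.
    2: { rewrite Ej. replace (IZR A * (INR (x * y) * z) + IZR B)%C with (INR y * (RtoC (f * IZR a) * z + IZR b))%C.
      - set (Q := (IZR C' * (INR (x * y) * z) + IZR D')%C) in *.
        set (P := (RtoC (f * IZR a) * z + IZR b)%C).
        rewrite mult_INR, RtoC_mult. field. auto.
      - unfold A, B. rewrite <- Exf, !mult_IZR, !mult_INR, <- !INR_IZR_INZ, !RtoC_mult. ring. }
    apply eta_multiplier; auto.
    - unfold W. replace (csqrt j / sqrt f * sqrt (INR x) * (csqrt j / sqrt f * sqrt (INR x)))%C with
        ((csqrt j * csqrt j) * RtoC (sqrt (INR x) * sqrt (INR x)) / RtoC (sqrt f * sqrt f))%C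
        by (rewrite !RtoC_mult; field; auto).
      rewrite csqrt_sqr, !sqrt_sqrt by lra. rewrite Ej, <- Exf, (RtoC_mult (INR x')).
      set (Q := (IZR C' * (INR (x * y) * z) + IZR D')%C). field. auto.
    - unfold W. replace (csqrt j / sqrt f * sqrt (INR x))%C with (RtoC (/ sqrt f * sqrt (INR x)) * csqrt j)%C
        by (rewrite RtoC_mult, RtoC_inv by lra; field; auto).
      rewrite re_scal_l. apply Rmult_lt_0_compat.
      + apply Rmult_lt_0_compat; [now apply Rinv_0_lt_compat|now apply sqrt_lt_R0].
      + unfold j. apply affine_csqrt_Re; auto. nra. }
  rewrite (iter_op_ext _ _ _ _ (fun x =>
     (e24 (divsumZ gs (fun y => eta_exponent (a * Z.of_nat (prod_list fs / x)) (b * Z.of_nat y)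
      (c * Z.of_nat (prod_list gs / y)) (d * Z.of_nat x))) *
      ((W ^ 2 ^ length gs * RtoC (sqrt (INR x) ^ 2 ^ length gs)) * iter_op Cmult 1%C (divs gs) (fun y => eta (INR (x * y) * z)%C)))%C)).
  - rewrite !(iter_op_op Cmult 1%C) by apply comm_monoid_Cmult.
    rewrite iter_Cmult_e24, iter_Cmult_const, iter_Cmult_RtoC, length_divs, length_app.
    fold (divsumZ fs (fun x => divsumZ gs (fun y => eta_exponent (a * Z.of_nat (prod_list fs / x)) (b * Z.of_nat y)
      (c * Z.of_nat (prod_list gs / y)) (d * Z.of_nat x)))). fold (total_exponent fs gs a b c d).
    rewrite <- Cpow_mult_r, Nat.pow_add_r, (Nat.mul_comm (2 ^ length gs)).
    assert (E : iter_op Rmult 1 (divs fs) (fun x => sqrt (INR x) ^ 2 ^ length gs) = sqrt_prod fs ^ 2 ^ length gs).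
    { unfold sqrt_prod. generalize (2 ^ length gs)%nat. intros n. induction n as [|n IH].
      - simpl. rewrite iter_Rmult_const. apply pow1.
      - simpl. rewrite iter_op_op, IH by apply comm_monoid_Rmult. reflexivity. }
    rewrite E. ring.
  - intros x Hx. rewrite (iter_op_ext _ _ _ _ _ (fun y Hy => Term x y Hx Hy)).
    rewrite !(iter_op_op Cmult 1%C) by apply comm_monoid_Cmult.
    rewrite iter_Cmult_e24, !iter_Cmult_const, length_divs, RtoC_pow. reflexivity.
Qed.

Definition Delta_of (ps : list nat) (z : C) : C := DeltaN (length ps) (prod_list ps) z.

Lemma Delta_Permutation l l' z : distinct_primes l -> Permutation l l' -> Delta_of l z = Delta_of l' z.
Proof.
  intros H P. unfold Delta_of. rewrite (Permutation_length P), (prod_list_Permutation _ _ P). reflexivity.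
Qed.

Lemma Cpow_quarter (u v : C) h : (u * u = v)%C -> (u ^ (4 * h) = v ^ (2 * h))%C.
Proof.
  intros <-. replace (4 * h)%nat with (2 * h + 2 * h)%nat by lia. rewrite Cpow_mult_l, Cpow_add_r. reflexivity.
Qed.

(** The automorphy factor (c z + d)^(2 h) is cleared of its denominator f^h, so
    that the square root of f disappears. *)
Lemma Delta_transform_odd fs gs (a b c d : Z) z h :
  distinct_primes (fs ++ gs) -> (0 < d)%Z ->
  weightN (length (fs ++ gs)) (prod_list (fs ++ gs)) = (2 * h)%nat ->
  (Z.of_nat (prod_list fs) * a * d - b * (c * Z.of_nat (prod_list gs)) = 1)%Z ->
  ((d * Z.of_nat (prod_list fs)) mod 2 = 1)%Z -> UHP z ->
  let f := INR (prod_list fs) in let N := INR (prod_list (fs ++ gs)) in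
  let j := (RtoC (N * IZR c) * z + RtoC (f * IZR d))%C in
  (f ^ h * Delta_of (fs ++ gs) ((RtoC (f * IZR a) * z + IZR b) / j) = j ^ (2 * h) * Delta_of (fs ++ gs) z)%C.
Proof.
  intros H Hd Hh D Ho Hz f N j. destruct (distinct_primes_app _ _ H) as [Hf Hg].
  assert (F0 : 0 < f) by (apply lt_0_INR; pose proof (prod_list_pos fs Hf); lia).
  destruct (weight_facts _ H) as [h1 [W1 [_ [E4 _]]]].
  assert (h1 = h) by lia. subst h1.
  unfold Delta_of. rewrite !DeltaN_eta_prod by exact H.
  set (l := ellN (length (fs ++ gs)) (prod_list (fs ++ gs))) in *.
  unfold j, f, N. rewrite eta_prod_transform by assumption. fold f N. fold j.
  rewrite !Cpow_mult_l, e24_pow.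
  destruct (total_exponent_24 fs gs a b c d H Hd D Ho) as [m Hm]. fold l in Hm.
  rewrite Hm, e24_24, <- Cpow_mult_r, E4.
  assert (S0 : 0 < sqrt f) by now apply sqrt_lt_R0.
  assert (SC : RtoC (sqrt f) <> 0%C) by (intro E; apply RtoC_inj in E; lra).
  assert (FC : RtoC f <> 0%C) by (intro E; apply RtoC_inj in E; lra).
  rewrite (Cpow_quarter _ (j / f)%C).
  2: { transitivity ((csqrt j * csqrt j) / RtoC (sqrt f * sqrt f))%C.
       - rewrite RtoC_mult. field. auto.
       - now rewrite csqrt_sqr, sqrt_sqrt by lra. }
  rewrite <- (RtoC_pow (sqrt_prod fs ^ 2 ^ length gs) l), (sqrt_prod_power fs (length gs) l h).
  2: { rewrite <- E4, length_app, Nat.pow_add_r. reflexivity. }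
  fold f. unfold Cdiv. rewrite Cpow_mult_l, Cpow_inv by auto. rewrite RtoC_pow.
  replace (2 * h)%nat with (h + h)%nat by lia. rewrite (Cpow_add_r f).
  assert (FP : (f ^ h)%C <> 0%C) by now apply Cpow_nz.
  field. exact FP.
Qed.

(** The Fricke involution z -> -1 / (N z): it exchanges v with N / v, up to the
    inversion of eta.  The eighth roots of unity disappear since 4 divides the
    weight. *)
Lemma Delta_Fricke ps z h : distinct_primes ps ->
  weightN (length ps) (prod_list ps) = (2 * h)%nat -> UHP z ->
  Delta_of ps (- / (INR (prod_list ps) * z)) = (INR (prod_list ps) ^ h * z ^ (2 * h) * Delta_of ps z)%C.
Proof.
  intros H Hh Hz. pose proof (prod_list_pos ps H) as N0.
  destruct (weight_facts _ H) as [h1 [W1 [[h' Eh] [E4 _]]]].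
  assert (Eh1 : h1 = h) by lia. rewrite Eh1 in E4, Eh. pose proof (UHP_neq_0 z Hz) as z0.
  unfold Delta_of. rewrite !DeltaN_eta_prod by exact H.
  set (l := ellN (length ps) (prod_list ps)) in *.
  assert (E : eta_prod ps (- / (INR (prod_list ps) * z)) =
    (e24 (-3) ^ 2 ^ length ps * (csqrt z ^ 2 ^ length ps * RtoC (sqrt_prod ps)) * eta_prod ps z)%C).
  { unfold eta_prod. rewrite <- (iter_op_divs_compl Cmult 1%C ps _ comm_monoid_Cmult H).
    rewrite (iter_op_ext _ _ _ _ (fun v => e24 (-3) * ((csqrt z * RtoC (sqrt (INR v))) * eta (INR v * z)))%C).
    - rewrite !(iter_op_op Cmult 1%C) by apply comm_monoid_Cmult.
      rewrite !iter_Cmult_const, iter_Cmult_RtoC, length_divs. fold (sqrt_prod ps). ring.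
    - intros v Hv. destruct (in_divs_Z ps v H Hv) as [_ [Pv Ev]].
      assert (Rv : 0 < INR v) by (rewrite INR_IZR_INZ; now apply (IZR_lt 0)).
      assert (EN : INR (prod_list ps / v) * INR v = INR (prod_list ps))
        by (rewrite !INR_IZR_INZ, <- mult_IZR, Ev; reflexivity).
      assert (NN : 0 < INR (prod_list ps)) by (apply lt_0_INR; lia).
      assert (NC : RtoC (INR (prod_list ps / v)) <> 0%C).
      { intro E. apply RtoC_inj in E. rewrite E in EN. lra. }
      assert (VC : RtoC (INR v) <> 0%C) by (intro E; apply RtoC_inj in E; lra).
      replace (INR (prod_list ps / v) * - / (INR (prod_list ps) * z))%C with (- / (INR v * z))%C
        by (rewrite <- EN, RtoC_mult; field; auto).
      rewrite e24_m3. rewrite <- eta_S.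
      + reflexivity.
      + unfold UHP in *. rewrite im_scal_l. now apply Rmult_lt_0_compat.
      + replace (csqrt z * sqrt (INR v) * (csqrt z * sqrt (INR v)))%C with
          ((csqrt z * csqrt z) * RtoC (sqrt (INR v) * sqrt (INR v)))%C by (rewrite RtoC_mult; ring).
        rewrite csqrt_sqr, sqrt_sqrt by lra. ring.
      + rewrite re_scal_r. apply Rmult_lt_0_compat; [|now apply sqrt_lt_R0].
        apply csqrt_Re_pos. left. unfold UHP in Hz. lra. }
  rewrite E, !Cpow_mult_l, <- !Cpow_mult_r, E4, (Cpow_quarter (csqrt z) z h (csqrt_sqr z)).
  assert (E1 : (e24 (-3) ^ (4 * h) = 1)%C).
  { rewrite e24_pow. rewrite <- (e24_24 (- Z.of_nat h')). f_equal. lia. }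
  rewrite E1, <- (RtoC_pow (sqrt_prod ps) l).
  pose proof (sqrt_prod_power ps 0 l h ltac:(simpl; lia)) as X. simpl (2 ^ 0)%nat in X. rewrite pow_1 in X.
  rewrite X, RtoC_pow. ring.
Qed.

(** * The group Gamma0(N)+ *)

Definition Delta_rule (ps : list nat) (h : nat) (a b c d f : Z) : Prop :=
  forall z, UHP z ->
    (IZR f ^ h * Delta_of ps ((IZR a * z + IZR b) / (IZR c * z + IZR d)) =
      (IZR c * z + IZR d) ^ (2 * h) * Delta_of ps z)%C.

Definition plus_entries (N : nat) (a b c d f : Z) : Prop :=
  (a * d - b * c = f /\ 0 < f /\ (f | Z.of_nat N) /\ (f | a) /\ (f | d) /\ (Z.of_nat N | c))%Z.

Lemma Delta_rule_odd_pos ps h a b c d f : distinct_primes ps ->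
  weightN (length ps) (prod_list ps) = (2 * h)%nat ->
  plus_entries (prod_list ps) a b c d f ->
  (d mod 2 = 1)%Z -> (0 < d)%Z -> Delta_rule ps h a b c d f.
Proof.
  intros H Hh [D [Pf [Df [Da [Dd Dc]]]]] Od Pd z Hz.
  assert (Ef : exists n, f = Z.of_nat n) by (exists (Z.to_nat f); lia).
  destruct Ef as [n ->]. apply divide_Z_nat in Df.
  destruct (divs_split ps n H Df) as [fs [gs [P En]]].
  pose proof (distinct_primes_Permutation _ _ P H) as H'.
  pose proof (prod_list_Permutation _ _ P) as EN. pose proof (Permutation_length P) as EL.
  rewrite !(Delta_Permutation ps (fs ++ gs)) by assumption.
  rewrite EN in *. rewrite EL in Hh.
  destruct Da as [a' Ea]. destruct Dd as [d' Ed]. destruct Dc as [c' Ec].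
  rewrite prod_list_app, Nat2Z.inj_mul in Ec.
  assert (D' : (Z.of_nat (prod_list fs) * a' * d' - b * (c' * Z.of_nat (prod_list gs)) = 1)%Z).
  { rewrite En. apply Z.mul_reg_l with (Z.of_nat n); [lia|]. rewrite Z.mul_1_r.
    transitivity (a * d - b * c)%Z; [rewrite Ea, Ed, Ec, En; ring|exact D]. }
  assert (Od' : ((d' * Z.of_nat (prod_list fs)) mod 2 = 1)%Z) by (rewrite En, <- Ed; exact Od).
  assert (Pd' : (0 < d')%Z) by nia.
  pose proof (Delta_transform_odd fs gs a' b c' d' z h H' Pd' Hh D' Od' Hz) as T. cbv zeta in T.
  assert (X1 : INR (prod_list fs) * IZR a' = IZR a) by (rewrite En, INR_IZR_INZ, <- mult_IZR, Ea; f_equal; lia).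
  assert (X2 : INR (prod_list (fs ++ gs)) * IZR c' = IZR c).
  { rewrite INR_IZR_INZ, <- mult_IZR, prod_list_app, Nat2Z.inj_mul, Ec. f_equal. lia. }
  assert (X3 : INR (prod_list fs) * IZR d' = IZR d) by (rewrite En, INR_IZR_INZ, <- mult_IZR, Ed; f_equal; lia).
  rewrite X1, X2, X3, En in T. rewrite <- INR_IZR_INZ. exact T.
Qed.

Lemma Delta_T ps z : distinct_primes ps -> UHP z -> Delta_of ps (z + 1) = Delta_of ps z.
Proof.
  intros H Hz. destruct (weight_facts _ H) as [h [W _]].
  assert (R : Delta_rule ps h 1 1 0 1 1).
  { apply Delta_rule_odd_pos; auto; try reflexivity.
    repeat split; try lia; try apply Z.divide_1_l. apply Z.divide_0_r. }
  specialize (R z Hz). replace ((IZR 1 * z + IZR 1) / (IZR 0 * z + IZR 1))%C with (z + 1)%C in R by field.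
  replace (IZR 0 * z + IZR 1)%C with (RtoC 1) in R by ring.
  rewrite !Cpow_1_l, !Cmult_1_l in R. exact R.
Qed.

(** The weight 2 h is even, so that a matrix may be replaced by its negative. *)
Lemma Delta_rule_odd ps h a b c d f : distinct_primes ps ->
  weightN (length ps) (prod_list ps) = (2 * h)%nat ->
  plus_entries (prod_list ps) a b c d f ->
  (d mod 2 = 1)%Z -> Delta_rule ps h a b c d f.
Proof.
  intros H Hh Hp Od. destruct (Z_lt_le_dec 0 d) as [L|L]; [now apply Delta_rule_odd_pos|].
  intros z Hz.
  assert (R : Delta_rule ps h (- a) (- b) (- c) (- d) f).
  { apply Delta_rule_odd_pos; auto.
    - destruct Hp as [D [Pf [Df [Da [Dd Dc]]]]]. repeat split; auto; try (now apply Z.divide_opp_r). lia.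
    - clear - Od. Z.to_euclidean_division_equations; lia.
    - assert (d <> 0)%Z by (intros ->; discriminate). lia. }
  assert (N : (IZR c * z + IZR d)%C <> 0%C).
  { apply (affine_neq_0 (IZR a) (IZR b)); auto. destruct Hp as [D [Pf _]].
    rewrite <- !mult_IZR, <- minus_IZR, D. now apply (IZR_lt 0). }
  specialize (R z Hz). rewrite !opp_IZR, !RtoC_opp in R.
  replace (- IZR c * z + - IZR d)%C with (-1 * (IZR c * z + IZR d))%C in R by ring.
  replace ((- IZR a * z + - IZR b) / (-1 * (IZR c * z + IZR d)))%C with
    ((IZR a * z + IZR b) / (IZR c * z + IZR d))%C in R.
  - rewrite R, Cpow_mult_l, (Cpow_mult_r (-1)).
    replace ((-1) ^ 2)%C with (RtoC 1) by ring. rewrite Cpow_1_l. ring.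
  - field. exact N.
Qed.

(** If f is odd and d even then c is odd, and a translation makes d odd. *)
Lemma Delta_rule_odd_det ps h a b c d f : distinct_primes ps ->
  weightN (length ps) (prod_list ps) = (2 * h)%nat ->
  plus_entries (prod_list ps) a b c d f ->
  (f mod 2 = 1)%Z -> Delta_rule ps h a b c d f.
Proof.
  intros H Hh Hp Of. destruct (Z.eq_dec (d mod 2) 1) as [Od|Od]; [now apply Delta_rule_odd|].
  intros z Hz.
  assert (R : Delta_rule ps h a (a + b) c (c + d) f).
  { apply Delta_rule_odd; auto.
    - destruct Hp as [D [Pf [Df [Da [Dd Dc]]]]]. repeat split; auto; [lia|].
      apply Z.divide_add_r; auto. now apply (Z.divide_trans _ _ _ Df).
    - destruct Hp as [D _]. assert (E : (d mod 2 = 0)%Z) by (pose proof (Z.mod_pos_bound d 2); lia).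
      rewrite Zmod_odd in *. rewrite <- D, Z.odd_sub, !Z.odd_mul in Of. rewrite Z.odd_add.
      destruct (Z.odd d), (Z.odd c), (Z.odd a), (Z.odd b); simpl in *; congruence. }
  set (z' := (z - 1)%C).
  assert (Hz' : UHP z') by (unfold UHP, z' in *; rewrite Im_minus, im_RtoC; lra).
  specialize (R z' Hz'). unfold z' in R.
  rewrite !plus_IZR, !RtoC_plus in R.
  replace (IZR a * (z - 1) + (IZR a + IZR b))%C with (IZR a * z + IZR b)%C in R by ring.
  replace (IZR c * (z - 1) + (IZR c + IZR d))%C with (IZR c * z + IZR d)%C in R by ring.
  rewrite R, <- (Delta_T ps (z - 1)) by auto. do 2 f_equal. ring.
Qed.

Lemma square_divisor_of_distinct_primes ps n : distinct_primes ps -> Nat.divide (n * n) (prod_list ps) -> n = 1%nat.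
Proof.
  intros H D. assert (Hn : Nat.divide n (prod_list ps)).
  { eapply Nat.divide_trans; [|exact D]. apply Nat.divide_factor_l. }
  destruct (divs_split ps n H Hn) as [fs [gs [P En]]].
  pose proof (distinct_primes_Permutation _ _ P H) as H'.
  rewrite (prod_list_Permutation _ _ P), prod_list_app, En in D.
  destruct (distinct_primes_app _ _ H') as [Hf Hg]. pose proof (prod_list_pos fs Hf) as Pn. rewrite En in Pn.
  apply Nat.mul_divide_cancel_l in D; [|lia].
  destruct fs as [|p fs]; [simpl in En; auto|].
  exfalso. destruct (distinct_primes_head p (fs ++ gs) H') as [Pp Np].
  apply Np. rewrite prod_list_app. apply Nat.divide_mul_r. eapply Nat.divide_trans; [|exact D].
  rewrite <- En. apply Nat.divide_factor_l.
Qed.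

(** When f is even, N / f is odd; composing with the Fricke involution
    exchanges the two. *)
Lemma Delta_rule_all ps h a b c d f : distinct_primes ps ->
  weightN (length ps) (prod_list ps) = (2 * h)%nat ->
  plus_entries (prod_list ps) a b c d f -> Delta_rule ps h a b c d f.
Proof.
  intros H Hh Hp. destruct (Z.eq_dec (f mod 2) 1) as [Of|Of]; [now apply Delta_rule_odd_det|].
  destruct Hp as [D [Pf [[g Eg] [[a' Ea] [[d' Ed] [c' Ec]]]]]].
  pose proof (prod_list_pos ps H) as NP.
  assert (Pg : (0 < g)%Z) by nia.
  assert (Og : (g mod 2 = 1)%Z).
  { destruct (Z.eq_dec (g mod 2) 1) as [E|E]; auto. exfalso.
    assert (2 = 1)%nat; [|lia]. apply (square_divisor_of_distinct_primes ps 2 H).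
    apply divide_Z_nat. rewrite Eg.
    assert (E1 : (2 | g)%Z) by (apply Z.mod_divide; [lia|]; pose proof (Z.mod_pos_bound g 2); lia).
    assert (E2 : (2 | f)%Z) by (apply Z.mod_divide; [lia|]; pose proof (Z.mod_pos_bound f 2); lia).
    change (Z.of_nat (2 * 2)) with (2 * 2)%Z. now apply Z_mul_divide_compat. }
  set (N := Z.of_nat (prod_list ps)) in *.
  assert (D' : (a' * d' * f - b * c' * g = 1)%Z).
  { apply Z.mul_reg_l with f; [lia|]. rewrite Z.mul_1_r.
    transitivity (a * d - b * c)%Z; [rewrite Ea, Ed, Ec, Eg; ring|exact D]. }
  assert (R : Delta_rule ps h (b * g) (- a') (N * d') (- (g * c')) g).
  { apply Delta_rule_odd_det; auto. repeat split; auto.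
    - rewrite Eg. transitivity (g * (a' * d' * f - b * c' * g))%Z; [ring|]. rewrite D'. ring.
    - exists f. fold N. rewrite Eg. ring.
    - apply Z.divide_factor_r.
    - apply Z.divide_opp_r, Z.divide_factor_l.
    - apply Z.divide_factor_l. }
  intros z Hz. pose proof (UHP_neq_0 z Hz) as z0.
  assert (F0 : 0 < IZR f) by now apply (IZR_lt 0). assert (G0 : 0 < IZR g) by now apply (IZR_lt 0).
  assert (FC : RtoC (IZR f) <> 0%C) by (intro E; apply RtoC_inj in E; lra).
  assert (GC : RtoC (IZR g) <> 0%C) by (intro E; apply RtoC_inj in E; lra).
  assert (EN : RtoC (INR (prod_list ps)) = (IZR g * IZR f)%C).
  { rewrite INR_IZR_INZ. fold N. rewrite Eg, mult_IZR, RtoC_mult. reflexivity. }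
  pose proof (Delta_Fricke ps z h H Hh Hz) as Fr. rewrite EN in Fr.
  set (z' := (- / (IZR g * IZR f * z))%C) in *.
  assert (Hz' : UHP z').
  { unfold z'. apply UHP_S. unfold UHP in *. rewrite <- RtoC_mult, im_scal_l. apply Rmult_lt_0_compat; auto. nra. }
  assert (Nj : (IZR c * z + IZR d)%C <> 0%C).
  { apply (affine_neq_0 (IZR a) (IZR b)); auto. rewrite <- !mult_IZR, <- minus_IZR, D. auto. }
  specialize (R z' Hz').
  assert (Ej : (IZR (N * d') * z' + IZR (- (g * c')) = - / (IZR f * z) * (IZR c * z + IZR d))%C).
  { unfold z'. rewrite Ec, Ed, Eg, opp_IZR, !mult_IZR, RtoC_opp, !RtoC_mult. field. auto. }
  assert (En : (IZR (b * g) * z' + IZR (- a') = - / (IZR f * z) * (IZR a * z + IZR b))%C).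
  { unfold z'. rewrite Ea, opp_IZR, !mult_IZR, RtoC_opp, !RtoC_mult. field. auto. }
  rewrite Ej, En in R.
  replace (- / (IZR f * z) * (IZR a * z + IZR b) / (- / (IZR f * z) * (IZR c * z + IZR d)))%C with
    ((IZR a * z + IZR b) / (IZR c * z + IZR d))%C in R.
  2: { assert (K : (- / (IZR f * z))%C <> 0%C).
       { intros G. apply C1_nz. replace (RtoC 1) with (- / (IZR f * z) * - (IZR f * z))%C by (field; auto).
         rewrite G. ring. }
       set (k := (- / (IZR f * z))%C) in *. field. auto. }
  rewrite Fr in R.
  set (X := Delta_of ps ((IZR a * z + IZR b) / (IZR c * z + IZR d))) in *.
  set (Y := Delta_of ps z) in *. set (j := (IZR c * z + IZR d)%C) in *.
  assert (GH : (IZR g ^ h)%C <> 0%C) by now apply Cpow_nz.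
  assert (FH : (IZR f ^ h)%C <> 0%C) by now apply Cpow_nz.
  assert (ZH : (z ^ (2 * h))%C <> 0%C) by now apply Cpow_nz.
  replace (- / (IZR f * z) * j)%C with (-1 * (/ IZR f * (/ z * j)))%C in R by (field; auto).
  rewrite !Cpow_mult_l, (Cpow_mult_r (-1)), !Cpow_inv in R by auto.
  replace ((-1) ^ 2)%C with (RtoC 1) in R by ring. rewrite Cpow_1_l in R.
  replace (IZR f ^ h * X)%C with (IZR f ^ h * / IZR g ^ h * (IZR g ^ h * X))%C by (field; auto).
  rewrite R. replace (IZR f ^ (2 * h))%C with (IZR f ^ h * IZR f ^ h)%C
    by (rewrite <- Cpow_add_r; f_equal; lia).
  field. auto.
Qed.

Theorem Delta_modular ps (g : mat2) z : distinct_primes ps ->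
  Gamma0_plus (prod_list ps) g -> UHP z ->
  Delta_of ps (moebius g z) = (autfactor g z ^ weightN (length ps) (prod_list ps) * Delta_of ps z)%C.
Proof.
  intros H [_ [a [b [c [d [f [D [Pf [Df [Da [Dd [Dc ->]]]]]]]]]]]] Hz.
  destruct (weight_facts _ H) as [h [W _]].
  pose proof (Delta_rule_all ps h a b c d f H W (conj D (conj Pf (conj Df (conj Da (conj Dd Dc))))) z Hz) as R.
  assert (F0 : 0 < IZR f) by now apply (IZR_lt 0).
  assert (S0 : 0 < sqrt (IZR f)) by now apply sqrt_lt_R0.
  assert (FC : RtoC (IZR f) <> 0%C) by (intro E; apply RtoC_inj in E; lra).
  assert (SC : RtoC (sqrt (IZR f)) <> 0%C) by (intro E; apply RtoC_inj in E; lra).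
  assert (Nj : (IZR c * z + IZR d)%C <> 0%C).
  { apply (affine_neq_0 (IZR a) (IZR b)); auto. rewrite <- !mult_IZR, <- minus_IZR, D. auto. }
  unfold moebius, autfactor. cbn [m11 m12 m21 m22]. rewrite W, !RtoC_div by lra.
  replace ((IZR a / sqrt (IZR f) * z + IZR b / sqrt (IZR f)) /
    (IZR c / sqrt (IZR f) * z + IZR d / sqrt (IZR f)))%C with
    ((IZR a * z + IZR b) / (IZR c * z + IZR d))%C by (field; auto).
  replace (IZR c / sqrt (IZR f) * z + IZR d / sqrt (IZR f))%C with
    ((IZR c * z + IZR d) * / sqrt (IZR f))%C by (field; auto).
  rewrite Cpow_mult_l, Cpow_inv by auto.
  replace (sqrt (IZR f) ^ (2 * h))%C with (IZR f ^ h)%C.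
  - assert (FH : (IZR f ^ h)%C <> 0%C) by now apply Cpow_nz.
    set (X := Delta_of ps ((IZR a * z + IZR b) / (IZR c * z + IZR d))) in *.
    replace X with (/ IZR f ^ h * (IZR f ^ h * X))%C by (field; auto).
    rewrite R. ring.
  - rewrite Cpow_mult_r. f_equal. rewrite <- RtoC_pow. f_equal. simpl. rewrite Rmult_1_r.
    symmetry. apply sqrt_sqrt. lra.
Qed.

(** * Power series in q *)

Definition abs_power_series (a : nat -> C) : Prop :=
  forall r, 0 <= r < 1 -> summable (fun n => Cmod (a n) * r ^ n).

Definition has_power_series (f : C -> C) (a : nat -> C) : Prop :=
  abs_power_series a /\ forall z, UHP z -> clim (csum (fun n => a n * e z ^ n)%C) (f z).

Definition cauchy_product (a b : nat -> C) (n : nat) : C :=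
  csum (fun i => a i * b (n - i)%nat)%C (S n).

Lemma cauchy_product_partial a b x N :
  csum (fun n => cauchy_product a b n * x ^ n)%C N =
  csum (fun i => a i * x ^ i * csum (fun j => b j * x ^ j) (N - i))%C N.
Proof.
  induction N as [|N IH]; [reflexivity|]. cbn [csum]. rewrite IH.
  rewrite (csum_ext_lt (fun i => a i * x ^ i * csum (fun j => b j * x ^ j) (S N - i))%C
    (fun i => a i * x ^ i * csum (fun j => b j * x ^ j) (N - i) + x ^ N * (a i * b (N - i)%nat))%C).
  - rewrite csum_plus, csum_scal. replace (S N - N)%nat with 1%nat by lia.
    unfold cauchy_product. cbn [csum]. rewrite Nat.sub_diag. cbn [Cpow]. ring.
  - intros i Hi. replace (S N - i)%nat with (S (N - i)) by lia. cbn [csum].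
    assert (E : (x ^ N = x ^ i * x ^ (N - i))%C) by (rewrite <- Cpow_add_r; f_equal; lia).
    rewrite E. ring.
Qed.

Lemma csum_RtoC f n : csum (fun i => RtoC (f i)) n = RtoC (rsum f n).
Proof. induction n as [|n IH]; simpl; [reflexivity|]. now rewrite IH, RtoC_plus. Qed.

Lemma cauchy_product_abs a b : abs_power_series a -> abs_power_series b ->
  abs_power_series (cauchy_product a b).
Proof.
  intros Ha Hb r Hr. destruct (Ha r Hr) as [a0 [A HA]]. destruct (Hb r Hr) as [b0 [B HB]].
  assert (B0 : 0 <= B) by apply (HB O).
  assert (R : forall n, 0 <= r ^ n) by (intros; apply pow_le; lra).
  set (a' := fun n => RtoC (Cmod (a n))). set (b' := fun n => RtoC (Cmod (b n))).
  (* [cauchy_product_partial] for the series of the moduli *)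
  assert (Real : forall n, exists c, cauchy_product a' b' n = RtoC c /\ Cmod (cauchy_product a b n) <= c).
  { intros n. unfold cauchy_product. exists (rsum (fun i => Cmod (a i) * Cmod (b (n - i)%nat)) (S n)). split.
    - rewrite <- csum_RtoC. apply csum_ext. intros i. unfold a', b'. now rewrite RtoC_mult.
    - apply Cmod_csum_le. intros i. rewrite Cmod_mult. lra. }
  split; [intros n; apply Rmult_le_pos; [apply Cmod_ge_0|auto]|].
  exists (A * B). intros N.
  assert (E : exists s, csum (fun n => cauchy_product a' b' n * r ^ n)%C N = RtoC s /\
     rsum (fun n => Cmod (cauchy_product a b n) * r ^ n) N <= s).
  { induction N as [|N [s [E L]]]; [exists 0; simpl; split; [reflexivity|lra]|].
    destruct (Real N) as [c [Ec Lc]]. exists (s + c * r ^ N). cbn [csum rsum]. split.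
    - rewrite E, Ec, RtoC_plus, RtoC_mult, RtoC_pow. reflexivity.
    - specialize (R N). nra. }
  destruct E as [s [E L]]. eapply Rle_trans; [exact L|].
  rewrite cauchy_product_partial in E.
  assert (T : forall i, csum (fun j => b' j * r ^ j)%C (N - i) = RtoC (rsum (fun j => Cmod (b j) * r ^ j) (N - i))).
  { intros i. rewrite <- csum_RtoC. apply csum_ext. intros j. unfold b'. now rewrite RtoC_mult, RtoC_pow. }
  rewrite (csum_ext _ (fun i => RtoC (Cmod (a i) * r ^ i * rsum (fun j => Cmod (b j) * r ^ j) (N - i)))) in E.
  - rewrite csum_RtoC in E. apply RtoC_inj in E. rewrite <- E.
    eapply Rle_trans; [apply (rsum_le _ (fun i => B * (Cmod (a i) * r ^ i)))|].
    + intros i. rewrite (Rmult_comm B). apply Rmult_le_compat_l; [apply a0|apply HB].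
    + rewrite rsum_scal, (Rmult_comm A). apply Rmult_le_compat_l; auto.
  - intros i. rewrite T. unfold a'. now rewrite !RtoC_mult, RtoC_pow.
Qed.

(** Cauchy's product of absolutely convergent series, as a dominated limit. *)
Lemma has_power_series_mult f g a b : has_power_series f a -> has_power_series g b ->
  has_power_series (fun z => f z * g z)%C (cauchy_product a b).
Proof.
  intros [Ha Hf] [Hb Hg]. split; [now apply cauchy_product_abs|].
  intros z Hz. set (x := e z).
  assert (Hr : 0 <= Cmod x < 1) by (split; [apply Cmod_ge_0|now apply Cmod_e_lt_1]).
  destruct (Hb _ Hr) as [b0 [B HB]].
  apply (clim_ext (fun N => csum (fun i => a i * x ^ i * csum (fun j => b j * x ^ j) (N - i))%C N)).
  { intros N. symmetry. apply cauchy_product_partial. }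
  set (F := fun N i => (a i * x ^ i * csum (fun j => b j * x ^ j) (N - i))%C).
  apply (tannery F (fun i => a i * x ^ i * g z)%C (fun i => B * (Cmod (a i) * Cmod x ^ i))).
  - apply summable_scal; [apply (HB O)|now apply Ha].
  - intros N i. unfold F. rewrite !Cmod_mult, Cmod_pow, Rmult_comm.
    apply Rmult_le_compat_r; [apply Rmult_le_pos; [apply Cmod_ge_0|apply pow_le; lra]|].
    eapply Rle_trans; [|apply (HB (N - i)%nat)]. apply Cmod_csum_le. intros j.
    rewrite Cmod_mult, Cmod_pow. lra.
  - intros i. unfold F. apply clim_scal. intros eps He. destruct (Hg z Hz eps He) as [N0 HN].
    exists (N0 + i)%nat. intros N HNi. apply HN. lia.
  - intros N. apply (clim_ext_from (fun _ => csum (F N) N) _ _ N); [|apply clim_const].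
    intros M HM. replace M with (N + (M - N))%nat by lia. rewrite csum_add.
    rewrite (csum_ext (fun i => F N (N + i)%nat) (fun _ => 0%C)); [rewrite csum_0; ring|].
    intros i. unfold F. replace (N - (N + i))%nat with 0%nat by lia. simpl. ring.
  - apply (clim_ext (fun n => g z * csum (fun i => a i * x ^ i) n)%C).
    + intros n. rewrite <- csum_scal. apply csum_ext. intros; ring.
    + rewrite (Cmult_comm (f z)). apply clim_scal. now apply Hf.
Qed.

Lemma has_power_series_1 : has_power_series (fun _ => 1%C) (fun n => match n with O => 1%C | _ => 0%C end).
Proof.
  assert (E : forall x n, csum (fun n => (match n with O => 1 | _ => 0 end) * x ^ n)%C (S n) = 1%C).
  { intros x. induction n as [|n IH]; [simpl; ring|].
    change (csum (fun n => (match n with O => 1 | _ => 0 end) * x ^ n)%C (S n) + 0 * x ^ S n = 1)%C.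
    rewrite IH. ring. }
  split.
  - intros r Hr. split.
    + intros [|n]; [rewrite Cmod_1; simpl; lra|rewrite Cmod_0; lra].
    + exists 1. intros [|n]; [simpl; lra|]. right.
      induction n as [|n IH]; [simpl; rewrite Cmod_1; ring|]. cbn [rsum] in *. rewrite IH, Cmod_0. ring.
  - intros z _. apply (clim_ext_from (fun _ => 1%C) _ _ 1); [|apply clim_const].
    intros [|n] Hn; [lia|]. symmetry. apply E.
Qed.

Lemma has_power_series_pow f a n : has_power_series f a -> exists b, has_power_series (fun z => f z ^ n)%C b.
Proof.
  intros H. induction n as [|n [b Hb]]; [eexists; apply has_power_series_1|].
  eexists. apply (has_power_series_mult f (fun z => f z ^ n)%C a b); auto.
Qed.

(** ** The expansion of the product of the 1 - q^(v j) *)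

(** Coefficients of the product of the 1 + s q^(v j) for j from 1 to n; those
    for s = 1 dominate those for s = -1. *)
Fixpoint prod_coef (s : R) (v n m : nat) : R :=
  match n with
  | O => match m with O => 1 | _ => 0 end
  | S k => prod_coef s v k m + (if (v * S k <=? m)%nat then s * prod_coef s v k (m - v * S k) else 0)
  end.

Lemma prod_coef_ge_0 v n m : 0 <= prod_coef 1 v n m.
Proof.
  revert m. induction n as [|n IH]; intros m; simpl; [destruct m; lra|].
  pose proof (IH m). destruct (_ <=? _)%nat; [|lra]. pose proof (IH (m - v * S n)%nat). lra.
Qed.

Lemma Rabs_prod_coef v n m : Rabs (prod_coef (-1) v n m) <= prod_coef 1 v n m.
Proof.
  revert m. induction n as [|n IH]; intros m.
  - simpl. destruct m; rewrite Rabs_pos_eq; lra.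
  - cbn [prod_coef]. eapply Rle_trans; [apply Rabs_triang|]. apply Rplus_le_compat; auto.
    destruct (_ <=? _)%nat; [|rewrite Rabs_R0; lra].
    rewrite Rabs_mult, (Rabs_left (-1)), Rmult_1_l by lra.
    replace (- -1) with 1 by ring. rewrite Rmult_1_l. apply IH.
Qed.

(** Only finitely many factors contribute to a given coefficient. *)
Lemma prod_coef_stable s v n m : (0 < v)%nat -> (m <= n)%nat -> prod_coef s v n m = prod_coef s v m m.
Proof.
  intros Hv H. induction H as [|n H IH]; [reflexivity|]. cbn [prod_coef]. rewrite IH.
  replace (v * S n <=? m)%nat with false; [ring|]. symmetry. apply Nat.leb_gt. nia.
Qed.

Lemma prod_coef_mono v n m k : (n <= k)%nat -> prod_coef 1 v n m <= prod_coef 1 v k m.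
Proof.
  intros H. induction H as [|k H IH]; [lra|]. cbn [prod_coef].
  destruct (_ <=? _)%nat; [|lra]. pose proof (prod_coef_ge_0 v k (m - v * S k)). lra.
Qed.

Lemma prod_coef_le v n m : (0 < v)%nat -> prod_coef 1 v n m <= prod_coef 1 v m m.
Proof.
  intros Hv. destruct (le_lt_dec m n) as [H|H]; [right; now apply prod_coef_stable|].
  apply prod_coef_mono. lia.
Qed.

(** On the left is a partial sum of the product of the 1 + r^(v j), which is at
    most the exponential of the sum of the r^(v j). *)
Lemma rsum_prod_coef_le r v n M : 0 <= r < 1 -> (0 < v)%nat ->
  rsum (fun m => prod_coef 1 v n m * r ^ m) M <= exp (rsum (fun i => r ^ i) n).
Proof.
  intros Hr Hv. revert M. induction n as [|n IH]; intros M.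
  - simpl. rewrite exp_0. destruct M as [|M]; [simpl; lra|]. right.
    induction M as [|M IH]; [simpl; ring|]. cbn [rsum] in *. rewrite IH. ring.
  - cbn [rsum]. rewrite exp_plus.
    set (k := (v * S n)%nat). set (E := exp (rsum (fun i => r ^ i) n)) in *.
    assert (E0 : 0 < E) by apply exp_pos.
    assert (Sh : rsum (fun m => (if (k <=? m)%nat then prod_coef 1 v n (m - k) else 0) * r ^ m) M <= r ^ k * E).
    { destruct (le_lt_dec k M) as [L|L].
      - replace M with (k + (M - k))%nat by lia. generalize (M - k)%nat. intros M'.
        assert (X : rsum (fun m => (if (k <=? m)%nat then prod_coef 1 v n (m - k) else 0) * r ^ m) (k + M') =
          r ^ k * rsum (fun m => prod_coef 1 v n m * r ^ m) M').
        { induction M' as [|M' IHM].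
          - rewrite Nat.add_0_r. simpl. rewrite Rmult_0_r.
            assert (Y : forall K, (K <= k)%nat -> rsum (fun m => (if (k <=? m)%nat then prod_coef 1 v n (m - k) else 0) * r ^ m) K = 0).
            { induction K as [|K IHK]; intros HK; [reflexivity|]. cbn [rsum]. rewrite IHK by lia.
              replace (k <=? K)%nat with false by (symmetry; apply Nat.leb_gt; lia). ring. }
            now apply Y.
          - rewrite Nat.add_succ_r. cbn [rsum]. rewrite IHM.
            replace (k <=? k + M')%nat with true by (symmetry; apply Nat.leb_le; lia).
            replace (k + M' - k)%nat with M' by lia. rewrite pow_add. ring. }
        rewrite X. apply Rmult_le_compat_l; [apply pow_le; lra|apply IH].
      - assert (Y : forall K, (K <= k)%nat -> rsum (fun m => (if (k <=? m)%nat then prod_coef 1 v n (m - k) else 0) * r ^ m) K = 0).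
        { induction K as [|K IHK]; intros HK; [reflexivity|]. cbn [rsum]. rewrite IHK by lia.
          replace (k <=? K)%nat with false by (symmetry; apply Nat.leb_gt; lia). ring. }
        rewrite Y by lia. apply Rmult_le_pos; [apply pow_le; lra|lra]. }
    rewrite (rsum_ext_lt _ (fun m => prod_coef 1 v n m * r ^ m + (if (k <=? m)%nat then prod_coef 1 v n (m - k) else 0) * r ^ m)).
    + rewrite rsum_plus. specialize (IH M).
      assert (K : r ^ k <= r ^ n).
      { replace k with (n + (k - n))%nat by (unfold k; nia). rewrite pow_add.
        pose proof (pow_le r n ltac:(lra)).
        assert (r ^ (k - n) <= 1) by (rewrite <- (pow1 (k - n)); apply pow_incr; lra).
        pose proof (pow_le r (k - n) ltac:(lra)). nra. }
      pose proof (exp_ineq1_le (r ^ n)). pose proof (pow_le r n ltac:(lra)). nra.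
    + intros m _. cbn [prod_coef]. fold k. destruct (k <=? m)%nat; ring.
Qed.

Lemma clim_shift (a : nat -> C) (x l : C) k : clim (csum (fun m => a m * x ^ m)%C) l ->
  clim (csum (fun m => (if (k <=? m)%nat then a (m - k)%nat else 0) * x ^ m)%C) (x ^ k * l).
Proof.
  intros H.
  assert (X : forall M, csum (fun m => (if (k <=? m)%nat then a (m - k)%nat else 0) * x ^ m)%C (k + M) =
     (x ^ k * csum (fun m => a m * x ^ m) M)%C).
  { intros M. rewrite csum_add, <- csum_scal.
    rewrite (csum_ext_lt _ (fun _ => 0%C)).
    - rewrite csum_0, Cplus_0_l. apply csum_ext. intros i.
      replace (k <=? k + i)%nat with true by (symmetry; apply Nat.leb_le; lia).
      replace (k + i - k)%nat with i by lia. rewrite Cpow_add_r. ring.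
    - intros i Hi. replace (k <=? i)%nat with false by (symmetry; apply Nat.leb_gt; lia). ring. }
  pose proof (clim_scal _ _ (x ^ k)%C H) as L. intros eps He. destruct (L eps He) as [N HN].
  exists (k + N)%nat. intros n Hn. replace n with (k + (n - k))%nat by lia. rewrite X. apply HN. lia.
Qed.

(** The coefficients of the partial products are eventually constant and
    dominated by those for s = 1, so Tannery's theorem identifies the limit. *)
Lemma eprod_power_series v : (0 < v)%nat ->
  has_power_series (fun z => eprod_inf (INR v * z)) (fun m => RtoC (prod_coef (-1) v m m)).
Proof.
  intros Hv.
  assert (Sum : forall r, 0 <= r < 1 -> summable (fun m => prod_coef 1 v m m * r ^ m)).
  { intros r Hr. destruct (summable_geom r Hr) as [_ [B HB]]. split.
    - intros m. apply Rmult_le_pos; [apply prod_coef_ge_0|apply pow_le; lra].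
    - exists (exp B). intros M.
      rewrite (rsum_ext_lt _ (fun m => prod_coef 1 v M m * r ^ m)).
      + eapply Rle_trans; [now apply rsum_prod_coef_le|].
        destruct (Rle_lt_or_eq_dec _ _ (HB M)) as [G|G]; [left; now apply exp_increasing|rewrite G; lra].
      + intros m Hm. rewrite (prod_coef_stable 1 v M m) by lia. reflexivity. }
  assert (Abs : abs_power_series (fun m => RtoC (prod_coef (-1) v m m))).
  { intros r Hr. apply (summable_le (fun m => prod_coef 1 v m m * r ^ m)); [|now apply Sum].
    intros m. rewrite Cmod_R. pose proof (pow_le r m ltac:(lra)). pose proof (Rabs_pos (prod_coef (-1) v m m)).
    pose proof (Rabs_prod_coef v m m). split; [nra|]. now apply Rmult_le_compat_r. }
  split; auto. intros z Hz. set (x := e z).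
  assert (Hr : 0 <= Cmod x < 1) by (split; [apply Cmod_ge_0|now apply Cmod_e_lt_1]).
  assert (Uv : UHP (INR v * z)).
  { unfold UHP in *. rewrite im_scal_l. apply Rmult_lt_0_compat; auto. now apply lt_0_INR. }
  destruct (csum_converges (fun m => prod_coef (-1) v m m * x ^ m)%C (fun m => Cmod (prod_coef (-1) v m m) * Cmod x ^ m))
    as [l Hl]; [now apply Abs|intros i; rewrite Cmod_mult, Cmod_pow; lra|].
  replace (eprod_inf (INR v * z)) with l; [exact Hl|].
  apply (clim_unique (eprod (INR v * z))); [|now apply clim_eprod].
  apply (tannery (fun n m => prod_coef (-1) v n m * x ^ m)%C (fun m => prod_coef (-1) v m m * x ^ m)%C
    (fun m => prod_coef 1 v m m * Cmod x ^ m)); auto.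
  - intros n m. rewrite Cmod_mult, Cmod_pow, Cmod_R. apply Rmult_le_compat_r; [apply pow_le; lra|].
    eapply Rle_trans; [apply Rabs_prod_coef|now apply prod_coef_le].
  - intros m. apply (clim_ext_from (fun _ => prod_coef (-1) v m m * x ^ m)%C _ _ m); [|apply clim_const].
    intros n Hn. now rewrite (prod_coef_stable _ v n m).
  - induction k as [|n IH].
    + destruct has_power_series_1 as [_ H1]. specialize (H1 z Hz). revert H1. apply clim_ext.
      intros n. apply csum_ext. intros [|i]; reflexivity.
    + unfold eprod in *. cbn [Cprod].
      pose proof (clim_minus _ _ _ _ IH (clim_shift _ _ _ (v * S n) IH)) as L.
      replace (Cprod (fun n => 1 - e (INR n * (INR v * z))) n * (1 - e (INR (S n) * (INR v * z))))%C with
        (Cprod (fun n => 1 - e (INR n * (INR v * z))) n - x ^ (v * S n) * Cprod (fun n => 1 - e (INR n * (INR v * z))) n)%C.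
      * revert L. apply clim_ext. intros M. rewrite <- csum_minus. apply csum_ext. intros m.
        cbn [prod_coef]. destruct (v * S n <=? m)%nat; rewrite RtoC_plus, ?RtoC_mult; [|rewrite Cplus_0_r]; ring.
      * assert (E : e (INR (S n) * (INR v * z)) = (x ^ (v * S n))%C).
        { unfold x. rewrite <- e_nat_mul. f_equal. rewrite mult_INR, RtoC_mult. ring. }
        rewrite E. ring.
Qed.

Lemma power_series_list l : (forall v, In v l -> (0 < v)%nat) ->
  exists a, has_power_series (fun z => iter_op Cmult 1%C l (fun v => eprod_inf (INR v * z))) a.
Proof.
  induction l as [|v l IH]; intros H.
  - eexists. apply has_power_series_1.
  - destruct IH as [a Ha]; [intros; apply H; simpl; auto|].
    eexists. apply (has_power_series_mult _ _ _ _ (eprod_power_series v (H v (or_introl eq_refl))) Ha).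
Qed.

Lemma e_list_sum l z : iter_op Cmult 1%C l (fun v => e (INR v * z / 24)) = e (INR (list_sum l) * z / 24).
Proof.
  induction l as [|v l IH].
  - change (list_sum nil) with 0%nat. simpl INR. replace (0 * z / 24)%C with (RtoC 0) by field. symmetry. apply e_0.
  - change (list_sum (v :: l)) with (v + list_sum l)%nat. rewrite plus_INR, RtoC_plus.
    replace ((INR v + INR (list_sum l)) * z / 24)%C with (INR v * z / 24 + INR (list_sum l) * z / 24)%C by field.
    rewrite e_plus, <- IH. reflexivity.
Qed.

(** The factors q^(v / 24) of the eta functions collect to q^n with
    n = ell sigma(N) / 24, an integer by the choice of ell. *)
Lemma Delta_q_factor ps : distinct_primes ps ->
  exists n a, (0 < n)%nat /\ abs_power_series a /\
    forall z, UHP z -> exists l, clim (csum (fun m => a m * e z ^ m)%C) l /\ Delta_of ps z = (e z ^ n * l)%C.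
Proof.
  intros H. destruct (weight_facts _ H) as [_ [_ [_ [_ [[n En] [_ L0]]]]]].
  set (l := ellN (length ps) (prod_list ps)) in *. set (N := prod_list ps) in *.
  assert (N0 : (0 < N)%nat) by now apply prod_list_pos.
  assert (Pos : forall v, In v (divisors N) -> (0 < v)%nat).
  { intros v Hv. unfold divisors in Hv. apply filter_In in Hv. destruct Hv as [Hv _]. apply in_seq in Hv. lia. }
  assert (S0 : (0 < Defs.sigma N)%nat).
  { unfold Defs.sigma. assert (H1 : In 1%nat (divisors N)).
    { unfold divisors. apply filter_In. split; [apply in_seq; lia|]. rewrite Nat.mod_1_r. reflexivity. }
    revert H1. generalize (divisors N). intros k. induction k as [|v k IH]; intros Hk; [contradiction|].
    change (list_sum (v :: k)) with (v + list_sum k)%nat. destruct Hk as [->|Hk]; [lia|]. specialize (IH Hk). lia. }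
  destruct (power_series_list (divisors N) Pos) as [a Ha].
  destruct (has_power_series_pow _ a l Ha) as [b [Hb1 Hb2]].
  exists n, b. split; [nia|]. split; auto. intros z Hz.
  exists (iter_op Cmult 1%C (divisors N) (fun v => eprod_inf (INR v * z)) ^ l)%C. split; [now apply Hb2|].
  unfold Delta_of, DeltaN. fold N l.
  replace (fold_right (fun v w => v * w)%C 1%C (map (fun v => eta (INR v * z)) (divisors N))) with
    (iter_op Cmult 1%C (divisors N) (fun v => e (INR v * z / 24) * eprod_inf (INR v * z))%C).
  - rewrite iter_op_op by apply comm_monoid_Cmult. rewrite e_list_sum, Cpow_mult_l. f_equal.
    rewrite <- !e_nat_mul. f_equal. fold (Defs.sigma N).
    replace (INR l * (INR (Defs.sigma N) * z / 24))%C with (RtoC (INR (l * Defs.sigma N)) * z / 24)%C.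
    + rewrite En, mult_INR, RtoC_mult. simpl (INR 24).
      replace (1 + 1 + 1 + 1 + 1 + 1 + 1 + 1 + 1 + 1 + 1 + 1 + 1 + 1 + 1 + 1 + 1 + 1 + 1 + 1 + 1 + 1 + 1 + 1) with 24 by ring.
      field.
    + rewrite mult_INR, RtoC_mult. field.
  - unfold iter_op. generalize (divisors N). intros k. induction k as [|v k IH]; simpl; [reflexivity|].
    rewrite IH. reflexivity.
Qed.

Lemma sum_n_csum (u : nat -> C) n : sum_n (G := C_AbelianMonoid) u n = csum u (S n).
Proof.
  induction n as [|n IH].
  - rewrite sum_O. simpl. now rewrite Cplus_0_l.
  - rewrite sum_Sn, IH. reflexivity.
Qed.

Lemma Delta_q_expansion ps : distinct_primes ps ->
  exists c : Z -> C, has_qexp (Delta_of ps) c /\ forall n : Z, (n <= 0)%Z -> c n = 0%C.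
Proof.
  intros H. destruct (Delta_q_factor ps H) as [n [a [n0 [_ Ha]]]].
  exists (fun k => if (k <? Z.of_nat n)%Z then RtoC 0 else a (Z.to_nat (k - Z.of_nat n))). split.
  - exists O. split.
    + intros k Hk. replace (k <? Z.of_nat n)%Z with true by (symmetry; apply Z.ltb_lt; lia). reflexivity.
    + intros z Hz. destruct (Ha z Hz) as [l [Hl ->]].
      pose proof (clim_shift a (e z) l n Hl) as L.
      unfold is_series. apply (filterlim_ext (fun N => csum (fun m => (if (n <=? m)%nat then a (m - n)%nat else 0) * e z ^ m)%C (S N))).
      * intros N. rewrite sum_n_csum. apply csum_ext. intros j. cbv zeta.
        rewrite Z.sub_0_r, <- INR_IZR_INZ, e_nat_mul. f_equal.
        destruct (Nat.leb_spec n j) as [G|G], (Z.ltb_spec (Z.of_nat j) (Z.of_nat n)); try lia; [|reflexivity].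
        f_equal. lia.
      * apply clim_filterlim. apply (clim_comp _ _ S); [intros; lia|exact L].
  - intros k Hk. replace (k <? Z.of_nat n)%Z with true by (symmetry; apply Z.ltb_lt; lia). reflexivity.
Qed.

(** * Conclusion *)

Lemma UHP_nat_mul v z : (0 < v)%nat -> UHP z -> UHP (INR v * z).
Proof.
  intros Hv Hz. unfold UHP in *. rewrite im_scal_l. apply Rmult_lt_0_compat; auto. now apply lt_0_INR.
Qed.

Lemma cder_pow f z l n : cder f z l -> exists m, cder (fun w => f w ^ n)%C z m.
Proof.
  intros H. induction n as [|n [m Hm]]; [eexists; apply (cder_const 1)|].
  eexists. apply (cder_mult f (fun w => f w ^ n)%C); eassumption.
Qed.

Lemma Delta_holomorphic ps z : distinct_primes ps -> UHP z -> exists l, cder (Delta_of ps) z l.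
Proof.
  intros H Hz.
  assert (P : exists l, cder (eta_prod ps) z l).
  { unfold eta_prod. assert (Pos : forall v, In v (divs ps) -> (0 < v)%nat) by (intros v; now apply divs_pos).
    revert Pos. generalize (divs ps). intros k. induction k as [|v k IH]; intros Pos.
    - eexists. apply (cder_const 1).
    - destruct IH as [m Hm]; [intros; apply Pos; simpl; auto|].
      destruct (cder_eta _ (UHP_nat_mul v z (Pos v (or_introl eq_refl)) Hz)) as [H1 [_ D]].
      eexists. apply (cder_mult (fun w => eta (INR v * w)) _ _ _ _ (cder_comp eta (fun w => INR v * w)%C _ _ _ (cder_scal (INR v) (fun w => w) _ _ (cder_id z)) D) Hm). }
  destruct P as [l P]. destruct (cder_pow _ z l (ellN (length ps) (prod_list ps)) P) as [m Hm].
  exists m. revert Hm. apply cder_ext. intros w. symmetry. now apply DeltaN_eta_prod.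
Qed.

Lemma Delta_neq_0 ps z : distinct_primes ps -> UHP z -> Delta_of ps z <> 0%C.
Proof.
  intros H Hz. unfold Delta_of. rewrite DeltaN_eta_prod by exact H. apply Cpow_nz. unfold eta_prod.
  assert (Pos : forall v, In v (divs ps) -> (0 < v)%nat) by (intros v; now apply divs_pos).
  revert Pos. generalize (divs ps). intros k. induction k as [|v k IH]; intros Pos; [apply C1_nz|].
  apply Cmult_neq_0.
  - apply eta_neq_0, UHP_nat_mul; auto. apply Pos; simpl; auto.
  - apply IH. intros; apply Pos; simpl; auto.
Qed.

Theorem theorem16 (N : nat) (ps : list nat)
  (hprime : forall p : nat, In p ps -> prime (Z.of_nat p))
  (hdistinct : NoDup ps)
  (hN : N = fold_right Nat.mul 1%nat ps) :
  let r := length ps in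
  holomorphic_form N (weightN r N) (DeltaN r N) /\
  vanishes_only_at_cusp (DeltaN r N).
Proof.
  intros r. subst N. assert (H : distinct_primes ps) by (split; assumption).
  fold (prod_list ps). change (DeltaN r (prod_list ps)) with (Delta_of ps).
  destruct (Delta_q_expansion ps H) as [c [Hc Hc0]].
  split; [split; [|split]|split].
  - intros z Hz. destruct (Delta_holomorphic ps z H Hz) as [l Hl]. now apply cder_ex_derive in Hl.
  - intros g z Hg Hz. now apply Delta_modular.
  - now exists c.
  - now exists c.
  - intros z Hz. now apply Delta_neq_0.
Qed.
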